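(* Let $(X_t,\mathcal{F}_t,\mathbf{P}^{\theta}_x)_{\theta\in\mathbb{R}}$ be a parametric family of recurrent strong Markov processes on the canonical space described in the context, fix $\theta^*\in\mathbb{R}$, a probability measure $\mu$ on $S$, and $\mathbf{P}=\int\mathbf{P}^{\theta^*}_x\,d\mu(x)$. Let $Y\colon(\Omega,\mathcal{F}_{\tau_2})\to(\mathbb{R},\mathcal{B}(\mathbb{R}))$ be measurable, bounded below, with $Y\in\bigcap_{d\in\mathtt{D}}L^2(\mathbf{P}_d)$ (where $\mathbf{P}_d=\mathbf{P}^{\theta^*}_d$). Let $Y_2=Y$ and $Y_n=Y\circ\mathrm{sh}_{\tau_{n-1}}$ for $n\ge3$. Let $\eta(\theta,d)=\mathbf{E}^{\theta}_d(Y)$ for $\theta\in\mathbb{R}$, $d\in\mathtt{D}$, and assume: (N1) for each $d\in\mathtt{D}$, $\eta(\cdot,d)$ is strictly monotone and twice continuously differentiable with non-vanishing derivative; (N2) there are $L,L'>0$ with $|\eta(\theta,d)-\eta(\theta^*,d)|\le L|\theta-\theta^*|+L'$ for all $\theta\in\mathbb{R}$, $d\in\mathtt{D}$. Let $V(\theta,d,y)=y-\eta(\theta,d)$, $\alpha(d)=-\frac{\partial\eta}{\partial\theta}(\theta^*,d)$, and let $(\Theta^N_n)$ be an $(\mathcal{F}_{\tau_n})$-adapted sequence with $\mathbf{E}((\Theta^N_1)^2)<\infty$ and $$\Theta^N_{n+1}=\Theta^N_n-\frac1n\,\frac{V(\Theta^N_n,X_{\tau_n},Y_{n+1})}{\alpha(X_{\tau_n})}.$$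 Then, under $\mathbf{P}$, $n^{1/2}(\Theta^N_n-\theta^* )$ is asymptotically normally distributed with mean zero and variance $$\sigma^2=\sum_{d\in\mathtt{D}}p_d\,\frac{\mathrm{Var}_d(Y)}{\alpha^2(d)}=\sum_{d\in\mathtt{D}}p_d\,\frac{\mathbf{E}_d(Y-\eta(\theta^*,d))^2}{\alpha^2(d)},$$ where $p=(p_d)$ is the left-fixed probability row vector of the Markov chain $(X_{\tau_n},\mathcal{F}_{\tau_n})$ under $\theta^*$.
   Context: $S$ is one of $\mathbb{R}$, $[0,\infty)$, $(0,\infty)$; $\Omega=C([0,\infty);S)$ with the topology of uniform convergence on compacts, $X_t$ the coordinate process, $\mathcal{F}_t=\sigma(X_u:u\le t)$, $\mathcal{F}_{t^+}=\bigcap_{\epsilon>0}\sigma(X_u:u\le t+\epsilon)$. $\mathtt{D}=\{d_1<\dots<d_s\}\subset S$ is finite ($s\ge2$); $\tau_1=\inf\{t\ge0:X_t\in\mathtt{D}\}$, $\tau_{n+1}=\inf\{t\ge\tau_n:X_t\in\mathtt{D}\setminus\{X_{\tau_n}\}\}$ (finite by recurrence). For a stopping time $\tau$, $\mathrm{sh}_\tau$ denotes the shift map $\mathrm{sh}_\tau(\omega)(\cdot)=\omega(\tau(\omega)+\cdot)$. $(X_{\tau_n})$ is a Markov chain on $\mathtt{D}$ whose transition matrix is irreducible; $p$ is its unique invariant probability row vector (all entries positive). *)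

(* Defs.v *)
From HB Require Import structures.
From mathcomp Require Import all_boot all_order all_algebra.
From mathcomp Require Import all_classical all_reals all_analysis measurable_realfun.
Set Implicit Arguments.
Unset Strict Implicit.
Unset Printing Implicit Defensive.
Import Order.TTheory GRing.Theory Num.Theory numFieldNormedType.Exports.
Local Open Scope classical_set_scope.
Local Open Scope ring_scope.

Inductive state_space := SpR | SpNonneg | SpPos.

Section PathSpace.
Context {R : realType} (s : state_space).

Definition Sset : set R :=
  match s with
  | SpR => setT
  | SpNonneg => [set x | 0 <= x]
  | SpPos => [set x | 0 < x]
  end.

(* A path in C([0,oo); S), represented on all of R by extending it
   constantly (= its value at 0) to negative times; continuity on R of the
   extension is equivalent to continuity on [0,oo) of the path. *)
Definition is_path (f : R -> R) : Prop :=
  (forall t, Sset (f t)) /\ (forall t, t < 0 -> f t = f 0) /\ continuous f.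

Definition Omega := {f : R -> R | `[< is_path f >]}.
HB.instance Definition _ := Choice.on Omega.

Lemma one_in_Sset : Sset 1.
Proof. rewrite /Sset; case: s => /=; by [| exact: ler01 | exact: ltr01]. Qed.

Lemma cst1_path : `[< is_path (fun _ => 1) >].
Proof.
apply/asboolP; split; first by move=> _; exact: one_in_Sset.
by split => //; exact: cst_continuous.
Qed.

HB.instance Definition _ :=
  isPointed.Build Omega (exist (fun f => `[< is_path f >]) (fun _ => 1) cst1_path).

Definition Xc (t : R) (w : Omega) : R := val w t.

Definition coord_gen (I : set R) : set (set Omega) :=
  fun A => exists u, I u /\ exists B : set R, measurable B /\ A = Xc u @^-1` B.

Definition Fall : set (set Omega) := <<s coord_gen [set u | 0 <= u] >>.

Definition path_space := g_sigma_algebraType (coord_gen [set u | 0 <= u]).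

Definition Ft (t : R) : set (set Omega) := <<s coord_gen [set u | 0 <= u <= t] >>.

Definition Ftplus (t : R) : set (set Omega) :=
  fun A => forall e : R, 0 < e -> Ft (t + e) A.

Definition stopping_time (tau : Omega -> \bar R) : Prop :=
  (forall w, (0 <= tau w)%E) /\
  forall t, 0 <= t -> Ftplus t [set w | (tau w <= t%:E)%E].

Definition F_at (tau : Omega -> \bar R) : set (set Omega) :=
  fun A => Fall A /\
    forall t, 0 <= t -> Ftplus t (A `&` [set w | (tau w <= t%:E)%E]).

(* X_tau (with an irrelevant fallback value on {tau = +oo}) *)
Definition Xat (tau : Omega -> \bar R) (w : Omega) : R :=
  if tau w is r%:E then val w r else val w 0.

(* the shift_at sh_tau (with an irrelevant fallback on {tau = +oo});
   for finite tau, t |-> w (tau + max t 0) is always a path, so insubd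
   returns it *)
Definition shift_at (tau : Omega -> \bar R) (w : Omega) : Omega :=
  if tau w is r%:E then insubd w (fun t => val w (r + Num.max t 0)) else w.

Definition tau1 (D : seq R) (w : Omega) : \bar R :=
  ereal_inf [set t%:E | t in [set t | 0 <= t /\ val w t \in D]].

Definition tau_next (D : seq R) (tau : Omega -> \bar R) (w : Omega) : \bar R :=
  ereal_inf [set t%:E | t in [set t | (tau w <= t%:E)%E /\
     val w t \in D /\ val w t != Xat tau w]].

Fixpoint tau_aux (D : seq R) (n : nat) : Omega -> \bar R :=
  match n with
  | 0 => tau1 D
  | m.+1 => tau_next D (tau_aux D m)
  end.

(* tau D n = tau_n, for n >= 1 *)
Definition tau (D : seq R) (n : nat) : Omega -> \bar R := tau_aux D n.-1.

Definition Yn (D : seq R) (Y : Omega -> R) (n : nat) (w : Omega) : R :=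
  if (n <= 2)%N then Y w else Y (shift_at (tau D n.-1) w).

Definition recurrent_strong_markov_family
    (P : R -> R -> probability path_space R) : Prop :=
  (forall th x, Sset x -> P th x [set w | Xc 0 w = x] = 1%E) /\
  (forall th (A : set path_space), measurable A ->
     measurable_fun Sset ((fun x => P th x A) : R -> \bar R)) /\
  (forall th x, Sset x ->
   forall tau0, stopping_time tau0 ->
   forall (A : set path_space), measurable A ->
   forall B, F_at tau0 B ->
     P th x (B `&` [set w | (tau0 w < +oo)%E] `&` (shift_at tau0 @^-1` A)) =
     (\int[P th x]_(w in B `&` [set w | (tau0 w < +oo)%E])
        P th (Xat tau0 w) A)%E) /\
  (forall th x y, Sset x -> Sset y ->
     P th x [set w | exists t, 0 <= t /\ Xc t w = y] = 1%E).

End PathSpace.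

Section Model.
Context {R : realType} {s : state_space}
  (P : R -> R -> probability (@path_space R s) R) (Y : @Omega R s -> R).

Definition etaY (th d : R) : R := fine (\int[P th d]_w (Y w)%:E).

Definition alpha (thstar d : R) : R := - derive1 (fun th => etaY th d) thstar.

Definition Var_d (thstar d : R) : R :=
  fine (\int[P thstar d]_w ((Y w - etaY thstar d) ^+ 2)%:E).

(* transition matrix of the embedded chain (X_{tau_n}) under theta* *)
Definition Qmat (D : seq R) (thstar d d' : R) : R :=
  fine (P thstar d [set w | Xat (tau D 2) w = d']).

Definition sigma2 (D : seq R) (p : R -> R) (thstar : R) : R :=
  \sum_(d <- D) p d * (Var_d thstar d / (alpha thstar d) ^+ 2).

End Model.

Section Reg.
Context {R : realType}.
Definition strictly_monotone (f : R -> R) : Prop :=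
  (forall x y, x < y -> f x < f y) \/ (forall x y, x < y -> f y < f x).

Definition C2 (f : R -> R) : Prop :=
  (forall x, derivable f x 1) /\
  (forall x, derivable (derive1 f) x 1) /\
  continuous (derive1 (derive1 f)).
End Reg.

(* Main.v *)
Require Import Defs.
From HB Require Import structures.
From mathcomp Require Import all_boot all_order all_algebra.
From mathcomp Require Import all_classical all_reals all_analysis measurable_realfun.
From mathcomp Require Import ring lra.
Set Implicit Arguments.
Unset Strict Implicit.
Unset Printing Implicit Defensive.
Import Order.TTheory GRing.Theory Num.Theory numFieldNormedType.Exports.
Local Open Scope classical_set_scope.
Local Open Scope ring_scope.

(* Write e_n = Theta_n - theta* and eta' for the derivative of eta in theta.
   The recursion reads n (e_{n+1} - e_n) = - (g(X_{tau_n}, e_n) + xi_{n+1}) with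
   g(d, x) = (eta(theta* + x, d) - eta(theta*, d)) / eta'(theta*, d), which has
   the sign of x and is x + O(x^2), and
   xi_{n+1} = (Y o sh_{tau_n} - eta(theta*, X_{tau_n})) / alpha(X_{tau_n}), which
   is conditionally centred by the strong Markov property. Summing,
   n e_{n+1} = e_2 - sum_k (g(X_{tau_k}, e_k) - e_k) - sum_k xi_{k+1}.

   A Lyapunov estimate shows that e_m is small with large probability for some
   late m; from there on, E e_k^2 = O(1/k) on an event of probability close to 1
   on which e stays small, so the sum of the g - e is O(log n), negligible
   against sqrt n. For the sum S_n of the xi, E cos(h S_n + c) obeys a
   closed one-step recursion once it is corrected by a solution u of the
   Poisson equation u - Q u = v - <p, v> of the embedded chain, v being the
   conditional variance of xi; this gives the Gaussian characteristic function.
   The Poisson equation is solvable because the harmonic functions of Q are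
   constant: a path visits every point of D, and the times tau_n exhaust the
   half-line. Cosines suffice as test functions since bounded continuous
   functions are approximated on compacts by polynomials in sin (l x). *)

(** The obstacle is that [g] may flatten out at infinity: nothing bounds its slope from below there,
    so [E e_n^2] admits no global contraction. The drift is therefore exploited in two forms. Far
    from 0 only its sign counts, together with the divergence of the sum of the steps [1/n]. Near 0,
    where [g] is close to the identity, [e^2] contracts by [1 - 5/4 gam] at a step of size [gam]; a
    rate above 1 is what yields the order [1/k] instead of a slower power.

    The free phase [c] in [cos (l x + c)] replaces complex exponentials: [c = 0] and [c = - pi / 2]
    give real and imaginary parts, and the family is stable under the addition formulas, so that one
    real recursion suffices.

    Conditional expectations are never formed; they enter as identities between integrals over
    events of the past. Everything is carried out under [P_x] for a fixed starting point. The limit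
    does not depend on [x], hence the initial law is integrated out at the very end, by dominated
    convergence. *)

Lemma norm_cos_le1 (R : realType) (x : R) : `|cos x| <= 1.
Proof. by rewrite ler_norml cos_geN1 cos_le1. Qed.

Lemma norm_sin_le1 (R : realType) (x : R) : `|sin x| <= 1.
Proof. by rewrite ler_norml sin_geN1 sin_le1. Qed.

Lemma continuous_affine (R : realType) (a b : R) : continuous (fun x : R => a * x + b).
Proof.
move=> x; apply: cvgD; last exact: cvg_cst.
by apply: cvgM; [exact: cvg_cst|exact: cvg_id].
Qed.

Lemma continuous_cos_affine (R : realType) (a b : R) :
  continuous (fun x : R => cos (a * x + b)).
Proof.
by move=> x; apply: (continuous_comp (@continuous_affine R a b x)); exact: continuous_cos.
Qed.

(** * Real integrable functions and expectations *)

Notation L1 mu f := (integrable mu setT (EFin \o f)).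

Section real_integrable_functions.
Context d (T : measurableType d) (R : realType) (mu : {measure set T -> \bar R}).
Implicit Types f g : T -> R.

Lemma L1_measurable f : L1 mu f -> measurable_fun setT f.
Proof. by move=> /measurable_int/measurable_EFinP. Qed.

Lemma L1D f g : L1 mu f -> L1 mu g -> L1 mu (fun x => f x + g x).
Proof.
move=> hf hg; have := integrableD measurableT hf hg.
by apply: eq_integrable => // x _ /=; rewrite EFinD.
Qed.

Lemma L1Zl (c : R) f : L1 mu f -> L1 mu (fun x => c * f x).
Proof.
move=> hf; have := integrableZl measurableT c hf.
by apply: eq_integrable => // x _ /=; rewrite EFinM.
Qed.

Lemma L1B f g : L1 mu f -> L1 mu g -> L1 mu (fun x => f x - g x).
Proof.
move=> hf hg; have := integrableB measurableT hf hg.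
by apply: eq_integrable => // x _ /=; rewrite EFinB.
Qed.

Lemma L1_le f g : measurable_fun setT f -> L1 mu g ->
  (forall x, `|f x| <= g x) -> L1 mu f.
Proof.
move=> mf ig fg; apply: (le_integrable _ _ _ ig) => //=.
  exact/measurable_EFinP.
by move=> x _; rewrite lee_fin (le_trans (fg x))// ler_norm.
Qed.

Lemma L1_abs f : L1 mu f -> L1 mu (fun x => `|f x|).
Proof. by move=> /integrable_norm. Qed.

End real_integrable_functions.

Section probability_expectation.
Context d (T : measurableType d) (R : realType) (Pr : probability T R).
Implicit Types f g : T -> R.
Local Notation L f := (L1 Pr f).
Local Notation "'E[' f ]" := (Rintegral Pr setT f).

Lemma L1_bounded f (M : R) : measurable_fun setT f ->
  (forall x, `|f x| <= M) -> L f.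
Proof.
move=> mf fM; apply: (L1_le (g := cst M)) => //.
by apply: finite_measure_integrable_cst.
Qed.

Lemma L1_cst (c : R) : L (cst c).
Proof. exact: finite_measure_integrable_cst. Qed.

Lemma L1_sqr f : measurable_fun setT f -> L (fun x => f x ^+ 2) -> L f.
Proof.
move=> mf if2; apply: (L1_le mf (L1D (L1_cst 1) if2)) => w.
have := sqr_ge0 (`|f w| - 1); rewrite -[f w ^+ 2]real_normK ?num_real//=.
by have := normr_ge0 (f w); nra.
Qed.

(** Up to the factor [3 h^2] this is the bound on the second order Taylor error of the cosine for an
    increment [h f]. Being at most [f^2], it asks for second moments only. *)
Lemma L1_min_cube f (h : R) : measurable_fun setT f -> L (fun x => f x ^+ 2) ->
  L (fun x => Num.min (`|h| * `|f x| ^+ 3) (f x ^+ 2)).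
Proof.
move=> mf if2; apply: (L1_le _ if2).
  apply: measurable_minr; last exact: measurable_funX.
  apply: measurable_funM => //; apply: measurable_funX.
  exact: (measurableT_comp (@normr_measurable R setT)).
move=> w; rewrite ger0_norm ?ge_min ?lexx ?orbT// le_min sqr_ge0.
by rewrite mulr_ge0// exprn_ge0.
Qed.

Lemma L1M_bounded f g (M : R) : L f -> measurable_fun setT g ->
  (forall x, `|g x| <= M) -> L (fun x => g x * f x).
Proof.
move=> hf mg gM; apply: (L1_le (g := fun x => M * `|f x|)).
- by apply: measurable_funM => //; exact: L1_measurable hf.
- by apply: L1Zl; exact: L1_abs.
- by move=> x; rewrite normrM ler_wpM2r.
Qed.

Lemma L1_indicM f (A : set T) : L f -> measurable A -> L (fun x => \1_A x * f x).
Proof.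
move=> hf mA; apply: (L1M_bounded (M := 1)) => //.
by move=> x; rewrite indicE; case: (_ \in _); rewrite ?normr0 ?normr1.
Qed.

Lemma ExpD f g : L f -> L g -> E[fun x => f x + g x] = E[f] + E[g].
Proof. by move=> *; rewrite RintegralD. Qed.

Lemma ExpB f g : L f -> L g -> E[fun x => f x - g x] = E[f] - E[g].
Proof. by move=> *; rewrite RintegralB. Qed.

Lemma ExpZl (c : R) f : L f -> E[fun x => c * f x] = c * E[f].
Proof. by move=> *; rewrite RintegralZl. Qed.

Lemma Exp_cst (c : R) : E[cst c] = c.
Proof. by rewrite /cst Rintegral_cst//= probability_setT mulr1. Qed.

Lemma Exp_le f g : L f -> L g -> (forall x, f x <= g x) -> E[f] <= E[g].
Proof. by move=> *; apply: le_Rintegral. Qed.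

Lemma Exp_ge0 f : (forall x, 0 <= f x) -> 0 <= E[f].
Proof. by move=> *; apply: Rintegral_ge0. Qed.

Lemma Exp_abs_le f g : L f -> L g -> (forall x, `|f x| <= g x) -> `|E[f]| <= E[g].
Proof.
move=> hf hg fg; apply: le_trans (le_normr_Rintegral measurableT hf) _.
by apply: Exp_le => //; exact: L1_abs.
Qed.

Lemma Exp_indic (A : set T) : measurable A -> E[\1_A] = fine (Pr A).
Proof. by move=> mA; rewrite /Rintegral integral_indic// setIT. Qed.

Lemma L1_indic (A : set T) : measurable A -> L (\1_A : T -> R).
Proof.
move=> mA; apply: (L1_bounded (M := 1)) => //.
by move=> x; rewrite indicE; case: (_ \in _); rewrite ?normr0 ?normr1.
Qed.

Lemma L1_sum (I : Type) (s : seq I) (P : pred I) (F : I -> T -> R) :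
  (forall i, L (F i)) -> L (fun x => \sum_(i <- s | P i) F i x).
Proof.
move=> h; elim: s => [|a s ih].
  have -> : (fun x => \sum_(i <- [::] | P i) F i x) = cst 0.
    by apply/funext => x; rewrite big_nil.
  exact: L1_cst.
case Pa : (P a); last first.
  by under eq_fun do rewrite big_cons Pa.
by under eq_fun do rewrite big_cons Pa; apply: L1D.
Qed.

Lemma Exp_sum (I : Type) (s : seq I) (P : pred I) (F : I -> T -> R) :
  (forall i, L (F i)) ->
  E[fun x => \sum_(i <- s | P i) F i x] = \sum_(i <- s | P i) E[F i].
Proof.
move=> h; elim: s => [|a s ih].
  have -> : (fun x => \sum_(i <- [::] | P i) F i x) = cst 0.
    by apply/funext => x; rewrite big_nil.
  by rewrite big_nil Exp_cst.
rewrite big_cons; case Pa : (P a); last first.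
  by under eq_fun do rewrite big_cons Pa.
under eq_fun do rewrite big_cons Pa; rewrite ExpD ?ih//.
exact: L1_sum.
Qed.

Lemma Exp_eq_EFin f : L f -> (\int[Pr]_x (f x)%:E)%E = (E[f])%:E.
Proof. by move=> hf; rewrite fineK//; exact: integrable_fin_num. Qed.

End probability_expectation.

Arguments L1_bounded {d T R Pr f M}.
Arguments L1_indic {d T R Pr A}.
Arguments L1_cst {d T R Pr}.

Lemma measurable_norm_gt d (T : measurableType d) (R : realType) (V : T -> R) (M : R) :
  measurable_fun setT V -> measurable [set w | M < `|V w|].
Proof.
move=> mV.
rewrite [X in measurable X](_ : _ = setT `&` (fun w => `|V w|) @^-1` `]M, +oo[%classic).
  by apply: (measurableT_comp (@normr_measurable R setT) mV).
by apply/seteqP; split => w /=; rewrite in_itv/= andbT// => -[].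
Qed.

(** * Weierstrass approximation by Bernstein polynomials *)

Lemma unif_continuous_itv (R : realType) (F : R -> R) (a b : R) :
  continuous F -> forall eps : R, 0 < eps -> exists2 del : R, 0 < del &
  forall x y : R, a <= x <= b -> `|x - y| < del -> `|F x - F y| <= eps.
Proof.
move=> cF eps eps0.
have /compact_near_coveringP cpt : compact `[a, b]%classic := @segment_compact R a b.
(* Compactness as a near-covering property: the modulus is a parameter tending to [0] from the
   right, and one value of it serves all [x] at once. *)
have := cpt R (0 : R)^'+ (fun d x => forall y, `|x - y| < d -> `|F x - F y| <= eps) _.
case.
  move=> x _; have e2 : 0 < eps / 2 by lra.
  have /cvgrPdist_lt/(_ _ e2) [d /= d0 Hd] := cF x.
  exists (ball x (d / 2), [set t | 0 < t < d / 2]) => /=.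
    split; first by apply: nbhsx_ballx; lra.
    have : \forall t \near (0 : R)^'+, 0 < t < d / 2.
      near=> t; apply/andP; split; near: t; first exact: nbhs_right_gt.
      by apply: nbhs_right_lt; lra.
    by [].
  move=> [u t] /= [xu] /andP[t0 td] y uy.
  have {}xu : `|x - u| < d / 2 by [].
  have h1 : `|F x - F u| < eps / 2.
    by apply: Hd => /=; apply: (lt_trans xu); lra.
  have h2 : `|F x - F y| < eps / 2.
    apply: Hd => /=.
    rewrite (_ : x - y = (x - u) + (u - y)); last by ring.
    by apply: (le_lt_trans (ler_normD _ _)); lra.
  rewrite (_ : F u - F y = (F x - F y) - (F x - F u)); last by ring.
  by apply: (le_trans (ler_normB _ _)); lra.
move=> d /= d0 Hd; exists (d / 2); first by lra.
move=> x y xab xy.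
have d2 : ball_ Num.norm 0 d (d / 2) by rewrite /ball_ /= sub0r normrN gtr0_norm; lra.
have d20 : 0 < d / 2 by lra.
by apply: (Hd _ d2 d20).
Unshelve. all: by end_near.
Qed.

Definition bern {R : realType} (n k : nat) (x : R) : R :=
  'C(n, k)%:R * x ^+ k * (1 - x) ^+ (n - k).

Lemma bern_ge0 (R : realType) n k (x : R) : 0 <= x <= 1 -> 0 <= bern n k x.
Proof.
by move=> /andP[x0 x1]; rewrite /bern !mulr_ge0 ?exprn_ge0 ?ler0n//; lra.
Qed.

Lemma sum_bern (R : realType) n (x : R) : \sum_(k < n.+1) bern n k x = 1.
Proof.
have := exprDn (1 - x) x n; rewrite subrK expr1n => ->.
by apply: eq_bigr => i _; rewrite /bern -mulrA mulr_natl [x ^+ _ * _]mulrC.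
Qed.

(** Here and in [sum_bern2], binomial moments from [k C(n, k) = n C(n - 1, k - 1)]. *)
Lemma sum_bern1 (R : realType) n (x : R) :
  \sum_(k < n.+1) k%:R * bern n k x = n%:R * x.
Proof.
case: n => [|n]; first by rewrite big_ord1 !mul0r.
rewrite big_ord_recl mul0r add0r.
transitivity (\sum_(k < n.+1) n.+1%:R * x * bern n k x); last first.
  by rewrite -mulr_sumr sum_bern mulr1.
apply: eq_bigr => i _; rewrite /bern lift0 subSS.
rewrite exprS !mulrA -natrM -mul_bin_diag natrM/=; ring.
Qed.

Lemma sum_bern2 (R : realType) n (x : R) :
  \sum_(k < n.+1) k%:R ^+ 2 * bern n k x =
  n%:R * x * (1 + n.-1%:R * x).
Proof.
case: n => [|n]; first by rewrite big_ord1 expr2 !mul0r.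
rewrite big_ord_recl expr2 !mul0r add0r.
transitivity (\sum_(k < n.+1) (n.+1%:R * x * bern n k x
    + n.+1%:R * x * (k%:R * bern n k x))); last first.
  by rewrite big_split/= -!mulr_sumr sum_bern sum_bern1 mulr1 mulrDr mulr1.
apply: eq_bigr => i _; rewrite /bern lift0 subSS.
have H : i.+1%:R * 'C(n.+1, i.+1)%:R = n.+1%:R * 'C(n, i)%:R :> R.
  by rewrite -!natrM -mul_bin_diag.
transitivity (i.+1%:R * (i.+1%:R * 'C(n.+1, i.+1)%:R) * x ^+ i.+1 * (1 - x) ^+ (n - i)).
  by ring.
rewrite H (_ : i.+1%:R = i%:R + 1 :> R); last by rewrite natr1.
by rewrite exprS; ring.
Qed.

Lemma sum_bern_var (R : realType) n (x : R) : 0 <= x <= 1 -> (0 < n)%N ->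
  \sum_(k < n.+1) (k%:R / n%:R - x) ^+ 2 * bern n k x <= n%:R^-1.
Proof.
move=> /andP[x0 x1] n0.
have nR : 0 < n%:R :> R by rewrite ltr0n.
have -> : \sum_(k < n.+1) (k%:R / n%:R - x) ^+ 2 * bern n k x =
  n%:R^-1 ^+ 2 * (\sum_(k < n.+1) k%:R ^+ 2 * bern n k x)
  - 2 * x / n%:R * (\sum_(k < n.+1) k%:R * bern n k x)
  + x ^+ 2 * (\sum_(k < n.+1) bern n k x).
  rewrite !mulr_sumr -sumrB -big_split/=; apply: eq_bigr => i _.
  by ring.
rewrite sum_bern sum_bern1 sum_bern2.
have -> : n.-1%:R = n%:R - 1 :> R by rewrite -{2}(prednK n0) -natr1; ring.
have -> : n%:R^-1 ^+ 2 * (n%:R * x * (1 + (n%:R - 1) * x)) - 2 * x / n%:R * (n%:R * x) + x ^+ 2 * 1 = n%:R^-1 * (x * (1 - x)) :> R.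
  by field; rewrite gt_eqF.
rewrite -[leRHS]mulr1 ler_wpM2l ?invr_ge0 ?ltW//; nra.
Qed.

(** Bernstein's argument: [F (k / n)] is within [eps / 2] of [F x] when [k / n] is within [del] of
    [x], and otherwise differs from it by at most [2 M <= K (k / n - x)^2]. The average costs
    [eps / 2] plus [K] times the variance, which is at most [1 / n]. *)
Lemma weierstrass01 (R : realType) (F : R -> R) : continuous F ->
  forall eps : R, 0 < eps -> exists p : {poly R},
  forall x : R, 0 <= x <= 1 -> `|p.[x] - F x| <= eps.
Proof.
move=> cF eps eps0.
have e2 : 0 < eps / 2 by lra.
have [del del0 Hdel] := unif_continuous_itv 0 1 cF e2.
have [M M0 HM] : exists2 M : R, 0 < M & forall x : R, 0 <= x <= 1 -> `|F x| <= M.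
  have cab : {within `[(0:R), 1], continuous (fun x => `|F x|)}.
    apply: continuous_subspaceT => x; apply: cvg_norm; exact: cF.
  have [c _ Hc] := EVT_max ler01 cab.
  exists (`|F c| + 1); first by have := normr_ge0 (F c); lra.
  move=> x x01; have := Hc x; rewrite in_itv/= => /(_ x01); lra.
pose K := 2 * M / del ^+ 2.
have K0 : 0 < K by rewrite /K divr_gt0 ?exprn_gt0//; lra.
have quad (x y : R) : 0 <= x <= 1 -> 0 <= y <= 1 ->
    `|F y - F x| <= eps / 2 + K * (y - x) ^+ 2.
  move=> x01 y01; case: (ltP `|x - y| del) => xy.
    have := Hdel x y x01 xy; rewrite distrC.
    have := sqr_ge0 (y - x); nra.
  have h : 1 <= (y - x) ^+ 2 / del ^+ 2.
    rewrite ler_pdivlMr ?exprn_gt0// mul1r -[leRHS]real_normK ?num_real//.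
    by rewrite distrC; apply: lerXn2r => //; rewrite nnegrE ltW.
  have := ler_normB (F y) (F x); have := HM _ x01; have := HM _ y01.
  rewrite /K -mulrA [del ^- 2 * _]mulrC; nra.
have [n n0 Hn] : exists2 n, (0 < n)%N & K / n%:R <= eps / 2.
  exists (Num.truncn (K / (eps / 2))).+1 => //.
  rewrite ler_pdivrMr ?ltr0n// mulrC -ler_pdivrMr//; apply: ltW.
  exact: truncnS_gt.
exists (\sum_(k < n.+1) (F (k%:R / n%:R) * 'C(n, k)%:R) *:
   ('X ^+ k * (1 - 'X) ^+ (n - k))) => x x01.
rewrite horner_sum.
have -> : \sum_(i < n.+1) ((F (i%:R / n%:R) * 'C(n, i)%:R) *:
   ('X ^+ i * (1 - 'X) ^+ (n - i))).[x] =
   \sum_(i < n.+1) F (i%:R / n%:R) * bern n i x.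
  by apply: eq_bigr => i _; rewrite !hornerE/= /bern ?mulrA.
have -> : F x = \sum_(i < n.+1) F x * bern n i x by rewrite -mulr_sumr sum_bern mulr1.
rewrite -sumrB.
apply: (le_trans (ler_norm_sum _ _ _)).
apply: (@le_trans _ _ (\sum_(i < n.+1) (eps / 2 * bern n i x +
   K * ((i%:R / n%:R - x) ^+ 2 * bern n i x)))).
  apply: ler_sum => i _.
  rewrite -mulrBl normrM (ger0_norm (bern_ge0 n i x01)) [K * _]mulrA -mulrDl.
  rewrite ler_wpM2r ?bern_ge0//; apply: quad => //.
  rewrite divr_ge0 ?ler0n//= ler_pdivrMr ?ltr0n// mul1r ler_nat.
  by rewrite -ltnS.
rewrite big_split/= -!mulr_sumr sum_bern mulr1.
have := sum_bern_var x01 n0.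
have : K * n%:R^-1 <= eps / 2 by [].
nra.
Qed.

(** * Gaussian characteristic function and cosine test functions *)

Section gaussian_characteristic_function.
Context {R : realType}.
Local Notation leb := (@lebesgue_measure R).
Local Notation phi := (@normal_pdf R 0 1).

Lemma normal_pdf01E (z : R) :
  phi z = @normal_peak R 1 * expR (- z ^+ 2 / 2).
Proof.
by rewrite normal_pdfE ?oner_neq0// /normal_fun subr0 expr1n -mulr_natr mul1r.
Qed.

Lemma is_derive_normal_pdf01 (z : R) : is_derive z 1 phi (- (z * phi z)).
Proof.
have -> : phi = fun z : R => @normal_peak R 1 * expR (- z ^+ 2 / 2).
  by apply/funext => x; rewrite normal_pdf01E.
have h : is_derive z 1 (fun z : R => - z ^+ 2 / 2) (- z).
  have -> : (fun z : R => - z ^+ 2 / 2) = (fun z : R => (- 2^-1) *: z ^+ 2).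
    by apply/funext => x; rewrite /GRing.scale/=; ring.
  by apply: is_derive_eq; rewrite /GRing.scale/= ?mulr1; field.
have := is_derive1_comp (f := expR) (g := fun z : R => - z ^+ 2 / 2) (x := z) (is_derive_expR _) h.
move=> h2.
have h3 := is_deriveZ (@normal_peak R 1) h2.
apply: (@is_derive_eq _ _ _ _ _ _ _ _ h3).
by rewrite /GRing.scale/=; ring.
Qed.

Lemma integrable_normal_pdf01 : leb.-integrable setT (EFin \o phi).
Proof. exact: integrable_normal_pdf. Qed.

Lemma integrable_normal_moment1 :
  leb.-integrable setT (EFin \o (fun z => `|z| * phi z)).
Proof.
(* The density with standard deviation [sqrt 2] decays like [exp (- z^2 / 4)], and the factor [|z|]
   is absorbed by [|z| <= 1 + z^2 / 4 <= exp (z^2 / 4)]. *)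
pose s : R := Num.sqrt 2.
have s0 : s != 0 by rewrite /s gt_eqF// sqrtr_gt0.
pose C := @normal_peak R 1 / @normal_peak R s.
have h := integrableZl (mu := leb) (f := fun x => (normal_pdf 0 s x)%:E) measurableT C (integrable_normal_pdf 0 s).
apply: (le_integrable _ _ _ h) => //=.
  apply/measurable_EFinP; apply: measurable_funM; last exact: measurable_normal_pdf.
  exact: normr_measurable.
move=> z _; rewrite lee_fin normal_pdf01E (normal_pdfE _ s0) /C /normal_fun subr0.
rewrite sqr_sqrtr//.
have p1 : 0 < @normal_peak R 1 by rewrite normal_peak_gt0 ?oner_neq0.
have ps : 0 < @normal_peak R s by rewrite normal_peak_gt0.
rewrite [X in _ <= `|X|]mulrA divfK ?gt_eqF//.
have p1' := ltW p1.
rewrite normrM normr_id [X in _ <= X]ger0_norm ?mulr_ge0 ?expR_ge0//.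
rewrite [`|_ * expR _|]ger0_norm ?mulr_ge0 ?expR_ge0//.
rewrite mulrCA ler_wpM2l//.
have -> : - z ^+ 2 / 2 = - z ^+ 2 / (2 *+ 2) - z ^+ 2 / (2 *+ 2).
  by rewrite -mulr_natr; field.
rewrite expRD mulrCA -[leRHS]mulr1 ler_wpM2l ?expR_ge0//.
rewrite expRN -[leRHS](@divff _ (expR (z ^+ 2 / (2 *+ 2)))) ?gt_eqF ?expR_gt0//.
rewrite ler_wpM2r ?invr_ge0 ?expR_ge0//.
apply: le_trans (expR_ge1Dx _).
rewrite -[z ^+ 2]real_normK ?num_real// -mulr_natr.
have := sqr_ge0 (`|z| / 2 - 1).
rewrite (_ : 2%:R * 2 = 4 :> R); last by ring.
nra.
Qed.

(* integrate the derivative of [sin (l z + c) phi z] over the line *)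
Lemma normal_sin_parts (l c : R) :
  \int[leb]_z (z * sin (l * z + c) * phi z) =
  l * \int[leb]_z (cos (l * z + c) * phi z).
Proof.
pose H (z : R) := sin (l * z + c) * phi z.
pose H' (z : R) := (l * cos (l * z + c) - z * sin (l * z + c)) * phi z.
have dH (z : R) : is_derive z 1 H (H' z).
  have h : is_derive z 1 (fun z : R => l * z + c) l.
    have -> : (fun z : R => l * z + c) = (fun z : R => l *: z + cst c z) by [].
    by apply: is_derive_eq; rewrite /GRing.scale/= ?mulr1 addr0.
  have h1 := is_derive1_comp (f := sin) (g := fun z : R => l * z + c) (x := z) (is_derive_sin _) h.
  have h2 := is_deriveM h1 (is_derive_normal_pdf01 z).
  apply: (@is_derive_eq _ _ _ _ _ _ _ _ h2).
  by rewrite /H' /GRing.scale/=; ring.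
have cphi : continuous phi by apply: continuous_normal_pdf; exact: oner_neq0.
have csin : continuous (fun z : R => sin (l * z + c)).
  by move=> z; apply: (continuous_comp (@continuous_affine R l c z)); exact: continuous_sin.
have ccos : continuous (fun z : R => cos (l * z + c)) by exact: continuous_cos_affine.
have cH' : continuous H'.
  move=> z; apply: cvgM; last exact: cphi.
  apply: cvgB; first by apply: cvgM; [exact: cvg_cst|exact: ccos].
  by apply: cvgM; [exact: cvg_id|exact: csin].
have cH : continuous H.
  by move=> z; apply: cvgM; [exact: csin|exact: cphi].
have i1 : leb.-integrable setT (EFin \o (fun z => cos (l * z + c) * phi z)).
  apply: (le_integrable _ _ _ integrable_normal_pdf01) => //=.
    apply/measurable_EFinP; apply: measurable_funM; last exact: measurable_normal_pdf.
    exact: continuous_measurable_fun.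
  move=> z _; rewrite lee_fin normrM ler_piMl//.
  by rewrite norm_cos_le1.
have i2 : leb.-integrable setT (EFin \o (fun z => z * sin (l * z + c) * phi z)).
  apply: (le_integrable _ _ _ integrable_normal_moment1) => //=.
    apply/measurable_EFinP; apply: measurable_funM; last exact: measurable_normal_pdf.
    by apply: measurable_funM => //; exact: continuous_measurable_fun.
  move=> z _; rewrite lee_fin !normrM normr_id ler_wpM2r// ler_piMr//.
  by rewrite norm_sin_le1.
have iH' : leb.-integrable setT (EFin \o H').
  have := L1B (L1Zl l i1) i2.
  by apply: eq_integrable => // z _ /=; rewrite /H'; congr EFin; ring.
suff : \int[leb]_z H' z = 0.
  rewrite (_ : H' = fun z => l * (cos (l * z + c) * phi z) - z * sin (l * z + c) * phi z); last first.
    by apply/funext => z; rewrite /H'; ring.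
  rewrite RintegralB//; last exact: L1Zl.
  by rewrite RintegralZl// => /eqP; rewrite subr_eq0 => /eqP/esym.
have peak0 : 0 < @normal_peak R 1 by rewrite normal_peak_gt0 ?oner_neq0.
have Hn (n : nat) : (\int[leb]_(x in `[(- n.+1%:R)%R, n.+1%:R]) (H' x)%:E = (H n.+1%:R - H (- n.+1%:R))%:E)%E.
  rewrite (@continuous_FTC2 _ H' H)//.
  - by apply: (@lt_trans _ _ 0); rewrite ?oppr_lt0 ltr0n.
  - exact: continuous_subspaceT.
  - split.
    + by move=> x _; have [] := dH x.
    + by apply: cvg_at_right_filter; exact: cH.
    + by apply: cvg_at_left_filter; exact: cH.
  - by move=> x _; rewrite derive1E; have [_ ->] := dH x.
have lim0 : (H n.+1%:R - H (- n.+1%:R)) @[n --> \oo] --> (0 : R).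
  have h : (2 * @normal_peak R 1) * harmonic n @[n --> \oo] --> (0 : R).
    by rewrite -[X in _ --> X](mulr0 (2 * @normal_peak R 1)); apply: cvgM; [exact: cvg_cst|exact: cvg_harmonic].
  apply: norm_cvg0.
  apply: (squeeze_cvgr _ (cvg_cst 0) h); near=> n.
  rewrite normr_ge0/=; apply: (le_trans (ler_normB _ _)).
  have b (x : R) : 1 <= `|x| -> `|H x| <= @normal_peak R 1 * `|x|^-1.
    move=> x1; rewrite /H normrM normal_pdf01E.
    apply: (@le_trans _ _ (`|@normal_peak R 1 * expR (- x ^+ 2 / 2)|)).
      by rewrite ler_piMl// norm_sin_le1.
    rewrite ger0_norm ?mulr_ge0 ?expR_ge0 ?(ltW peak0)// ler_wpM2l ?(ltW peak0)//.
    rewrite mulNr expRN lef_pV2 ?posrE ?expR_gt0//; last by rewrite (lt_le_trans ltr01).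
    apply: le_trans (expR_ge1Dx _); rewrite -[x ^+ 2]real_normK ?num_real//.
    by have := sqr_ge0 (`|x| - 1); nra.
  have := b n.+1%:R; have := b (- n.+1%:R); rewrite normrN !normr_nat ler1n.
  by move=> /(_ isT) h1 /(_ isT) h2; rewrite /harmonic/= -mulrA mulr_natl mulr2n lerD.
have lim1 : (\int[leb]_(x in `[(- n.+1%:R)%R, n.+1%:R]) (H' x)%:E)%E @[n --> \oo] --> (\int[leb]_x (H' x)%:E)%E.
  under eq_fun do rewrite integral_mkcond.
  apply: (@dominated_cvg _ _ _ leb setT measurableT _ _ (fun x => `|H' x|%:E)) => //=.
  - move=> n; apply/(measurable_restrictT _ _).1 => //; apply: measurable_funTS.
    by case/integrableP : iH'.
  - move=> x _; apply: cvg_near_cst; near=> n.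
    rewrite patchE; case: ifPn => //; rewrite notin_setE/= in_itv/=; case.
    rewrite -ler_norml; near: n; exists (Num.truncn `|x|) => // n /= xn.
    by rewrite ltW// (lt_le_trans (truncnS_gt _))// ler_nat ltnS.
  - by apply: L1_abs.
  - move=> n x _; rewrite patchE; case: ifPn => _; first by [].
    by rewrite (_ : point = 0%E)// abse0 lee_fin.
have lim2 : (\int[leb]_x (H' x)%:E = 0)%E.
  apply: (cvg_unique _ lim1) => //.
  rewrite /=; under eq_fun do rewrite Hn.
  by apply: cvg_EFin => //; exact: nearW.
by rewrite /Rintegral lim2.
Unshelve. all: by end_near.
Qed.

Definition gauss_cos (c l : R) := \int[leb]_z (cos (l * z + c) * phi z).

(** Differentiation under the integral, dominated by [|z| phi z], gives minus the integral of
    [z sin (l z + c) phi z]; [normal_sin_parts] closes this into a linear differential equation in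
    [l]. *)
Lemma is_derive_gauss_cos (c l : R) :
  is_derive l 1 (gauss_cos c) (- (l * gauss_cos c l)).
Proof.
pose f (x z : R) := cos (x * z + c) * phi z.
have df (x z : R) : is_derive x 1 (f ^~ z) (- (z * sin (x * z + c) * phi z)).
  have h : is_derive x 1 (fun x : R => x * z + c) z.
    have -> : (fun x : R => x * z + c) = (fun x : R => z *: x + cst c x).
      by apply/funext => y; rewrite /GRing.scale/= mulrC.
    by apply: is_derive_eq; rewrite /GRing.scale/= ?mulr1 addr0.
  have h1 := is_derive1_comp (f := cos) (g := fun x : R => x * z + c) (x := x) (is_derive_cos _) h.
  have h2 := is_deriveZ (phi z) h1.
  have -> : f ^~ z = phi z \*: (cos \o (fun x : R => x * z + c)).
    by apply/funext => y; rewrite /f /GRing.scale/= mulrC.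
  apply: (@is_derive_eq _ _ _ _ _ _ _ _ h2).
  by rewrite /GRing.scale/=; ring.
have mf (x : R) : L1 leb (f x).
  apply: (L1_le _ integrable_normal_pdf01) => /=.
    apply: measurable_funM; last exact: measurable_normal_pdf.
    by apply: continuous_measurable_fun; exact: continuous_cos_affine.
  move=> z; rewrite /f normrM [`|phi z|]ger0_norm ?normal_pdf_ge0// ler_piMl ?normal_pdf_ge0//.
  by rewrite norm_cos_le1.
have lI : (`](l - 1), (l + 1)[%classic : set R) l.
  by rewrite /= in_itv/=; apply/andP; split; lra.
have d1 (x z : R) : partial1of2 f x z = - (z * sin (x * z + c) * phi z).
  by rewrite partial1of2E; have [_ ->] := df x z.
have ub (x z : R) : `|partial1of2 f x z| <= `|z| * phi z.
  rewrite d1 normrN !normrM [`|phi z|]ger0_norm ?normal_pdf_ge0//.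
  by rewrite ler_wpM2r ?normal_pdf_ge0// ler_piMr// norm_sin_le1.
have gp (z : R) : 0 <= `|z| * phi z by rewrite mulr_ge0 ?normal_pdf_ge0.
have hd := @derivable_under_integral R _ _ leb f setT measurableT l (l - 1) (l + 1) lI
  (fun x _ => mf x) (fun x z _ _ => (let: DeriveDef a _ := df x z in a)) _ gp
  integrable_normal_moment1 (fun x z _ _ => ub x z).
have he := @differentiation_under_integral R _ _ leb f setT measurableT l (l - 1) (l + 1) lI
  (fun x _ => mf x) (fun x z _ _ => (let: DeriveDef a _ := df x z in a)) _ gp
  integrable_normal_moment1 (fun x z _ _ => ub x z).
apply: DeriveDef; first exact: hd.
rewrite -derive1E; apply: (eq_trans he).
under eq_Rintegral do rewrite d1.
rewrite -normal_sin_parts -[RHS]mulN1r -RintegralZl//.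
  by apply: eq_Rintegral => z _; rewrite mulN1r.
apply: (L1_le _ integrable_normal_moment1) => /=.
  apply: measurable_funM; last exact: measurable_normal_pdf.
  apply: measurable_funM => //.
  apply: continuous_measurable_fun => z; apply: (continuous_comp (@continuous_affine R l c z)).
  exact: continuous_sin.
by move=> z; have := ub l z; rewrite d1 normrN.
Qed.

(** The integrating factor [exp (x^2 / 2)] turns the solution of that equation into a constant,
    evaluated at [x = 0]. *)
Lemma gauss_cosE (c l : R) : gauss_cos c l = expR (- l ^+ 2 / 2) * cos c.
Proof.
pose G (x : R) := expR (x ^+ 2 / 2) * gauss_cos c x.
have dG (x : R) : is_derive x 1 G 0.
  have h : is_derive x 1 (fun z : R => z ^+ 2 / 2) x.
    have -> : (fun z : R => z ^+ 2 / 2) = (fun z : R => (2^-1) *: z ^+ 2).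
      by apply/funext => y; rewrite /GRing.scale/=; ring.
    by apply: is_derive_eq; rewrite /GRing.scale/= ?mulr1; field.
  have h1 := is_derive1_comp (f := expR) (g := fun z : R => z ^+ 2 / 2) (x := x) (is_derive_expR _) h.
  have h2 := is_deriveM h1 (is_derive_gauss_cos c x).
  apply: (@is_derive_eq _ _ _ _ _ _ _ _ h2).
  by rewrite /GRing.scale/=; ring.
have GE : G l = G 0 by apply: is_derive_0_is_cst.
move: GE; rewrite /G expr0n/= mul0r expR0 mul1r => GE.
have -> : gauss_cos c l = expR (- l ^+ 2 / 2) * gauss_cos c 0.
  by rewrite -GE mulrA -expRD mulNr addNr expR0 mul1r.
congr (_ * _); rewrite /gauss_cos.
under eq_Rintegral do rewrite mul0r add0r.
by rewrite RintegralZl ?integrable_normal_pdf01// /Rintegral integral_normal_pdf mulr1.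
Qed.

(** The change of variables formula yields the abstract Radon-Nikodym derivative; it agrees almost
    everywhere with the density because both have the same integral over every measurable set. *)
Lemma integral_normal_prob (f : R -> R) : L1 (@normal_prob R 0 1) f ->
  (\int[normal_prob 0 1]_z (f z)%:E = \int[leb]_z (f z * phi z)%:E)%E.
Proof.
move=> intf; have mf := L1_measurable intf.
rewrite -(Radon_Nikodym_change_of_variables (normal_prob_dominates 0 1))//=.
apply: ae_eq_integral => //.
- apply: emeasurable_funM; first exact/measurable_EFinP.
  apply: (measurable_int leb).
  by apply: Radon_Nikodym_integrable; exact: normal_prob_dominates.
- apply/measurable_EFinP; apply: measurable_funM => //.
  exact: measurable_normal_pdf.
- under [X in ae_eq _ _ _ X]eq_fun do rewrite EFinM.
  apply: ae_eqe_mul2l => /=.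
  rewrite Radon_NikodymE//=; first exact: normal_prob_dominates.
  move=> abmu.
  case: cid => /= h [h1 h2 h3].
  apply: integral_ae_eq => //=.
  + by apply/measurable_EFinP; exact: measurable_normal_pdf.
  + by move=> E E01 mE; rewrite -h3.
Qed.

Lemma integral_normal_cos (c l : R) :
  (\int[normal_prob 0 1]_z (cos (l * z + c))%:E = (expR (- l ^+ 2 / 2) * cos c)%:E)%E.
Proof.
have mc : continuous (fun z : R => cos (l * z + c)) by exact: continuous_cos_affine.
have bc (z : R) : `|cos (l * z + c)| <= 1 by rewrite norm_cos_le1.
have h : L1 (@normal_prob R 0 1) (fun z : R => cos (l * z + c)).
  apply: (@L1_bounded _ _ R (@normal_prob R 0 1) _ 1 _ bc); exact: continuous_measurable_fun.
rewrite integral_normal_prob// -gauss_cosE /gauss_cos /Rintegral fineK//.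
apply: integrable_fin_num => //.
apply: (L1_le _ integrable_normal_pdf01) => //=.
  apply: measurable_funM; last exact: measurable_normal_pdf.
  exact: continuous_measurable_fun.
move=> z; rewrite normrM [`|phi z|]ger0_norm ?normal_pdf_ge0// ler_piMl ?normal_pdf_ge0//.
Qed.

End gaussian_characteristic_function.

(** The frequency [1 / (2 M)] keeps the argument of the sine in [[-1/2, 1/2]] for [|x| <= M], where
    [asin] inverts it. The first conclusion controls the approximation off the compact: it stays
    near the range of [f], hence bounded independently of [M]. *)
Lemma sin_poly_approx (R : realType) (f : R -> R) : continuous f ->
  forall M eps : R, 0 < M -> 0 < eps -> exists (p : {poly R}),
  (forall x, exists y, `|p.[sin ((2 * M)^-1 * x)] - f y| <= eps) /\
  (forall x, `|x| <= M -> `|p.[sin ((2 * M)^-1 * x)] - f x| <= eps).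
Proof.
move=> cf M eps M0 eps0.
pose s : R := sin 2^-1.
have h12 : -(pi / 2) <= (2^-1 : R) <= pi / 2.
  by have := pihalf_ge1 R; move=> h; apply/andP; split; lra.
have hN12 : -(pi / 2) <= (- 2^-1 : R) <= pi / 2.
  by have := pihalf_ge1 R; move=> h; apply/andP; split; lra.
have s1 : s < 1.
  rewrite /s -[X in _ < X](@sin_pihalf R) ltr_sin ?in_itv//=; have := pihalf_ge1 R; lra.
have s0 : 0 < s.
  by rewrite /s; apply: sin_gt0_pihalf; have := pihalf_ge1 R; move=> h; apply/andP; split; lra.
(* Since [s = sin (1/2) < 1], clipping to [[- s, s]] keeps the argument of [asin] inside the open
   interval of continuity; [2 u - 1] maps [[0, 1]] onto the range of the sine. *)
pose clip (t : R) : R := Num.max (- s) (Num.min s t).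
have clipb t : - s <= clip t <= s.
  by rewrite /clip le_max lexx/= ge_max ge_min lexx/=; lra.
have clipK t : - s <= t <= s -> clip t = t.
  by move=> /andP[a b]; rewrite /clip min_r// max_r.
have cclip : continuous clip.
  move=> t; apply: (@continuous_max R R (cst (- s)) (fun t : R => Num.min s t)); first exact: cvg_cst.
  by apply: (@continuous_min R R (cst s) id); [exact: cvg_cst|exact: cvg_id].
pose F (u : R) := f (2 * M * asin (clip (2 * u - 1))).
have cF : continuous F.
  move=> u; apply: continuous_comp; last exact: cf.
  apply: cvgM; first exact: cvg_cst.
  apply: (@continuous_comp _ _ _ (fun u : R => clip (2 * u - 1)) asin).
    apply: (@continuous_comp _ _ _ (fun u : R => 2 * u - 1) clip); last exact: cclip.
    exact: continuous_affine.
  apply: continuous_asin; have := clipb (2 * u - 1); lra.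
have [q Hq] := weierstrass01 cF eps0.
exists (q \Po (2^-1 *: (1 + 'X))).
have E (x : R) : let u := (1 + sin ((2 * M)^-1 * x)) / 2 in
    `|(q \Po (2^-1 *: (1 + 'X))).[sin ((2 * M)^-1 * x)] - F u| <= eps.
  rewrite /= horner_comp !hornerE mulrC; apply: Hq.
  have := sin_geN1 ((2 * M)^-1 * x); have := sin_le1 ((2 * M)^-1 * x).
  by move=> a b; apply/andP; split; lra.
split=> x; first by eexists; exact: E.
move=> xM; have := E x; rewrite /= /F.
have -> : 2 * ((1 + sin ((2 * M)^-1 * x)) / 2) - 1 = sin ((2 * M)^-1 * x) by field.
have xb : - 2^-1 <= (2 * M)^-1 * x <= 2^-1.
  rewrite -ler_norml normrM ger0_norm ?invr_ge0; last by lra.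
  by rewrite mulrC ler_pdivrMr; lra.
have pi1 := pihalf_ge1 R.
rewrite clipK; last first.
  rewrite /s -sinN; apply/andP; split; rewrite leNgt ltr_sin ?in_itv//= -?leNgt; try (by lra); case/andP: xb => ? ?; apply/andP; split; lra.
rewrite sinK; last by rewrite in_itv/=; case/andP: xb => ? ?; apply/andP; split; lra.
by rewrite mulrA divff ?mul1r//; lra.
Qed.

Lemma rv_tight d (T : measurableType d) (R : realType) (Pr : probability T R)
    (W : T -> R) : measurable_fun setT W ->
  forall eps : R, 0 < eps -> exists M : R, fine (Pr [set w | M < `|W w|]) <= eps.
Proof.
move=> mW eps eps0.
have h := @nonincreasing_cvg_mu _ _ _ Pr (fun n => [set w | n%:R < `|W w|]).
have h0 : \bigcap_n [set w | n%:R < `|W w|] = set0.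
  apply/seteqP; split => w //= /(_ (Num.truncn `|W w|).+1 I) /=.
  by have := truncnS_gt `|W w|; move=> a b; have := lt_trans a b; rewrite ltxx.
rewrite h0 measure0 in h.
have {}h : (Pr \o (fun n : nat => [set w | n%:R < `|W w|])) x @[x --> \oo] --> 0%E.
  apply: h => //.
  - by rewrite (le_lt_trans (probability_le1 _ _)) ?ltry//; exact: measurable_norm_gt.
  - by move=> n; exact: measurable_norm_gt.
  - by move=> m n mn; apply/subsetPset => w /=; apply: le_lt_trans; rewrite ler_nat.
move: h => /fine_cvgP[_ /cvgrPdist_le /(_ _ eps0)] [n _ /(_ n (leqnn n))] /=.
by rewrite sub0r normrN => hn; exists n%:R; rewrite (le_trans (ler_norm _)).
Qed.

Section trigonometric_test_functions.
Context d (T : measurableType d) (R : realType) (Pr : probability T R).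
Context d' (T' : measurableType d') (N : probability T' R).
Variables (Z : nat -> T -> R) (W : T' -> R).
Hypothesis mZ : forall n, measurable_fun setT (Z n).
Hypothesis mW : measurable_fun setT W.
Local Notation "'E[' f ]" := (Rintegral Pr setT f).
Local Notation "'N[' f ]" := (Rintegral N setT f).

Hypothesis cvg_cos : forall l c : R,
  E[fun w => cos (l * Z n w + c)] @[n --> \oo] --> N[fun w => cos (l * W w + c)].

Hypothesis tight : forall eps : R, 0 < eps -> exists M : R, 
  \forall n \near \oo, fine (Pr [set w | M < `|Z n w|]) <= eps.

Definition conv_test (h : R -> R) :=
  E[fun w => h (Z n w)] @[n --> \oo] --> N[fun w => h (W w)].

(** Continuity and boundedness travel with the convergence because linearity of the expectations
    requires integrability. *)
Definition good_test (h : R -> R) :=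
  [/\ continuous h, exists M : R, forall x, `|h x| <= M & conv_test h].

Lemma good_test_L1 h : good_test h ->
  (forall n, L1 Pr (fun w => h (Z n w))) /\ L1 N (fun w => h (W w)).
Proof.
move=> [ch [M hM] _]; split => [n|].
  by apply: (L1_bounded (M := M)) => //; apply: measurableT_comp => //; exact: continuous_measurable_fun.
by apply: (L1_bounded (M := M)) => //; apply: measurableT_comp => //; exact: continuous_measurable_fun.
Qed.

Lemma good_testD h1 h2 : good_test h1 -> good_test h2 ->
  good_test (fun x => h1 x + h2 x).
Proof.
move=> g1 g2; have [i1 j1] := good_test_L1 g1; have [i2 j2] := good_test_L1 g2.
case: g1 g2 => [c1 [M1 b1] v1] [c2 [M2 b2] v2]; split.
- by move=> x; apply: cvgD; [exact: c1|exact: c2].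
- by exists (M1 + M2) => x; rewrite (le_trans (ler_normD _ _))// lerD.
- rewrite /conv_test RintegralD//.
  under eq_fun do rewrite RintegralD//.
  exact: cvgD.
Qed.

Lemma good_testZ (a : R) h : good_test h -> good_test (fun x => a * h x).
Proof.
move=> g1; have [i1 j1] := good_test_L1 g1.
case: g1 => [c1 [M1 b1] v1]; split.
- by move=> x; apply: cvgM; [exact: cvg_cst|exact: c1].
- by exists (`|a| * M1) => x; rewrite normrM ler_wpM2l.
- rewrite /conv_test RintegralZl//.
  under eq_fun do rewrite RintegralZl//.
  by apply: cvgM => //; exact: cvg_cst.
Qed.

Lemma good_test_cos (l c : R) : good_test (fun x => cos (l * x + c)).
Proof.
split.
- exact: continuous_cos_affine.
- by exists 1 => x; rewrite norm_cos_le1.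
- exact: cvg_cos.
Qed.

(** The product-to-sum formula trades one factor [sin (l x)] for a change of frequency and phase in
    the cosine; carrying a general cosine factor makes the induction close. *)
Lemma good_test_sinX (l : R) (j : nat) (m c : R) :
  good_test (fun x => sin (l * x) ^+ j * cos (m * x + c)).
Proof.
elim: j m c => [|j ih] m c.
  by under eq_fun do rewrite expr0 mul1r; exact: good_test_cos.
have -> : (fun x => sin (l * x) ^+ j.+1 * cos (m * x + c)) =
  (fun x => 2^-1 * (sin (l * x) ^+ j * cos ((l + m) * x + (c - pi / 2)) +
           (-1) * (sin (l * x) ^+ j * cos ((m - l) * x + (c - pi / 2))))).
  apply/funext => x.
  have e1 : cos ((l + m) * x + (c - pi / 2)) = sin (l * x + (m * x + c)).
    by rewrite -cosBpihalf; congr cos; ring.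
  have e2 : cos ((m - l) * x + (c - pi / 2)) = sin ((m * x + c) - l * x).
    by rewrite -cosBpihalf; congr cos; ring.
  by rewrite e1 e2 sinD sinB exprSr; field.
by apply: good_testZ; apply: good_testD; [exact: ih|apply: good_testZ; exact: ih].
Qed.

Lemma good_test_poly_sin (l : R) (p : {poly R}) :
  good_test (fun x => p.[sin (l * x)]).
Proof.
have -> : (fun x => p.[sin (l * x)]) =
    (fun x => \sum_(i < size p) p`_i * sin (l * x) ^+ i).
  by apply/funext => x; rewrite horner_coef.
elim: (size p) => [|n ih].
  have -> : (fun x => \sum_(i < 0) p`_i * sin (l * x) ^+ i) =
     (fun x : R => 0 * cos (0 * x + 0)).
    by apply/funext => x; rewrite big_ord0 mul0r.
  by apply: good_testZ; exact: good_test_cos.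
under eq_fun do rewrite big_ord_recr/=.
apply: good_testD => //; apply: good_testZ.
have := good_test_sinX l n 0 0.
by under eq_fun do rewrite mul0r add0r cos0 mulr1.
Qed.

(** The polynomial in the sine is within [e] of [f] on [[- M, M]] and within [e + 2 B] of it
    elsewhere, so the tails cost only [2 B] times a probability that tightness makes small. *)
Theorem cvg_of_cos (f : R -> R) : continuous f ->
  (exists B : R, forall x, `|f x| <= B) -> conv_test f.
Proof.
move=> cf [B fB].
have B0 : 0 <= B by rewrite (le_trans _ (fB 0)).
apply/cvgrPdist_le => eps eps0.
(* The three comparisons cost [e], [2 e] and [2 e]; the tail level [e'] satisfies [2 B e' <= e]. *)
pose e := eps / 8.
have e0 : 0 < e by rewrite /e; lra.
pose e' := e / (2 * B + 1).
have e'0 : 0 < e' by rewrite /e' divr_gt0//; lra.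
have [M1 tZ] := tight e'0.
have [M2 tW] := rv_tight N mW e'0.
pose M := Num.max 1 (Num.max M1 M2).
have M0 : 0 < M by rewrite /M lt_max ltr01.
have [p [pf1 pf2]] := sin_poly_approx cf M0 e0.
pose h x := p.[sin ((2 * M)^-1 * x)].
have gh : good_test h := good_test_poly_sin (2 * M)^-1 p.
have [ihZ ihW] := good_test_L1 gh.
have ifZ n : L1 Pr (fun w => f (Z n w)).
  by apply: (L1_bounded (M := B)) => //; apply: measurableT_comp => //; exact: continuous_measurable_fun.
have ifW : L1 N (fun w => f (W w)).
  by apply: (L1_bounded (M := B)) => //; apply: measurableT_comp => //; exact: continuous_measurable_fun.
have hf x : `|h x - f x| <= e + (2 * B) * (if M < `|x| then 1 else 0).
  case: ifPn => [_|]; last by rewrite -leNgt mulr0 addr0; exact: pf2.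
  have [y hy] := pf1 x.
  have -> : h x - f x = (h x - f y) + (f y - f x) by ring.
  rewrite (le_trans (ler_normD _ _))// lerD// mulr1.
  rewrite (le_trans (ler_normB _ _))//; have := fB y; have := fB x; lra.
have key d0 (T0 : measurableType d0) (Q : probability T0 R) (V : T0 -> R) :
    measurable_fun setT V -> L1 Q (fun w => h (V w)) -> L1 Q (fun w => f (V w)) ->
    fine (Q [set w | M < `|V w|]) <= e' ->
    `|Rintegral Q setT (fun w => h (V w)) - Rintegral Q setT (fun w => f (V w))| <= 2 * e.
  move=> mV i1 i2 q.
  rewrite -RintegralB//.
  have mAV := measurable_norm_gt M mV.
  have i3 : L1 Q (fun w => e + (2 * B) * \1_[set w | M < `|V w|] w).
    by apply: L1D; [exact: L1_cst|apply: L1Zl; exact: L1_indic].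
  apply: (le_trans (Exp_abs_le (L1B i1 i2) i3 _)).
    move=> w; apply: (le_trans (hf _)); rewrite indicE lerD2l ler_wpM2l//; first lra.
    by case: ifPn => // MV; rewrite mem_set.
  rewrite ExpD//; [|exact: L1_cst|by apply: L1Zl; exact: L1_indic].
  rewrite Exp_cst ExpZl; last exact: L1_indic.
  rewrite Exp_indic//.
  have : (2 * B + 1) * fine (Q [set w | M < `|V w|]) <= e.
    by rewrite mulrC -ler_pdivlMr//; lra.
  have : 0 <= fine (Q [set w | M < `|V w|]) by rewrite fine_ge0.
  by nra.
have mono d0 (T0 : measurableType d0) (Q : probability T0 R) (V : T0 -> R) M' :
    measurable_fun setT V -> M' <= M -> fine (Q [set w | M' < `|V w|]) <= e' ->
    measurable [set w | M' < `|V w|] ->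
    fine (Q [set w | M < `|V w|]) <= e'.
  move=> mV MM hq mA'; apply: le_trans hq; rewrite fine_le ?fin_num_measure//; [exact: measurable_norm_gt|].
  by apply: le_measure; rewrite ?inE//; [exact: measurable_norm_gt|move=> w /=; exact: le_lt_trans].
case: gh => _ _ /cvgrPdist_le /(_ _ e0) ch.
near=> n.
have a1 : `|N[fun w => h (W w)] - E[fun w => h (Z n w)]| <= e by near: n.
have a2 := key _ _ Pr _ (mZ n) (ihZ n) (ifZ n).
have a3 := key _ _ N _ mW ihW ifW.
have {}a2 : `|E[fun w => h (Z n w)] - E[fun w => f (Z n w)]| <= 2 * e.
  apply: a2; apply: (@mono _ _ _ _ M1) => //; last exact: measurable_norm_gt.
    by rewrite /M !le_max lexx orbT.
  by near: n.
have {}a3 : `|N[fun w => h (W w)] - N[fun w => f (W w)]| <= 2 * e.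
  apply: a3; apply: (@mono _ _ _ _ M2) => //; last exact: measurable_norm_gt.
  by rewrite /M !le_max lexx !orbT.
have -> : N[fun w => f (W w)] - E[fun w => f (Z n w)] =
  (N[fun w => h (W w)] - E[fun w => h (Z n w)]) - (N[fun w => h (W w)] - N[fun w => f (W w)])
  + (E[fun w => h (Z n w)] - E[fun w => f (Z n w)]) by ring.
rewrite (le_trans (ler_normD _ _))// (le_trans (lerD (ler_normB _ _) (lexx _)))//.
by rewrite /e in a1 a2 a3 *; lra.
Unshelve. all: by end_near.
Qed.

End trigonometric_test_functions.

(** * Sub-sigma-algebras and conditional expectations tested on events *)

Definition Gmeas {T : Type} {R : realType} (G : set (set T)) (U : T -> R) :=
  forall B : set R, measurable B -> G (U @^-1` B).

Lemma norm_mul_le_sqr (R : realType) (a b : R) : `|a * b| <= a ^+ 2 + b ^+ 2.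
Proof.
rewrite normrM -[a ^+ 2]real_normK ?num_real// -[b ^+ 2]real_normK ?num_real//.
have := sqr_ge0 (`|a| - `|b|); have := normr_ge0 a; have := normr_ge0 b; nra.
Qed.

Section measurability_wrt_a_sigma_algebra.
Context d (T : measurableType d) (R : realType) (G : set (set T)).
Hypothesis sG : sigma_algebra setT G.
Implicit Types U V : T -> R.

(** Through this equivalence the closure properties of measurable functions, which concern types
    carrying a sigma-algebra, become available for each member of a filtration. *)
Lemma GmeasE U :
  Gmeas G U <-> measurable_fun setT (U : g_sigma_algebraType G -> R).
Proof.
have GE : @measurable _ (g_sigma_algebraType G) = G by exact: sigma_algebra_id.
split=> h.
  move=> _ B mB; rewrite setTI; have := h B mB; rewrite -{1}GE; exact.
move=> B mB; have := h measurableT B mB; rewrite setTI GE; exact.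
Qed.

Lemma Gmeas_measurable U : (forall A, G A -> measurable A) -> Gmeas G U ->
  measurable_fun setT U.
Proof. by move=> GT h _ B mB; rewrite setTI; apply: GT; exact: h. Qed.

Lemma GmeasT : G setT.
Proof. by case: sG => g0 gD _; have := gD _ g0; rewrite setD0. Qed.

Lemma Gmeas_setI A B : G A -> G B -> G (A `&` B).
Proof.
have GE : @measurable _ (g_sigma_algebraType G) = G by exact: sigma_algebra_id.
by rewrite -GE => a b; exact: measurableI.
Qed.

Lemma Gmeas_setC A : G A -> G (~` A).
Proof. by case: sG => g0 gD _ /gD; rewrite setTD. Qed.

Lemma Gmeas_cst (c : R) : Gmeas G (cst c).
Proof. by apply/GmeasE. Qed.

Lemma GmeasD U V : Gmeas G U -> Gmeas G V -> Gmeas G (fun w => U w + V w).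
Proof. by move=> /GmeasE u /GmeasE v; apply/GmeasE; apply: measurable_funD. Qed.

Lemma GmeasB U V : Gmeas G U -> Gmeas G V -> Gmeas G (fun w => U w - V w).
Proof. by move=> /GmeasE u /GmeasE v; apply/GmeasE; apply: measurable_funB. Qed.

Lemma GmeasM U V : Gmeas G U -> Gmeas G V -> Gmeas G (fun w => U w * V w).
Proof. by move=> /GmeasE u /GmeasE v; apply/GmeasE; apply: measurable_funM. Qed.

Lemma GmeasZ (c : R) U : Gmeas G U -> Gmeas G (fun w => c * U w).
Proof. by move=> u; apply: GmeasM => //; exact: Gmeas_cst. Qed.

Lemma Gmeas_comp (h : R -> R) U : measurable_fun setT h -> Gmeas G U ->
  Gmeas G (fun w => h (U w)).
Proof.
move=> mh u B mB; rewrite (_ : _ @^-1` _ = U @^-1` (h @^-1` B))//.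
by apply: u; rewrite -[_ @^-1` _]setTI; exact: mh.
Qed.

Lemma Gmeas_indic A : G A -> Gmeas G (\1_A : T -> R).
Proof.
move=> gA; apply/GmeasE; apply: measurable_indic.
by rewrite [X in X A](_ : _ = G)//; exact: sigma_algebra_id.
Qed.

Lemma Gmeas_sum (I : Type) (s : seq I) (F : I -> T -> R) :
  (forall i, Gmeas G (F i)) -> Gmeas G (fun w => \sum_(i <- s) F i w).
Proof.
move=> h; apply/GmeasE; apply: measurable_sum => i; exact/GmeasE.
Qed.

Lemma Gmeas_fin (I : finType) (X : T -> I) (F : I -> T -> R) :
  (forall i, G (X @^-1` [set i])) -> (forall i, Gmeas G (F i)) ->
  Gmeas G (fun w => F (X w) w).
Proof.
move=> gX gF.
have -> : (fun w => F (X w) w) =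
    (fun w => \sum_(i <- enum I) \1_(X @^-1` [set i]) w * F i w).
  apply/funext => w; rewrite (bigD1_seq (X w)) ?mem_enum ?enum_uniq//=.
  rewrite indicE mem_set// mul1r big1 ?addr0// => i iX.
  by rewrite indicE memNset ?mul0r// => /= e; move: iX; rewrite e eqxx.
by apply: Gmeas_sum => i; apply: GmeasM => //; exact: Gmeas_indic.
Qed.

End measurability_wrt_a_sigma_algebra.

Section conditional_expectation.
Context d (T : measurableType d) (R : realType) (Pr : probability T R).
Variable G : set (set T).
Hypothesis sG : sigma_algebra setT G.
Hypothesis GT : forall A, G A -> measurable A.
Local Notation "'E[' f ]" := (Rintegral Pr setT f).

Variable D : T -> R.
Hypothesis iD : L1 Pr D.
Hypothesis D0 : forall A, G A -> E[fun w => \1_A w * D w] = 0.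

(* Round [U] to the grid [Z/(n+1)]: the rounded variable is a finite linear
   combination of indicators of sets in [G]. *)
Let Exp_bounded_mul0 (U : T -> R) (M : nat) : Gmeas G U ->
  (forall w, `|U w| <= M%:R) -> E[fun w => U w * D w] = 0.
Proof.
move=> gU bU.
have mU := Gmeas_measurable GT gU.
have mD := L1_measurable iD.
have iUD : L1 Pr (fun w => U w * D w) by apply: (L1M_bounded (M := M%:R)).
pose C := E[fun w => `|D w|].
have C0 : 0 <= C by apply: Exp_ge0 => w.
suff H n : `|E[fun w => U w * D w]| <= n.+1%:R^-1 * C.
  apply/eqP; rewrite -normr_eq0 eq_le normr_ge0 andbT; apply/ler_addgt0Pr => e e0.
  rewrite add0r; apply: le_trans (H (Num.truncn (C / e))) _.
  rewrite mulrC ler_pdivrMr ?ltr0n// mulrC -ler_pdivrMr//.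
  by rewrite ltW// truncnS_gt.
pose N := ((M + M) * n.+1).+1%N.
have n0 : 0 < n.+1%:R :> R by rewrite ltr0n.
pose A (j : nat) := [set w | j%:R <= (U w + M%:R) * n.+1%:R < j.+1%:R].
have gA j : G (A j).
  have -> : A j = (fun w => (U w + M%:R) * n.+1%:R) @^-1` `[j%:R, j.+1%:R[%classic.
    by apply/seteqP; split => w /=; rewrite in_itv/=.
  apply: GmeasM => //; last exact: Gmeas_cst.
  by apply: GmeasD => //; exact: Gmeas_cst.
have mA j : measurable (A j) by exact: GT.
pose V (w : T) : R := \sum_(j < N) (j%:R / n.+1%:R - M%:R) * \1_(A j) w.
have iV1 (j : 'I_N) : L1 Pr (fun w => (j%:R / n.+1%:R - M%:R) * (\1_(A j) w * D w)).
  by apply: L1Zl; exact: L1_indicM.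
have VD : (fun w => V w * D w) =
    (fun w => \sum_(j < N) (j%:R / n.+1%:R - M%:R) * (\1_(A j) w * D w)).
  by apply/funext => w; rewrite /V mulr_suml; apply: eq_bigr => j _; rewrite mulrA.
have EV : E[fun w => V w * D w] = 0.
  rewrite VD Exp_sum// big1// => j _.
  by rewrite ExpZl ?D0 ?mulr0//; exact: L1_indicM.
have UV w : `|U w - V w| <= n.+1%:R^-1.
  have Uw := bU w; move: Uw; rewrite ler_norml => /andP[U1 U2].
  pose x := (U w + M%:R) * n.+1%:R.
  have x0 : 0 <= x.
    by rewrite /x mulr_ge0 ?(ltW n0)// -lerBlDr sub0r.
  pose j := Num.truncn x.
  have /andP[j1 j2] : j%:R <= x < j.+1%:R by apply: truncn_itv.
  have jN : (j < N)%N.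
    rewrite /N ltnS -(ler_nat R) (le_trans j1)// /x natrM natrD ler_wpM2r//.
    by rewrite lerD2r.
  have -> : V w = j%:R / n.+1%:R - M%:R.
    rewrite /V (bigD1 (Ordinal jN))//= indicE mem_set ?mulr1; last by apply/andP.
    rewrite big1 ?addr0// => i ij; rewrite indicE memNset ?mulr0// => /= /andP[i1 i2].
    move/negP: ij; apply; apply/eqP/val_inj => /=.
    by have/eqP : Num.truncn x == i by rewrite truncn_eq// i1 i2.
  have -> : U w - (j%:R / n.+1%:R - M%:R) = (x - j%:R) / n.+1%:R.
    by rewrite /x; field; rewrite gt_eqF.
  rewrite normrM [`|_^-1|]gtr0_norm ?invr_gt0// -[leRHS]mul1r ler_wpM2r ?invr_ge0 ?ltW//.
  by rewrite ger0_norm ?subr_ge0// ltrBlDr nat1r.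
have iVD : L1 Pr (fun w => V w * D w) by rewrite VD; exact: L1_sum.
rewrite -[E[_]]subr0 -EV -RintegralB// -RintegralZl//; last exact: L1_abs.
apply: Exp_abs_le; [exact: L1B|by apply: L1Zl; exact: L1_abs|].
by move=> w; rewrite -mulrBl normrM ler_wpM2r.
Qed.

(** Truncation of [U] to [|U| <= n] reduces to the bounded case, and [|U D|] dominates the passage
    to the limit. *)
Lemma Exp_mul0 (U : T -> R) : Gmeas G U -> L1 Pr (fun w => U w * D w) ->
  E[fun w => U w * D w] = 0.
Proof.
move=> gU iUD.
have mU := Gmeas_measurable GT gU.
pose A (n : nat) := [set w | `|U w| <= n%:R].
have gA n : G (A n).
  have -> : A n = (fun w => `|U w|) @^-1` `]-oo, n%:R]%classic.
    by apply/seteqP; split => w /=; rewrite in_itv.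
  exact: Gmeas_comp.
have mA n : measurable (A n) by exact: GT.
have E0 n : E[fun w => \1_(A n) w * (U w * D w)] = 0.
  rewrite (_ : (fun w => _) = (fun w => (\1_(A n) w * U w) * D w)); last first.
    by apply/funext => w; rewrite mulrA.
  apply: (@Exp_bounded_mul0 _ n).
    by apply: GmeasM => //; exact: Gmeas_indic.
  move=> w; rewrite indicE; case: (boolP (w \in A n)) => [|_].
    by rewrite inE mul1r.
  by rewrite mul0r normr0.
have : (\int[Pr]_w (\1_(A n) w * (U w * D w))%:E)%E @[n --> \oo] --> (\int[Pr]_w (U w * D w)%:E)%E.
  apply: (@dominated_cvg _ _ _ Pr setT measurableT _ _ (fun w => `|U w * D w|%:E)) => //=.
  - by move=> n; case/integrableP : (L1_indicM iUD (mA n)).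
  - move=> w _; apply: cvg_near_cst; near=> n.
    rewrite indicE mem_set ?mul1r// /A/=; near: n; exists (Num.truncn `|U w|).+1 => // n /= xn.
    by rewrite ltW// (lt_le_trans (truncnS_gt _))// ler_nat.
  - exact: L1_abs.
  - move=> n w _; rewrite lee_fin indicE normrM.
    by case: (w \in _); rewrite ?normr1 ?normr0 ?mul1r ?mul0r.
under eq_fun do rewrite (Exp_eq_EFin (L1_indicM iUD (mA _))) E0.
move=> h.
have e : (\int[Pr]_w (U w * D w)%:E = 0)%E.
  by apply: (cvg_unique _ h); [exact: ereal_hausdorff|exact: cvg_cst].
by rewrite /Rintegral e.
Unshelve. all: by end_near.
Qed.

End conditional_expectation.

(** The last hypothesis says that [f] and [g] have the same conditional expectation given [G]; a
    [G]-measurable factor may then be inserted, by [Exp_mul0] applied to [f - g]. *)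
Lemma Exp_mul_eq d (T : measurableType d) (R : realType) (Pr : probability T R)
    (G : set (set T)) (U f g : T -> R) :
  sigma_algebra setT G -> (forall A, G A -> measurable A) -> Gmeas G U ->
  L1 Pr f -> L1 Pr g -> L1 Pr (fun w => U w * f w) -> L1 Pr (fun w => U w * g w) ->
  (forall A, G A -> Rintegral Pr setT (fun w => \1_A w * f w) =
    Rintegral Pr setT (fun w => \1_A w * g w)) ->
  Rintegral Pr setT (fun w => U w * f w) = Rintegral Pr setT (fun w => U w * g w).
Proof.
move=> sG GT gU if_ ig iUf iUg fg.
have e (V : T -> R) : (fun w => V w * (f w - g w)) = (fun w => V w * f w - V w * g w).
  by apply/funext => w; rewrite mulrBr.
apply/eqP; rewrite -subr_eq0 -ExpB// -e; apply/eqP.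
apply: (Exp_mul0 sG GT) => //; [exact: L1B| |by rewrite e; exact: L1B].
move=> A gA; have mA := GT A gA.
by rewrite e ExpB ?fg ?subrr//; exact: L1_indicM.
Qed.

(* The row space of (1 - Q)^T has codimension one, because its kernel consists
   of the harmonic functions; it is therefore the whole kernel of [p]. *)
Lemma poisson_equation (F : fieldType) (I : finType) (Q : I -> I -> F) (p v : I -> F) :
  \sum_i p i = 1 -> (forall j, \sum_i p i * Q i j = p j) ->
  (forall h : I -> F, (forall i, \sum_j Q i j * h j = h i) ->
     forall i j, h i = h j) ->
  exists u : I -> F, forall i, u i - \sum_j Q i j * u j = v i - \sum_k p k * v k.
Proof.
move=> p1 pQ harm.
pose n := #|I|.
pose A : 'M[F]_n := \matrix_(a, b) ((a == b)%:R - Q (enum_val b) (enum_val a)).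
pose pc : 'cV[F]_n := \col_b p (enum_val b).
pose w : 'rV[F]_n := \row_b (v (enum_val b) - \sum_k p k * v k).
have sumE (f : I -> F) : \sum_(a < n) f (enum_val a) = \sum_i f i.
  by rewrite [RHS](reindex (@enum_val I I))//; exact: onW_bij (@enum_val_bij I).
have uA (u : 'rV[F]_n) b :
    (u *m A) 0 b = u 0 b - \sum_(a < n) Q (enum_val b) (enum_val a) * u 0 a.
  rewrite mxE (eq_bigr (fun a => u 0 a * (a == b)%:R - Q (enum_val b) (enum_val a) * u 0 a)).
    rewrite sumrB (bigD1 b)//= eqxx mulr1 big1 ?addr0// => a /negPf ->.
    by rewrite mulr0.
  by move=> a _; rewrite mxE mulrBr [u 0 a * Q _ _]mulrC.
have Apc : A *m pc = 0.
  apply/matrixP => a j; rewrite !mxE.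
  rewrite (eq_bigr (fun b => (a == b)%:R * p (enum_val b) - p (enum_val b) * Q (enum_val b) (enum_val a))).
    rewrite sumrB (bigD1 a)//= eqxx mul1r big1 ?addr0; last first.
      by move=> b ba; rewrite eq_sym (negPf ba) mul0r.
    by rewrite (sumE (fun i => p i * Q i (enum_val a))) pQ subrr.
  by move=> b _; rewrite !mxE mulrBl [Q _ _ * _]mulrC.
have wpc : w *m pc = 0.
  apply/matrixP => a j; rewrite !mxE.
  rewrite (eq_bigr (fun b => (fun i => p i * v i - p i * \sum_k p k * v k) (enum_val b))).
    by rewrite (sumE (fun i => p i * v i - p i * \sum_k p k * v k)) sumrB -mulr_suml p1 mul1r subrr.
  by move=> b _; rewrite !mxE mulrC mulrBr.
have AK : (A <= kermx pc)%MS by apply/sub_kermxP.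
have wK : (w <= kermx pc)%MS by apply/sub_kermxP.
have kA : (kermx A <= const_mx (m := 1) (n := n) (1 : F))%MS.
  apply/row_subP => i; set r := row i _.
  have rA : r *m A = 0 by apply/sub_kermxP; exact: row_sub.
  have rh (a b : 'I_n) : r 0 a = r 0 b.
    have := harm (fun i => r 0 (enum_rank i)) _ (enum_val a) (enum_val b).
    rewrite !enum_valK; apply => k.
    have := uA r (enum_rank k); rewrite rA mxE => /esym/eqP.
    rewrite subr_eq0 => /eqP ->; rewrite enum_rankK.
    rewrite -(sumE (fun j => Q k j * r 0 (enum_rank j))).
    by apply: eq_bigr => a' _; rewrite enum_valK.
  case: (posnP n) => n0.
    rewrite (_ : r = 0) ?sub0mx//; by apply/rowP => a; case: a => a h; exfalso; move: h; rewrite n0.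
  have -> : r = r 0 (Ordinal n0) *: const_mx 1.
    by apply/rowP => a; rewrite !mxE mulr1 -!/(r 0 _); have := rh a (Ordinal n0); rewrite !mxE.
  exact: scalemx_sub.
have pc0 : (0 < \rank pc)%N.
  rewrite lt0n mxrank_eq0; apply/eqP => pc0.
  have : \sum_i p i = 0.
    by rewrite -sumE big1// => a _; have /matrixP/(_ a 0) := pc0; rewrite !mxE.
  by rewrite p1; apply/eqP; rewrite oner_neq0.
(* The left kernel of [A] has rank at most 1 and [pc] has rank at least 1, hence
   [rank A >= n - 1 >= rank (kermx pc)]. *)
have rAK : (\rank (kermx pc) <= \rank A)%N.
  have := mxrankS kA => /leq_trans/(_ (rank_leq_row _)).
  rewrite !mxrank_ker => h.
  apply: (@leq_trans (n - 1)); first by rewrite leq_sub2l.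
  by rewrite leq_subLR addnC -leq_subLR.
have KA : (kermx pc <= A)%MS by rewrite -(mxrank_leqif_sup AK) eqn_leq mxrankS.
have /submxP[u uw] := submx_trans wK KA.
exists (fun i => u 0 (enum_rank i)) => i.
have := uA u (enum_rank i); rewrite -uw mxE enum_rankK => ->.
rewrite -(sumE (fun j => Q i j * u 0 (enum_rank j))).
by congr (_ - _); apply: eq_bigr => a _; rewrite enum_valK.
Qed.

(** * Mean value inequality and second order expansion of the cosine *)

Lemma MVT_bound (R : realType) (f df : R -> R) (a b B : R) :
  (forall x, `|x - a| <= `|b - a| -> is_derive x 1 f (df x)) ->
  (forall x, `|x - a| <= `|b - a| -> `|df x| <= B) ->
  `|f b - f a| <= B * `|b - a|.
Proof.
move=> fd dB.
have [ab|ba|<-] := ltgtP a b; last by rewrite !subrr !normr0 mulr0.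
- have h x : x \in `[a, b] -> `|x - a| <= `|b - a|.
    by rewrite in_itv/= => /andP[ax xb]; rewrite !ger0_norm ?subr_ge0 ?(ltW ab)// lerD2r.
  have [c cab ->] := @MVT_segment R f df a b (ltW ab)
    (fun x xab => fd x (h x (subset_itv_oo_cc xab)))
    (derivable_within_continuous (fun x xab => let: DeriveDef d _ := fd x (h x xab) in d)).
  by rewrite normrM ler_wpM2r// dB// h.
- have h x : x \in `[b, a] -> `|x - a| <= `|b - a|.
    rewrite in_itv/= => /andP[bx xa]; rewrite ![`|_ - a|]distrC.
    by rewrite !ger0_norm ?subr_ge0 ?(ltW ba)// lerD2l lerN2.
  have [c cab e] := @MVT_segment R f df b a (ltW ba)
    (fun x xab => fd x (h x (subset_itv_oo_cc xab)))
    (derivable_within_continuous (fun x xab => let: DeriveDef d _ := fd x (h x xab) in d)).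
  rewrite ![`|_ - f a|]distrC e [`|b - a|]distrC.
  by rewrite normrM ler_wpM2r// dB// h.
Qed.

Section cosine_expansion.
Context {R : realType}.
Implicit Types x y : R.

Lemma norm_sin_le y : `|sin y| <= `|y|.
Proof.
have := @MVT_bound R sin cos 0 y 1 (fun x _ => is_derive_sin x).
rewrite sin0 !subr0 mul1r; apply => x _.
by rewrite norm_cos_le1.
Qed.

Lemma cos_lipschitz x y : `|cos x - cos y| <= `|x - y|.
Proof.
rewrite -[leRHS]mul1r; apply: (@MVT_bound R cos (fun x => - sin x) y x 1) => z _.
by rewrite normrN norm_sin_le1.
Qed.

Lemma one_sub_cos_le y : 0 <= 1 - cos y <= y ^+ 2 / 2.
Proof.
have e : 1 - cos y = 2 * sin (y / 2) ^+ 2.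
  rewrite {1}(_ : y = y / 2 + y / 2); last by field.
  by rewrite cosD; have := cos2Dsin2 (y / 2); rewrite -!expr2; lra.
rewrite e; have := norm_sin_le (y / 2).
rewrite -(@ler_pXn2r _ 2)// ?nnegrE// !real_normK ?num_real// => h.
have := sqr_ge0 (sin (y / 2)) => h2; apply/andP; split; first lra.
rewrite (_ : y ^+ 2 / 2 = 2 * (y / 2) ^+ 2); last by field.
lra.
Qed.

(** The derivative [1 - cos x] is bounded by [one_sub_cos_le]; in the same way this bound controls
    the derivative in [norm_cos_taylor2_le]. *)
Lemma norm_sub_sin_le y : `|y - sin y| <= `|y| ^+ 3 / 2.
Proof.
have := @MVT_bound R (fun x => x - sin x) (fun x => 1 - cos x) 0 y (`|y| ^+ 2 / 2).
rewrite sin0 !subr0 (_ : `|y| ^+ 2 / 2 * `|y| = `|y| ^+ 3 / 2); last by ring.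
apply=> x; rewrite subr0 => xy.
have /andP[h1 h2] := one_sub_cos_le x; rewrite ger0_norm//.
apply: (le_trans h2); rewrite ler_wpM2r//.
by rewrite -[x ^+ 2]real_normK ?num_real// lerXn2r// nnegrE.
Qed.

Lemma norm_cos_taylor2_le y : `|cos y - 1 + y ^+ 2 / 2| <= `|y| ^+ 4 / 2.
Proof.
have := @MVT_bound R (fun x => cos x - 1 + x ^+ 2 / 2) (fun x => x - sin x) 0 y (`|y| ^+ 3 / 2).
rewrite cos0 expr0n/= mul0r !subr0 addr0 subrr subr0.
rewrite (_ : `|y| ^+ 3 / 2 * `|y| = `|y| ^+ 4 / 2); last by ring.
apply=> x; rewrite subr0 => xy.
  have -> : (fun x : R => cos x - 1 + x ^+ 2 / 2) = (fun x : R => (cos x - cst 1 x) + 2^-1 *: (x ^+ 2)).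
    by apply/funext => z; rewrite /GRing.scale/=; ring.
  by apply: is_derive_eq; rewrite /GRing.scale/= ?mulr1; field.
apply: (le_trans (norm_sub_sin_le x)); rewrite ler_wpM2r//.
by rewrite lerXn2r// nnegrE.
Qed.

(** The cubic bound serves small increments and the quadratic one large increments. Their minimum
    allows a Lindeberg argument with second moments only. *)
Lemma cos_taylor2 x y :
  `|cos (x + y) - (cos x - y * sin x - y ^+ 2 / 2 * cos x)| <=
  3 * Num.min (`|y| ^+ 3) (y ^+ 2).
Proof.
have -> : cos (x + y) - (cos x - y * sin x - y ^+ 2 / 2 * cos x) =
   cos x * (cos y - 1 + y ^+ 2 / 2) + sin x * (y - sin y).
  by rewrite cosD; ring.
apply: (@le_trans _ _ (`|cos y - 1 + y ^+ 2 / 2| + `|y - sin y|)).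
  apply: (le_trans (ler_normD _ _)); rewrite !normrM lerD// ler_piMl//.
    by rewrite norm_cos_le1.
  by rewrite norm_sin_le1.
have h1 := norm_cos_taylor2_le y; have h2 := norm_sub_sin_le y.
have y2 : y ^+ 2 = `|y| ^+ 2 by rewrite real_normK ?num_real.
have y0 := normr_ge0 y; have y3 := exprn_ge0 3 y0.
have [yl1|yg1] := leP `|y| 1.
  have h3 : `|y| ^+ 3 <= `|y| ^+ 2 by rewrite ler_wiXn2l.
  have h4 : `|y| ^+ 4 <= `|y| ^+ 3 by rewrite ler_wiXn2l.
  by rewrite [X in Num.min _ X]y2 min_l//; lra.
have h3 : `|y| ^+ 2 <= `|y| ^+ 3 by rewrite ler_weXn2l// ltW.
rewrite [X in Num.min _ X]y2 min_r//.
have h4 : `|y - sin y| <= `|y| + 1.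
  by rewrite (le_trans (ler_normB _ _))// lerD2l norm_sin_le1.
have h5 : `|cos y - 1 + y ^+ 2 / 2| <= `|y| ^+ 2 / 2.
  have := one_sub_cos_le y; rewrite -y2 => /andP[a b].
  by rewrite ger0_norm; lra.
have : `|y| <= `|y| ^+ 2 by rewrite -{1}[`|y|]expr1 ler_weXn2l// ltW.
by lra.
Qed.

Lemma expRN_approx (x : R) : 0 <= x -> `|expR (- x) - (1 - x)| <= x ^+ 2.
Proof.
move=> x0; have h1 := expR_ge1Dx (- x); rewrite ger0_norm; last by lra.
have h2 := expR_ge1Dx x; have e0 := expR_gt0 (- x).
have e1 : expR (- x) * expR x = 1 by rewrite -expRD addNr expR0.
have h3 : expR (- x) * (1 + x) <= 1 by rewrite -[leRHS]e1 ler_wpM2l ?(ltW e0).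
nra.
Qed.

End cosine_expansion.

(** The arithmetic of one step. [a] and [a'] stand for the expected cosine before and after the
    step, [b] and [b'] for the same weighted by [u], [b1] for the old cosine weighted by the new
    [u], [Ev] for the weighted conditional variance and [q] for [exp (- h^2 s2 / 2)]. The terms of
    order [h^2] cancel; what is left is the Taylor error [r], the change [b' - b1], and two terms of
    order [h^4]. *)
Lemma corrector_recursion (R : realType)
    (h s2 V K om a a' b b' b1 Ev r q : R) :
  `|h| <= 1 -> 0 <= s2 -> 0 <= V -> 0 <= K ->
  a' = a - h ^+ 2 / 2 * Ev + r -> Ev = s2 * a + b - b1 ->
  `|b' - b1| <= K * `|h| * (1 + V) -> `|a| <= 1 -> `|b| <= K ->
  `|r| <= 3 * h ^+ 2 * om ->
  `|q - (1 - h ^+ 2 * s2 / 2)| <= (h ^+ 2 * s2 / 2) ^+ 2 ->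
  `|a' - h ^+ 2 / 2 * b' - q * (a - h ^+ 2 / 2 * b)| <=
  h ^+ 2 * (3 * om + `|h| * (K * (1 + V) + s2 * K + s2 ^+ 2 * (1 + K))).
Proof.
move=> h1 s20 V0 K0 eA eV eB bC bCu ED hq.
have -> : a' - h ^+ 2 / 2 * b' - q * (a - h ^+ 2 / 2 * b) =
  r - h ^+ 2 / 2 * (b' - b1) - (h ^+ 2 * s2 / 2) * (h ^+ 2 / 2) * b
  - (q - (1 - h ^+ 2 * s2 / 2)) * (a - h ^+ 2 / 2 * b).
  by rewrite eA eV; field.
have h2 : h ^+ 2 = `|h| ^+ 2 by rewrite real_normK ?num_real.
have h0 := normr_ge0 h.
have hh1 : h ^+ 2 <= 1 by rewrite h2 expr_le1.
have hh0 : 0 <= h ^+ 2 := sqr_ge0 h.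
have hhh : h ^+ 2 <= `|h| by rewrite h2; nra.
have b0 := normr_ge0 b.
have s22 := sqr_ge0 s2.
set H := h ^+ 2 in hq ED eA hh1 hh0 hhh *.
have t1 : `|H / 2 * (b' - b1)| <= H * (`|h| * (K * (1 + V))).
  rewrite normrM [`|H / 2|]ger0_norm; last by lra.
  have g1 : 0 <= H * (`|h| * (K * (1 + V))).
    apply: mulr_ge0 => //; apply: mulr_ge0 => //; apply: mulr_ge0 => //; exact: addr_ge0.
  have : H / 2 * `|b' - b1| <= H / 2 * (K * `|h| * (1 + V)) by rewrite ler_wpM2l//; lra.
  lra.
have t2 : `|(H * s2 / 2) * (H / 2) * b| <= H * (`|h| * (s2 * K)).
  rewrite normrM ger0_norm; last by rewrite mulr_ge0// divr_ge0// mulr_ge0.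
  have -> : H * s2 / 2 * (H / 2) * `|b| = H * (H * (s2 * (`|b| / 4))) by field.
  have g1 : s2 * (`|b| / 4) <= s2 * K by rewrite ler_wpM2l//; lra.
  have g2 : 0 <= s2 * (`|b| / 4) by apply: mulr_ge0 => //; lra.
  by rewrite ler_wpM2l//; apply: ler_pM.
have t3 : `|(q - (1 - H * s2 / 2)) * (a - H / 2 * b)| <= H * (`|h| * (s2 ^+ 2 * (1 + K))).
  rewrite normrM.
  have g1 : `|a - H / 2 * b| <= 1 + K.
    apply: (le_trans (ler_normB _ _)); apply: lerD => //.
    rewrite normrM ger0_norm; last by lra.
    by rewrite -[leRHS]mul1r ler_pM//; lra.
  have g2 : (H * s2 / 2) ^+ 2 <= H * (`|h| * s2 ^+ 2).
    have -> : (H * s2 / 2) ^+ 2 = H * (H * (s2 ^+ 2 / 4)) by field.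
    by rewrite ler_wpM2l// ler_pM//; lra.
  have -> : H * (`|h| * (s2 ^+ 2 * (1 + K))) = H * (`|h| * s2 ^+ 2) * (1 + K) by ring.
  by rewrite ler_pM// (le_trans hq).
have -> : H * (3 * om + `|h| * (K * (1 + V) + s2 * K + s2 ^+ 2 * (1 + K))) =
    3 * H * om + H * (`|h| * (K * (1 + V))) + H * (`|h| * (s2 * K)) +
    H * (`|h| * (s2 ^+ 2 * (1 + K))) by ring.
rewrite (le_trans (ler_normB _ _))// lerD// (le_trans (ler_normB _ _))// lerD//.
by rewrite (le_trans (ler_normB _ _))// lerD.
Qed.

(** * Convergence to zero in probability and a Slutsky argument *)

Section convergence_in_probability.
Context d (T : measurableType d) (R : realType) (Pr : probability T R).
Local Notation "'E[' f ]" := (Rintegral Pr setT f).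
Local Notation "'P[' A ]" := (fine (Pr A)).
Implicit Types (A B : set T) (U V : nat -> T -> R).

Lemma prob_le A B : measurable A -> measurable B -> A `<=` B -> P[A] <= P[B].
Proof.
by move=> mA mB AB; rewrite fine_le ?fin_num_measure// le_measure ?inE.
Qed.

Lemma prob_le1 A : measurable A -> P[A] <= 1.
Proof.
by move=> mA; rewrite -(fine1 : fine (1%:E : \bar R) = 1) fine_le ?fin_num_measure// probability_le1.
Qed.

Lemma prob_union A B : measurable A -> measurable B -> P[A `|` B] <= P[A] + P[B].
Proof.
move=> mA mB; rewrite -fineD ?fin_num_measure// fine_le ?fin_num_measure//.
- exact: measurableU.
- by rewrite fin_numD !fin_num_measure.
- exact: measureU2.
Qed.

Lemma prob_setC A : measurable A -> P[~` A] = 1 - P[A].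
Proof.
by move=> mA; rewrite probability_setC// fineB ?fin_num_measure.
Qed.

Lemma markov_ineq (f : T -> R) (eta : R) : L1 Pr f -> (forall w, 0 <= f w) ->
  0 < eta -> eta * P[[set w | eta < f w]] <= E[f].
Proof.
move=> hf f0 eta0.
have e : [set w | eta < f w] = [set w | eta < `|f w|].
  by apply/seteqP; split => w /=; rewrite ger0_norm.
have mA : measurable [set w | eta < f w].
  by rewrite e; apply: measurable_norm_gt; exact: L1_measurable hf.
rewrite -Exp_indic// -ExpZl; last exact: L1_indic.
apply: Exp_le => //; first by apply: L1Zl; exact: L1_indic.
move=> w; rewrite indicE; case: (boolP (w \in _)) => [|_]; last by rewrite mulr0.
by rewrite inE/= mulr1 => /ltW.
Qed.

Lemma chebyshev_ineq (f : T -> R) (eta : R) : measurable_fun setT f ->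
  L1 Pr (fun w => f w ^+ 2) -> 0 < eta ->
  eta ^+ 2 * P[[set w | eta < `|f w|]] <= E[fun w => f w ^+ 2].
Proof.
move=> mf hf eta0.
have := markov_ineq hf (fun w => sqr_ge0 _) (exprn_gt0 2 eta0).
congr (_ * fine (Pr _) <= _); apply/seteqP; split => w /=.
- by rewrite -[f w ^+ 2]real_normK ?num_real// ltr_pXn2r// ?nnegrE// ltW.
- by rewrite -[f w ^+ 2]real_normK ?num_real// ltr_pXn2r// ?nnegrE// ltW.
Qed.

Definition cvg0P U := forall eta eps : R, 0 < eta -> 0 < eps ->
  exists N, forall n, (N <= n)%N -> P[[set w | eta < `|U n w|]] <= eps.

Lemma cvg0PD U V : (forall n, measurable_fun setT (U n)) ->
  (forall n, measurable_fun setT (V n)) ->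
  cvg0P U -> cvg0P V -> cvg0P (fun n w => U n w + V n w).
Proof.
move=> mU mV cU cV eta eps eta0 eps0.
have eta2 : 0 < eta / 2 by lra.
have eps2 : 0 < eps / 2 by lra.
have [N1 h1] := cU _ _ eta2 eps2; have [N2 h2] := cV _ _ eta2 eps2.
exists (maxn N1 N2) => n; rewrite geq_max => /andP[n1 n2].
apply: (@le_trans _ _ (P[[set w | eta / 2 < `|U n w|] `|` [set w | eta / 2 < `|V n w|]])).
  apply: prob_le.
  - by apply: measurable_norm_gt; exact: measurable_funD.
  - by apply: measurableU; exact: measurable_norm_gt.
  - move=> w /= h; case: (ltP (eta / 2) `|U n w|) => u; first by left.
    case: (ltP (eta / 2) `|V n w|) => v; first by right.
    by exfalso; have := ler_normD (U n w) (V n w); lra.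
apply: (le_trans (prob_union _ _)); try exact: measurable_norm_gt.
by have := h1 n n1; have := h2 n n2; lra.
Qed.

Lemma cvg0PM (a : nat -> R) (K : R) U : (forall n, measurable_fun setT (U n)) ->
  (forall n, `|a n| <= K) -> cvg0P U -> cvg0P (fun n w => a n * U n w).
Proof.
move=> mU aK cU eta eps eta0 eps0.
have K0 : 0 < K + 1 by have := aK 0%N; have := normr_ge0 (a 0%N); lra.
have [N h] := cU _ _ (divr_gt0 eta0 K0) eps0; exists N => n nN.
apply: le_trans (h n nN); apply: prob_le; try apply: measurable_norm_gt => //.
  by apply: measurable_funM.
move=> w /=; rewrite normrM => hw; rewrite ltr_pdivrMr//.
apply: (lt_le_trans hw); rewrite mulrC ler_wpM2l//.
by have := aK n; lra.
Qed.

Lemma cvg0P_rv (a : nat -> R) (Z : T -> R) : measurable_fun setT Z ->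
  (forall eps : R, 0 < eps -> exists N, forall n, (N <= n)%N -> `|a n| <= eps) ->
  cvg0P (fun n w => a n * Z w).
Proof.
move=> mZ a0 eta eps eta0 eps0.
have [M hM] := rv_tight Pr mZ eps0.
have M1 : 0 < `|M| + 1 by rewrite ltr_wpDl.
have [N h] := a0 _ (divr_gt0 eta0 M1); exists N => n nN.
apply: le_trans hM; apply: prob_le; try apply: measurable_norm_gt => //.
  by apply: measurable_funM.
move=> w /=; rewrite normrM => hw; rewrite ltNge; apply/negP => ZM.
have : `|a n| * `|Z w| <= eta.
  rewrite [leRHS](_ : eta = eta / (`|M| + 1) * (`|M| + 1)); last by rewrite divfK// gt_eqF.
  apply: ler_pM => //; first exact: h.
  by apply: (le_trans ZM); have := ler_norm M; lra.
by rewrite leNgt hw.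
Qed.

Lemma cvg0P_L2 U : (forall n, measurable_fun setT (U n)) ->
  (forall n, L1 Pr (fun w => U n w ^+ 2)) ->
  (forall eps : R, 0 < eps -> exists N, forall n, (N <= n)%N -> E[fun w => U n w ^+ 2] <= eps) ->
  cvg0P U.
Proof.
move=> mU iU hU eta eps eta0 eps0.
have e0 : 0 < eta ^+ 2 by rewrite exprn_gt0.
have [N h] := hU _ (mulr_gt0 e0 eps0); exists N => n nN.
have := chebyshev_ineq (mU n) (iU n) eta0 => h2.
by rewrite -(ler_pM2l e0) (le_trans h2)// h.
Qed.

(** The cosine is Lipschitz where [U] and [V] are close and bounded on the remaining event, whose
    probability vanishes. *)
Lemma slutsky_cos U V (l c : R) : (forall n, measurable_fun setT (U n)) ->
  (forall n, measurable_fun setT (V n)) -> cvg0P (fun n w => U n w - V n w) ->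
  E[fun w => cos (l * U n w + c)] - E[fun w => cos (l * V n w + c)] @[n --> \oo] --> 0.
Proof.
move=> mU mV h; apply/cvgrPdist_le => eps eps0.
have mc W : measurable_fun setT W -> L1 Pr (fun w : T => cos (l * W w + c)).
  move=> mW; apply: (L1_bounded (M := 1)); last first.
    by move=> w; rewrite norm_cos_le1.
  apply: (@measurableT_comp _ _ _ _ _ _ (@cos R)).
    by apply: continuous_measurable_fun; exact: continuous_cos.
  by apply: measurable_funD => //; exact: measurable_funM.
pose eta := eps / (2 * (`|l| + 1)).
have l1 : 0 < `|l| + 1 by rewrite ltr_wpDl.
have eta0 : 0 < eta by rewrite /eta divr_gt0// mulr_gt0.
have eps4 : 0 < eps / 4 by lra.
have [N hN] := h _ _ eta0 eps4; exists N => // n /= nN.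
rewrite sub0r normrN -ExpB; [|exact: mc|exact: mc].
have mA : measurable [set w | eta < `|U n w - V n w|].
  by apply: measurable_norm_gt; exact: measurable_funB.
have iB : L1 Pr (fun w => eps / 2 + 2 * \1_[set w | eta < `|U n w - V n w|] w).
  by apply: L1D; [exact: L1_cst|apply: L1Zl; exact: L1_indic].
apply: (le_trans (Exp_abs_le (L1B (mc _ (mU n)) (mc _ (mV n))) iB _)).
  move=> w; rewrite indicE; case: (boolP (w \in _)).
    rewrite mulr1 => _; apply: (le_trans (ler_normB _ _)).
    have : `|cos (l * U n w + c)| <= 1 by rewrite norm_cos_le1.
    have : `|cos (l * V n w + c)| <= 1 by rewrite norm_cos_le1.
    lra.
  rewrite notin_setE/= => /negP; rewrite -leNgt mulr0 addr0 => hw.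
  apply: (le_trans (cos_lipschitz _ _)).
  rewrite (_ : _ - _ = l * (U n w - V n w)); last by ring.
  rewrite normrM; apply: (@le_trans _ _ ((`|l| + 1) * eta)).
    by apply: ler_pM => //; lra.
  by rewrite /eta le_eqVlt; apply/orP; left; apply/eqP; field; rewrite gt_eqF.
rewrite ExpD; [|exact: L1_cst|by apply: L1Zl; exact: L1_indic].
rewrite Exp_cst ExpZl; last exact: L1_indic.
rewrite Exp_indic//; have := hN n nN; lra.
Qed.

End convergence_in_probability.

Lemma inv_sqrt_small (R : realType) (eps : R) : 0 < eps ->
  exists N, forall n, (N <= n)%N -> `|(Num.sqrt n%:R)^-1| <= eps.
Proof.
move=> eps0; exists (Num.truncn (eps^-1 ^+ 2)).+1 => n nN.
have n0 : 0 < n%:R :> R by rewrite ltr0n (leq_trans _ nN).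
rewrite ger0_norm ?invr_ge0 ?sqrtr_ge0// -[eps]invrK lef_pV2 ?posrE ?invr_gt0 ?sqrtr_gt0//.
rewrite -[leLHS]ger0_norm ?invr_ge0 ?(ltW eps0)// -sqrtr_sqr ler_wsqrtr//.
by rewrite ltW// (lt_le_trans (truncnS_gt _))// ler_nat.
Qed.

(** A substitute for [ln n = o (sqrt n)]: for [n >= N] the new term is [1 / (n + 1) <= (eps / 2) /
    sqrt (n + 1) <= eps (sqrt (n + 1) - sqrt n)], and the first [N] terms are each at most 1. *)
Lemma harmonic_small (R : realType) (eps : R) : 0 < eps ->
  exists N, forall n, \sum_(k < n) k.+1%:R^-1 <= N%:R + eps * Num.sqrt n%:R.
Proof.
move=> eps0; have e2 : 0 < eps / 2 by lra.
have [N hN] := inv_sqrt_small e2.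
exists N => n; elim: n => [|n ih].
  by rewrite big_ord0 sqrtr0 mulr0 addr0.
case: (leqP N n) => nN; last first.
  apply: (@le_trans _ _ N%:R); last by rewrite lerDl mulr_ge0 ?sqrtr_ge0 ?(ltW eps0).
  apply: (@le_trans _ _ (\sum_(k < n.+1) 1)); last by rewrite sumr_const card_ord ler_nat.
  by apply: ler_sum => k _; rewrite invf_le1// ler1n.
rewrite big_ord_recr/=; apply: (@le_trans _ _ (N%:R + eps * Num.sqrt n%:R + n.+1%:R^-1)).
  by rewrite lerD2r.
rewrite -addrA lerD2l -lerBrDl -mulrBr.
set a := Num.sqrt n%:R; set b := Num.sqrt n.+1%:R.
have a0 : 0 <= a by exact: sqrtr_ge0.
have b0 : 0 < b by rewrite sqrtr_gt0.
have ab : a <= b by rewrite ler_wsqrtr// ler_nat.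
have b2 : n.+1%:R = b ^+ 2 by rewrite sqr_sqrtr.
have ba2 : b ^+ 2 - a ^+ 2 = 1 by rewrite !sqr_sqrtr// -natr1 addrC addKr.
have hb : b^-1 <= eps / 2.
  by have := hN n.+1 (leqW nN); rewrite ger0_norm ?invr_ge0 ?(ltW b0).
rewrite b2 -exprVn.
have h1 : 2^-1 * b^-1 <= b - a.
  rewrite ler_pdivrMr//.
  have e1 : 1 = (b - a) * (b + a) by rewrite -ba2; ring.
  have : (b - a) * (b + a) <= (b - a) * (2 * b) by rewrite ler_wpM2l ?subr_ge0//; lra.
  rewrite -e1; lra.
apply: (@le_trans _ _ (eps * (2^-1 * b^-1))); last by rewrite ler_wpM2l// ltW.
have -> : eps * (2^-1 * b^-1) = (eps / 2) * b^-1 by ring.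
by rewrite expr2 ler_wpM2r// invr_ge0 ltW.
Qed.

(** * Central limit theorem with Markov modulated variances *)

Section markov_modulated_clt.
Context d (T : measurableType d) (R : realType) (Pr : probability T R).
Variables (I : finType) (X : nat -> T -> I) (xi : nat -> T -> R).
Variable (G : nat -> set (set T)).
Hypothesis sG : forall n, sigma_algebra setT (G n).
Hypothesis GT : forall n A, G n A -> measurable A.
Hypothesis GS : forall n, G n `<=` G n.+1.
Hypothesis GX : forall n i, G n (X n @^-1` [set i]).
Hypothesis Gxi : forall n, Gmeas (G n) (xi n).
Local Notation "'E[' f ]" := (Rintegral Pr setT f).

Variables (Q : I -> I -> R) (v p : I -> R).
Hypothesis xi2_L1 : forall n, L1 Pr (fun w => xi n.+1 w ^+ 2).
Hypothesis xi_mean : forall n A, G n A -> E[fun w => \1_A w * xi n.+1 w] = 0.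
Hypothesis xi_var : forall n A, G n A ->
  E[fun w => \1_A w * xi n.+1 w ^+ 2] = E[fun w => \1_A w * v (X n w)].
Hypothesis X_step : forall (u : I -> R) n A, G n A ->
  E[fun w => \1_A w * u (X n.+1 w)] = E[fun w => \1_A w * \sum_j Q (X n w) j * u j].

Lemma G_mono m n : (m <= n)%N -> G m `<=` G n.
Proof.
move=> mn; rewrite -(subnK mn); elim: (n - m)%N => [|k ih]; first by [].
by rewrite addSn => A /ih; exact: GS.
Qed.

Lemma Gmeas_le m n (U : T -> R) : (m <= n)%N -> Gmeas (G m) U -> Gmeas (G n) U.
Proof. by move=> mn h B mB; apply: (G_mono mn); exact: h. Qed.

Lemma Gmeas_chain n (u : I -> R) : Gmeas (G n) (fun w => u (X n w)).
Proof.
apply: (@Gmeas_fin _ _ _ _ (sG n) I (X n) (fun i => cst (u i))) => // i.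
exact: Gmeas_cst.
Qed.

Lemma fin_bounded (u : I -> R) : exists2 K : R, 0 <= K & forall i, `|u i| <= K.
Proof.
exists (\sum_i `|u i|); first by apply: sumr_ge0 => i _; exact: normr_ge0.
by move=> i; rewrite (bigD1 i)//= lerDl; apply: sumr_ge0 => j _; exact: normr_ge0.
Qed.

Lemma chain_L1 n (u : I -> R) : L1 Pr (fun w => u (X n w)).
Proof.
have [K _ uK] := fin_bounded u.
apply: (@L1_bounded _ _ _ Pr _ K) => //.
exact: (Gmeas_measurable (@GT n) (Gmeas_chain n u)).
Qed.

Lemma xi_measurable n : measurable_fun setT (xi n).
Proof. exact: (Gmeas_measurable (@GT n) (Gxi n)). Qed.

Lemma xi_L1 n : L1 Pr (xi n.+1).
Proof.
by apply: L1_sqr => //; exact: xi_measurable.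
Qed.

Lemma Exp_xi n (U : T -> R) : Gmeas (G n) U ->
  L1 Pr (fun w => U w * xi n.+1 w) -> E[fun w => U w * xi n.+1 w] = 0.
Proof.
move=> gU iU; apply: (Exp_mul0 (sG n) (@GT n)) => //; first exact: xi_L1.
by move=> A gA; exact: xi_mean.
Qed.

Lemma Exp_xi2 n (U : T -> R) : Gmeas (G n) U ->
  L1 Pr (fun w => U w * xi n.+1 w ^+ 2) -> L1 Pr (fun w => U w * v (X n w)) ->
  E[fun w => U w * xi n.+1 w ^+ 2] = E[fun w => U w * v (X n w)].
Proof.
move=> gU i1 i2; apply: (Exp_mul_eq (sG n) (@GT n)) => //; first exact: chain_L1.
by move=> A gA; exact: xi_var.
Qed.

Lemma Exp_step (u : I -> R) n (U : T -> R) (K : R) : Gmeas (G n) U ->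
  (forall w, `|U w| <= K) ->
  E[fun w => U w * u (X n.+1 w)] = E[fun w => U w * \sum_j Q (X n w) j * u j].
Proof.
move=> gU bU.
have mU := Gmeas_measurable (@GT n) gU.
have i1 := chain_L1 n.+1 u.
have i2 := chain_L1 n (fun i => \sum_j Q i j * u j).
apply: (Exp_mul_eq (sG n) (@GT n)) => //.
- exact: L1M_bounded bU.
- exact: (L1M_bounded i2 mU bU).
- by move=> A gA; exact: X_step.
Qed.

Definition psum n (w : T) := \sum_(k < n) xi k.+1 w.

Lemma Gmeas_psum n : Gmeas (G n) (psum n).
Proof.
apply: Gmeas_sum => // i; apply: (@Gmeas_le i.+1) => //.
Qed.

Lemma psumS n w : psum n.+1 w = psum n w + xi n.+1 w.
Proof. by rewrite /psum big_ord_recr. Qed.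

Variables (s2 V K : R) (u : I -> R).
Hypothesis s2_ge0 : 0 <= s2.
Hypothesis V_ge0 : 0 <= V.
Hypothesis xi2_le : forall n, E[fun w => xi n.+1 w ^+ 2] <= V.
Hypothesis poisson : forall i, u i - \sum_j Q i j * u j = v i - s2.
Hypothesis K_ge0 : 0 <= K.
Hypothesis u_le : forall i, `|u i| <= K.

Lemma xi2min_L1 (h : R) n :
  L1 Pr (fun w => Num.min (`|h| * `|xi n.+1 w| ^+ 3) (xi n.+1 w ^+ 2)).
Proof. by apply: L1_min_cube => //; exact: xi_measurable. Qed.

(** The coefficient of [|h|] in [corrector_recursion]. *)
Let clt_const := K * (1 + V) + s2 * K + s2 ^+ 2 * (1 + K).

(* [-h^2/2 E(cos(h S_n + c) u(X_n))] is the Poisson corrector: it turns the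
   conditional variance [v(X_n)] of the increment into its ergodic mean [s2]. *)
Let corr h c n := E[fun w => cos (h * psum n w + c)] -
  h ^+ 2 / 2 * E[fun w => cos (h * psum n w + c) * u (X n w)].

Let cos_psum_meas h c n : Gmeas (G n) (fun w => cos (h * psum n w + c)).
Proof.
apply: (Gmeas_comp (h := fun x => cos (h * x + c))); last exact: Gmeas_psum.
by apply: continuous_measurable_fun; exact: continuous_cos_affine.
Qed.

Let sin_psum_meas h c n : Gmeas (G n) (fun w => sin (h * psum n w + c)).
Proof.
have := cos_psum_meas h (c - pi / 2) n.
by under eq_fun do rewrite addrA cosBpihalf.
Qed.

(** In the expansion around [h S_n + c] the first order term vanishes by centring and the second
    order one involves [v (X n)]. The Poisson equation writes [v] as [s2 + u - Q u], and the Markov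
    property replaces [Q u] at [X n] by [u] at [X n.+1], which the corrector at time [n.+1]
    absorbs. *)
Lemma clt_step (h c om : R) n : `|h| <= 1 ->
  E[fun w => Num.min (`|h| * `|xi n.+1 w| ^+ 3) (xi n.+1 w ^+ 2)] <= om ->
  `|corr h c n.+1 - expR (- (h ^+ 2 * s2 / 2)) * corr h c n| <=
   h ^+ 2 * (3 * om + `|h| * clt_const).
Proof.
move=> h1 hom.
pose C w := cos (h * psum n w + c); pose S w := sin (h * psum n w + c).
pose C' w := cos (h * psum n.+1 w + c).
have mC := Gmeas_measurable (@GT n) (cos_psum_meas h c n).
have mS := Gmeas_measurable (@GT n) (sin_psum_meas h c n).
have mC' := Gmeas_measurable (@GT n.+1) (cos_psum_meas h c n.+1).
have iC : L1 Pr C by exact: (L1_bounded mC (fun w => norm_cos_le1 _)).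
have iC' : L1 Pr C' by exact: (L1_bounded mC' (fun w => norm_cos_le1 _)).
have iSx : L1 Pr (fun w => S w * xi n.+1 w) by exact: (L1M_bounded (xi_L1 n) mS (fun w => norm_sin_le1 _)).
have iCx : L1 Pr (fun w => C w * xi n.+1 w ^+ 2) by exact: (L1M_bounded (xi2_L1 n) mC (fun w => norm_cos_le1 _)).
have iCv : L1 Pr (fun w => C w * v (X n w)) by exact: (L1M_bounded (chain_L1 n v) mC (fun w => norm_cos_le1 _)).
have iCu : L1 Pr (fun w => C w * u (X n w)) by exact: (L1M_bounded (chain_L1 n u) mC (fun w => norm_cos_le1 _)).
have iCu' : L1 Pr (fun w => C w * u (X n.+1 w)) by exact: (L1M_bounded (chain_L1 n.+1 u) mC (fun w => norm_cos_le1 _)).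
have iC'u' : L1 Pr (fun w => C' w * u (X n.+1 w)) by exact: (L1M_bounded (chain_L1 n.+1 u) mC' (fun w => norm_cos_le1 _)).
have iCQ : L1 Pr (fun w => C w * \sum_j Q (X n w) j * u j).
  exact: (L1M_bounded (chain_L1 n (fun i => \sum_j Q i j * u j)) mC (fun w => norm_cos_le1 _)).
pose D w := C' w - (C w - h * (S w * xi n.+1 w) - h ^+ 2 / 2 * (C w * xi n.+1 w ^+ 2)).
have iD0 : L1 Pr (fun w => C w - h * (S w * xi n.+1 w) - h ^+ 2 / 2 * (C w * xi n.+1 w ^+ 2)).
  by apply: L1B; [apply: L1B => //|]; exact: L1Zl.
have iD : L1 Pr D by exact: L1B.
have bD w : `|D w| <= 3 * h ^+ 2 * Num.min (`|h| * `|xi n.+1 w| ^+ 3) (xi n.+1 w ^+ 2).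
  have -> : D w = cos ((h * psum n w + c) + h * xi n.+1 w) - (cos (h * psum n w + c) -
     h * xi n.+1 w * sin (h * psum n w + c) - (h * xi n.+1 w) ^+ 2 / 2 * cos (h * psum n w + c)).
    rewrite /D /C' /C /S psumS (_ : h * (psum n w + xi n.+1 w) + c = (h * psum n w + c) + h * xi n.+1 w); last by ring.
    by ring.
  apply: (le_trans (cos_taylor2 _ _)); rewrite -mulrA ler_wpM2l//.
  rewrite minr_pMr ?sqr_ge0// normrM !exprMn.
  rewrite (_ : `|h| ^+ 3 * `|xi n.+1 w| ^+ 3 = h ^+ 2 * (`|h| * `|xi n.+1 w| ^+ 3))//.
  by rewrite -[h ^+ 2]real_normK ?num_real//; ring.
have ED : `|E[D]| <= 3 * h ^+ 2 * om.
  apply: (le_trans (Exp_abs_le iD _ bD)); first by apply: L1Zl; exact: xi2min_L1.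
  rewrite ExpZl; last exact: xi2min_L1.
  by rewrite ler_wpM2l// mulr_ge0// sqr_ge0.
have eSx : E[fun w => S w * xi n.+1 w] = 0 by apply: Exp_xi => //; exact: sin_psum_meas.
have eCx : E[fun w => C w * xi n.+1 w ^+ 2] = E[fun w => C w * v (X n w)].
  by apply: Exp_xi2 => //; exact: cos_psum_meas.
have eA : E[C'] = E[C] - h ^+ 2 / 2 * E[fun w => C w * v (X n w)] + E[D].
  rewrite /D ExpB// ExpB//; [|by apply: L1B => //; exact: L1Zl|exact: L1Zl].
  rewrite ExpB//; last exact: L1Zl.
  by rewrite !ExpZl// eSx eCx; ring.
have eV : E[fun w => C w * v (X n w)] = s2 * E[C] + E[fun w => C w * u (X n w)]
    - E[fun w => C w * u (X n.+1 w)].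
  rewrite (Exp_step u (cos_psum_meas h c n) (fun w => norm_cos_le1 _))//.
  rewrite -ExpZl// -ExpD//; last exact: L1Zl.
  rewrite -ExpB//; last by apply: L1D => //; exact: L1Zl.
  apply: eq_Rintegral => w _.
  have -> : v (X n w) = s2 + (u (X n w) - \sum_j Q (X n w) j * u j).
    by rewrite poisson; ring.
  by rewrite /C; ring.
have eB : `|E[fun w => C' w * u (X n.+1 w)] - E[fun w => C w * u (X n.+1 w)]| <= K * `|h| * (1 + V).
  rewrite -ExpB//.
  have iB : L1 Pr (fun w => K * `|h| * (1 + xi n.+1 w ^+ 2)).
    by apply: L1Zl; apply: L1D; [exact: L1_cst|exact: xi2_L1].
  apply: (le_trans (Exp_abs_le (L1B iC'u' iCu') iB _)).
    move=> w; rewrite -mulrBl normrM mulrC -mulrA ler_pM//.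
    apply: (le_trans (cos_lipschitz _ _)).
    have -> : h * psum n.+1 w + c - (h * psum n w + c) = h * xi n.+1 w by rewrite psumS; ring.
    rewrite normrM ler_wpM2l//.
    rewrite -[xi n.+1 w ^+ 2]real_normK ?num_real//.
    by have := sqr_ge0 (`|xi n.+1 w| - 1); have := normr_ge0 (xi n.+1 w); nra.
  rewrite ExpZl; last by apply: L1D; [exact: L1_cst|exact: xi2_L1].
  rewrite ler_wpM2l ?mulr_ge0// ExpD; [|exact: L1_cst|exact: xi2_L1].
  by rewrite Exp_cst lerD2l.
have bC : `|E[C]| <= 1.
  by have := Exp_abs_le iC (L1_cst 1) (fun w => norm_cos_le1 _); rewrite Exp_cst.
have bCu : `|E[fun w => C w * u (X n w)]| <= K.
  have := Exp_abs_le iCu (L1_cst K); rewrite Exp_cst; apply => w.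
  by rewrite /C normrM /= -[leRHS]mul1r ler_pM ?norm_cos_le1.
have hq := @expRN_approx R (h ^+ 2 * s2 / 2).
have x0 : 0 <= h ^+ 2 * s2 / 2 by rewrite divr_ge0// mulr_ge0// sqr_ge0.
have {}hq := hq x0.
rewrite /corr.
move: eA eV eB bC bCu ED hq; rewrite -/C.
set a' := E[C']; set a := E[C]; set b := E[fun w => C w * u (X n w)].
set b' := E[fun w => C' w * u (X n.+1 w)].
set b1 := E[fun w => C w * u (X n.+1 w)].
set Ev := E[fun w => C w * v (X n w)]; set r := E[D].
set q := expR _.
move=> eA eV eB bC bCu ED hq.
exact: (corrector_recursion h1 s2_ge0 V_ge0 K_ge0 eA eV eB bC bCu ED hq).
Qed.

(** The errors of the steps add up linearly because [0 <= q <= 1]; removing the correctors at times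
    [0] and [n] costs at most [h^2 K]. *)
Lemma clt_bound (h c om : R) : `|h| <= 1 -> 0 <= om ->
  (forall n, E[fun w => Num.min (`|h| * `|xi n.+1 w| ^+ 3) (xi n.+1 w ^+ 2)] <= om) ->
  forall n, `|E[fun w => cos (h * psum n w + c)] - expR (- (h ^+ 2 * s2 / 2)) ^+ n * cos c| <=
   n%:R * (h ^+ 2 * (3 * om + `|h| * clt_const)) + h ^+ 2 * K.
Proof.
move=> h1 om0 hom n.
set q := expR _; set eta := h ^+ 2 * (3 * om + _).
have q0 : 0 <= q by exact: expR_ge0.
have hh0 : 0 <= h ^+ 2 := sqr_ge0 h.
have q1 : q <= 1.
  rewrite -[leRHS](@expR0 R) ler_expR oppr_le0 divr_ge0// mulr_ge0//.
have bu m : `|E[fun w => cos (h * psum m w + c) * u (X m w)]| <= K.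
  have mC := Gmeas_measurable (@GT m) (cos_psum_meas h c m).
  have := Exp_abs_le (L1M_bounded (chain_L1 m u) mC (fun w => norm_cos_le1 _)) (L1_cst K).
  rewrite Exp_cst; apply => w.
  by rewrite normrM /= -[leRHS]mul1r ler_pM ?norm_cos_le1.
have H m : `|corr h c m - q ^+ m * corr h c 0| <= m%:R * eta.
  elim: m => [|m ih]; first by rewrite expr0 mul1r subrr normr0 mul0r.
  have -> : corr h c m.+1 - q ^+ m.+1 * corr h c 0 =
     (corr h c m.+1 - q * corr h c m) + q * (corr h c m - q ^+ m * corr h c 0).
    by rewrite exprS; ring.
  apply: (le_trans (ler_normD _ _)); rewrite -natr1 mulrDl mul1r addrC lerD//; last first.
    exact: clt_step.
  rewrite normrM ger0_norm// -[leRHS]mul1r; apply: ler_pM => //.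
have e0 : E[fun w => cos (h * psum 0 w + c)] = cos c.
  rewrite (_ : (fun w => _) = cst (cos c)) ?Exp_cst//.
  by apply/funext => w; rewrite /psum big_ord0 mulr0 add0r.
have := H n; rewrite /corr e0 => Hn.
have -> : E[fun w => cos (h * psum n w + c)] - q ^+ n * cos c =
  (E[fun w => cos (h * psum n w + c)] -
      h ^+ 2 / 2 * E[fun w => cos (h * psum n w + c) * u (X n w)] -
      q ^+ n * (cos c - h ^+ 2 / 2 * E[fun w => cos (h * psum 0 w + c) * u (X 0%N w)]))
  + h ^+ 2 / 2 * (E[fun w => cos (h * psum n w + c) * u (X n w)] -
       q ^+ n * E[fun w => cos (h * psum 0 w + c) * u (X 0%N w)]) by ring.
apply: (le_trans (ler_normD _ _)); apply: lerD => //.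
rewrite normrM ger0_norm; last by lra.
have : `|E[fun w => cos (h * psum n w + c) * u (X n w)] -
       q ^+ n * E[fun w => cos (h * psum 0 w + c) * u (X 0%N w)]| <= 2 * K.
  apply: (le_trans (ler_normB _ _)); rewrite mulr2n mulrDl mul1r lerD// normrM -[leRHS]mul1r.
  by rewrite ler_pM// ger0_norm ?exprn_ge0// exprn_ile1.
move=> hK; have : h ^+ 2 / 2 * `|E[fun w => cos (h * psum n w + c) * u (X n w)] -
       q ^+ n * E[fun w => cos (h * psum 0 w + c) * u (X 0%N w)]| <= h ^+ 2 / 2 * (2 * K).
  by rewrite ler_wpM2l//; lra.
lra.
Qed.

Hypothesis lindeberg : forall eps : R, 0 < eps -> exists2 del : R, 0 < del &
  forall (h : R) n, `|h| <= del ->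
  E[fun w => Num.min (`|h| * `|xi n.+1 w| ^+ 3) (xi n.+1 w ^+ 2)] <= eps.

(** With [h = l / sqrt n] one has [n h^2 = l^2], so [q^n] is exactly the Gaussian factor and the
    accumulated error is [l^2 (3 om + |h| clt_const) + h^2 K]. *)
Theorem clt_cos (l c : R) :
  E[fun w => cos (l * (psum n w / Num.sqrt n%:R) + c)] @[n --> \oo] -->
  expR (- (l ^+ 2 * s2 / 2)) * cos c.
Proof.
apply/cvgrPdist_le => eps eps0.
have C0 : 0 <= clt_const.
  by rewrite /clt_const !addr_ge0// !mulr_ge0// ?sqr_ge0// addr_ge0.
(* For [om = e1] and both [|h|] and [h^2] at most [e1], the error of [clt_bound] is at most
   [e1 B = eps]. *)
pose B := 1 + l ^+ 2 * (3 + clt_const) + K.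
have B1 : 1 <= B by rewrite /B -addrA lerDl addr_ge0// mulr_ge0 ?sqr_ge0//; lra.
pose e1 := eps / B.
have e10 : 0 < e1 by rewrite /e1 divr_gt0//; lra.
have [del del0 hdel] := lindeberg e10.
pose m := Num.min 1 (Num.min del e1).
have m0 : 0 < m by rewrite /m !lt_min ltr01 del0 e10.
near=> n.
have n0 : (0 < n)%N by near: n; exists 1%N.
have nR : 0 < n%:R :> R by rewrite ltr0n.
pose h := l / Num.sqrt n%:R.
have hm : `|h| <= m.
  rewrite normrM [`|_^-1|]ger0_norm ?invr_ge0 ?sqrtr_ge0//.
  rewrite ler_pdivrMr ?sqrtr_gt0// mulrC -ler_pdivrMr//.
  rewrite -[leLHS]ger0_norm ?divr_ge0 ?(ltW m0)// -sqrtr_sqr ler_wsqrtr//.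
  near: n; exists (Num.truncn ((`|l| / m) ^+ 2)).+1 => // k /= hk.
  by rewrite ltW// (lt_le_trans (truncnS_gt _))// ler_nat.
have h1 : `|h| <= 1 by rewrite (le_trans hm)// /m ge_min lexx.
have hd : `|h| <= del by rewrite (le_trans hm)// /m !ge_min lexx orbT.
have he : `|h| <= e1 by rewrite (le_trans hm)// /m !ge_min lexx !orbT.
have := clt_bound c h1 (ltW e10) (fun k => hdel h k hd) n.
have nh : n%:R * h ^+ 2 = l ^+ 2.
  by rewrite /h exprMn exprVn sqr_sqrtr ?ler0n// mulrCA divff ?mulr1// gt_eqF.
rewrite (_ : expR _ ^+ n = expR (- (l ^+ 2 * s2 / 2))); last first.
  by rewrite -expRM_natl -nh; congr expR; field.
rewrite mulrA nh distrC => hb.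
under eq_Rintegral do rewrite [psum _ _ / _]mulrC mulrA.
apply: (le_trans hb).
have hh : h ^+ 2 <= e1.
  apply: le_trans he; rewrite -[h ^+ 2]real_normK ?num_real//; have := normr_ge0 h; nra.
have g : 3 * e1 + `|h| * clt_const <= e1 * (3 + clt_const) by nra.
have : l ^+ 2 * (3 * e1 + `|h| * clt_const) <= l ^+ 2 * (e1 * (3 + clt_const)).
  by rewrite ler_wpM2l// sqr_ge0.
have : h ^+ 2 * K <= e1 * K by rewrite ler_wpM2r.
have : e1 * B = eps by rewrite /e1 divfK// gt_eqF//; lra.
rewrite /B; nra.
Unshelve. all: by end_near.
Qed.

(** * Robbins-Monro recursion *)

Variables (e : nat -> T -> R) (g : I -> R -> R).
Hypothesis Ge : forall n, Gmeas (G n) (e n).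
Hypothesis mg : forall i, measurable_fun setT (g i).
Hypothesis e_rec : forall n w,
  e n.+1 w = e n w - n.+2%:R^-1 * (g (X n w) (e n w) + xi n.+1 w).
Variables (Cg Kg : R).
Hypothesis Cg_ge0 : 0 <= Cg.
Hypothesis Kg_ge0 : 0 <= Kg.
Hypothesis g_lin : forall i x, `|g i x| <= Cg * (1 + `|x|).
Hypothesis g_sign : forall i x, 0 <= x * g i x.
Hypothesis g_away : forall del : R, 0 < del ->
  exists2 c : R, 0 < c & forall i x, del <= `|x| -> c <= x * g i x.
Hypothesis g_quad : forall i x, `|g i x - x| <= Kg * x ^+ 2.

Local Notation "'P[' A ]" := (fine (Pr A)).

Let ge n w := g (X n w) (e n w).

Let Gge n : Gmeas (G n) (ge n).
Proof.
apply: (@Gmeas_fin _ _ _ _ (sG n) I (X n) (fun i w => g i (e n w))) => // i.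
exact: (Gmeas_comp (h := g i)).
Qed.

Let e_measurable n : measurable_fun setT (e n).
Proof. exact: (Gmeas_measurable (@GT n)). Qed.

Let ge_measurable n : measurable_fun setT (ge n).
Proof. exact: (Gmeas_measurable (@GT n)). Qed.

Let sqr2 (a b : R) : (a + b) ^+ 2 <= 2 * (a ^+ 2 + b ^+ 2).
Proof. have := sqr_ge0 (a - b); nra. Qed.

Let g_sq i x : g i x ^+ 2 <= 2 * Cg ^+ 2 * (1 + x ^+ 2).
Proof.
have := g_lin i x; rewrite -(@ler_pXn2r _ 2)// ?nnegrE//; last first.
  by rewrite mulr_ge0// addr_ge0.
rewrite real_normK ?num_real// => h; apply: (le_trans h).
have -> : 2 * Cg ^+ 2 * (1 + x ^+ 2) = Cg ^+ 2 * (2 * (1 + x ^+ 2)) by ring.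
rewrite exprMn; apply: ler_wpM2l; first exact: sqr_ge0.
by have := sqr2 1 `|x|; rewrite real_normK ?num_real// expr1n.
Qed.

(** Squared steps are summed by telescoping, here and in stage 2. *)
Let inv_sq n : n.+2%:R^-1 ^+ 2 <= n.+1%:R^-1 - n.+2%:R^-1 :> R.
Proof.
have h : n.+1%:R^-1 - n.+2%:R^-1 = n.+1%:R^-1 * n.+2%:R^-1 :> R.
  rewrite -[n.+2]addn1 natrD; field.
  by rewrite !(addrC _ 1) !nat1r !gt_eqF.
by rewrite h expr2 ler_wpM2r ?invr_ge0// lef_pV2 ?posrE// ler_nat.
Qed.

Section one_step.
Variables (n : nat) (B : set T).
Hypothesis GB : G n B.
Hypothesis iB : L1 Pr (fun w => \1_B w * e n w ^+ 2).
Let gam : R := n.+2%:R^-1.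
Let D w := \1_B w * (e n w - gam * ge n w).

Let i01 w : (\1_B w : R) ^+ 2 = \1_B w.
Proof. by rewrite indicE; case: (_ \in _); rewrite ?expr1n ?expr0n. Qed.

Let ind0 w : 0 <= (\1_B w : R).
Proof. by rewrite indicE; case: (_ \in _). Qed.

Let gam0 : 0 < gam. Proof. by rewrite invr_gt0. Qed.
Let gam1 : gam <= 1. Proof. by rewrite invf_le1// ler1n. Qed.

Lemma drift_L1 : L1 Pr (fun w => \1_B w * (e n w - gam * ge n w) ^+ 2).
Proof.
have mB := GT GB.
have h : L1 Pr (fun w => 2 * (\1_B w * e n w ^+ 2) + 4 * Cg ^+ 2 * (\1_B w + \1_B w * e n w ^+ 2)).
  by apply: L1D; apply: L1Zl => //; apply: L1D => //; exact: L1_indic.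
apply: (L1_le _ h).
  apply: measurable_funM => //; apply: measurable_funX; apply: measurable_funB => //.
  exact: measurable_funM.
move=> w; rewrite ger0_norm; last by apply: mulr_ge0 => //; exact: sqr_ge0.
have -> : 2 * (\1_B w * e n w ^+ 2) + 4 * Cg ^+ 2 * (\1_B w + \1_B w * e n w ^+ 2) =
  \1_B w * (2 * (e n w ^+ 2 + 2 * Cg ^+ 2 * (1 + e n w ^+ 2))) by ring.
rewrite ler_wpM2l//; apply: (le_trans (sqr2 _ _)).
rewrite ler_wpM2l// lerD2l sqrrN exprMn.
apply: (@le_trans _ _ (ge n w ^+ 2)); last exact: g_sq.
rewrite -[leRHS]mul1r; apply: ler_wpM2r; first exact: sqr_ge0.
by rewrite expr_le1// ltW.
Qed.

(** On an event of the past the drift part is [G n]-measurable, so its product with the noise has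
    mean zero, and the noise itself contributes at most [gam^2 V]. *)
Lemma drift_noise : L1 Pr (fun w => \1_B w * e n.+1 w ^+ 2) /\
  E[fun w => \1_B w * e n.+1 w ^+ 2] <=
  E[fun w => \1_B w * (e n w - gam * ge n w) ^+ 2] + gam ^+ 2 * V.
Proof.
have mB := GT GB.
have mD : measurable_fun setT D.
  apply: measurable_funM => //; apply: measurable_funB => //; exact: measurable_funM.
have D2 w : D w ^+ 2 = \1_B w * (e n w - gam * ge n w) ^+ 2 by rewrite /D exprMn i01.
have iD2 : L1 Pr (fun w => D w ^+ 2) by under eq_fun do rewrite D2; exact: drift_L1.
have iDx : L1 Pr (fun w => D w * xi n.+1 w).
  apply: (L1_le _ (L1D iD2 (xi2_L1 n))); last by move=> w; exact: norm_mul_le_sqr.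
  by apply: measurable_funM => //; exact: xi_measurable.
have iBx : L1 Pr (fun w => \1_B w * xi n.+1 w ^+ 2) by exact: L1_indicM.
have eq w : \1_B w * e n.+1 w ^+ 2 =
    D w ^+ 2 - 2 * gam * (D w * xi n.+1 w) + gam ^+ 2 * (\1_B w * xi n.+1 w ^+ 2).
  by rewrite D2 e_rec /D -/gam -/(ge n w); ring.
have iS : L1 Pr (fun w => D w ^+ 2 - 2 * gam * (D w * xi n.+1 w)).
  by apply: L1B => //; exact: L1Zl.
split; first by under eq_fun do rewrite eq; apply: L1D => //; exact: L1Zl.
under eq_Rintegral do rewrite eq.
rewrite ExpD//; last exact: L1Zl.
rewrite ExpB//; last exact: L1Zl.
rewrite !ExpZl// (Exp_xi (U := D))//; last first.
  apply: GmeasM => //; first exact: Gmeas_indic.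
  by apply: GmeasB => //; exact: GmeasZ.
under eq_Rintegral do rewrite D2.
rewrite mulr0 subr0 lerD2l ler_wpM2l ?sqr_ge0//.
apply: le_trans (xi2_le n); apply: Exp_le => // w.
by rewrite indicE; case: (_ \in _); rewrite ?mul1r ?mul0r ?sqr_ge0.
Qed.

End one_step.

(* On [B] the drifts [E(1_B e_n g_n) / (n + 2)] are summable, hence the
   drift, and with it [e], is small at arbitrarily late times. *)
Section stage1.
Variable M : R.
(** Moments of [e 0] are not at hand; cutting it at level [M] makes all localized second moments
    finite. *)
Let B := [set w | `|e 0%N w| <= M].

Let GB n : G n B.
Proof.
apply: (G_mono (leq0n n)).
have -> : B = (fun w => `|e 0%N w|) @^-1` `]-oo, M]%classic.
  by apply/seteqP; split => w /=; rewrite in_itv.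
by apply: (Gmeas_comp (h := fun x => `|x|)).
Qed.

Let mB : measurable B. Proof. exact: GT (GB 0). Qed.

Let iw n : L1 Pr (fun w => \1_B w * e n w ^+ 2).
Proof.
elim: n => [|n ih]; last by have [] := drift_noise (GB n) ih.
apply: (L1_bounded (M := M ^+ 2)).
  by apply: measurable_funM => //; exact: measurable_funX.
move=> w; rewrite indicE; case: (boolP (w \in B)) => [|_].
  rewrite inE mul1r normrX => h; rewrite lerXn2r// nnegrE.
  by rewrite (le_trans _ h).
by rewrite mul0r normr0 sqr_ge0.
Qed.

Let wk n := E[fun w => \1_B w * e n w ^+ 2].
Let Ek n := E[fun w => \1_B w * (e n w * ge n w)].
Let A := 2 * Cg ^+ 2 + V.

Let A0 : 0 <= A. Proof. by rewrite /A addr_ge0// mulr_ge0 ?sqr_ge0. Qed.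

Let iE n : L1 Pr (fun w => \1_B w * (e n w * ge n w)).
Proof.
have h : L1 Pr (fun w => \1_B w * e n w ^+ 2 + 2 * Cg ^+ 2 * (\1_B w + \1_B w * e n w ^+ 2)).
  apply: L1D => //; apply: L1Zl; apply: L1D => //; exact: L1_indic.
apply: (L1_le _ h).
  by apply: measurable_funM => //; exact: measurable_funM.
move=> w; have i0 : 0 <= (\1_B w : R) by rewrite indicE; case: (_ \in _).
rewrite normrM ger0_norm//.
have -> : \1_B w * e n w ^+ 2 + 2 * Cg ^+ 2 * (\1_B w + \1_B w * e n w ^+ 2) =
  \1_B w * (e n w ^+ 2 + 2 * Cg ^+ 2 * (1 + e n w ^+ 2)) by ring.
rewrite ler_wpM2l// (le_trans (norm_mul_le_sqr _ _))// lerD2l; exact: g_sq.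
Qed.

Let wk_ge0 n : 0 <= wk n.
Proof.
by apply: Exp_ge0 => w; rewrite mulr_ge0 ?sqr_ge0.
Qed.

Let Ek_ge0 n : 0 <= Ek n.
Proof.
by apply: Exp_ge0 => w; rewrite mulr_ge0 ?g_sign.
Qed.

(** The constant [A] gathers the noise [V] and the squared drift, bounded through the linear growth
    of [g]. *)
Let wk_rec n : wk n.+1 <= wk n - 2 * n.+2%:R^-1 * Ek n + n.+2%:R^-1 ^+ 2 * (A * (wk n + 1)).
Proof.
have [_ h] := drift_noise (GB n) (iw n); apply: (le_trans h).
set gam := n.+2%:R^-1.
have i1 := drift_L1 (GB n) (iw n).
have i2 : L1 Pr (fun w => \1_B w * e n w ^+ 2 - 2 * gam * (\1_B w * (e n w * ge n w))
   + gam ^+ 2 * (2 * Cg ^+ 2) * (\1_B w + \1_B w * e n w ^+ 2)).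
  apply: L1D; first by apply: L1B => //; exact: L1Zl.
  by apply: L1Zl; apply: L1D => //; exact: L1_indic.
have : E[fun w => \1_B w * (e n w - gam * ge n w) ^+ 2] <=
   wk n - 2 * gam * Ek n + gam ^+ 2 * (2 * Cg ^+ 2) * (1 + wk n).
  apply: (@le_trans _ _ (E[fun w => \1_B w * e n w ^+ 2 - 2 * gam * (\1_B w * (e n w * ge n w))
   + gam ^+ 2 * (2 * Cg ^+ 2) * (\1_B w + \1_B w * e n w ^+ 2)])).
    apply: Exp_le => // w.
    have i0 : 0 <= (\1_B w : R) by rewrite indicE; case: (_ \in _).
    have -> : \1_B w * e n w ^+ 2 - 2 * gam * (\1_B w * (e n w * ge n w))
       + gam ^+ 2 * (2 * Cg ^+ 2) * (\1_B w + \1_B w * e n w ^+ 2) =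
      \1_B w * (e n w ^+ 2 - 2 * gam * (e n w * ge n w) + gam ^+ 2 * (2 * Cg ^+ 2 * (1 + e n w ^+ 2))) by ring.
    rewrite ler_wpM2l// -[_ * ge n w in leLHS]mulr1.
    have -> : (e n w - gam * ge n w * 1) ^+ 2 = e n w ^+ 2 - 2 * gam * (e n w * ge n w) + gam ^+ 2 * ge n w ^+ 2 by ring.
    rewrite lerD2l ler_wpM2l ?sqr_ge0//; exact: g_sq.
  have i3 : L1 Pr (fun w => \1_B w + \1_B w * e n w ^+ 2) by apply: L1D => //; exact: L1_indic.
  have i4 : L1 Pr (fun w => \1_B w * e n w ^+ 2 - 2 * gam * (\1_B w * (e n w * ge n w))).
    by apply: L1B => //; exact: L1Zl.
  rewrite ExpD//; last exact: L1Zl.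
  rewrite ExpB//; last exact: L1Zl.
  rewrite !ExpZl// lerD2l; apply: ler_wpM2l.
    by apply: mulr_ge0; [exact: sqr_ge0|apply: mulr_ge0 => //; exact: sqr_ge0].
  rewrite ExpD//; last exact: L1_indic.
  by rewrite lerD2r Exp_indic// prob_le1.
have : gam ^+ 2 * V <= gam ^+ 2 * (V * (1 + wk n)).
  by rewrite ler_wpM2l ?sqr_ge0// ler_peMr// lerDl.
rewrite /A; lra.
Qed.

Let W := (wk 0 + 1) * expR A.

(** By the sign of the drift, [wk + 1] grows at most by the factor [1 + A gam^2 <= exp (A gam^2)],
    and the squared steps sum to at most 1. *)
Let wk_le n : wk n + 1 <= W.
Proof.
have h : wk n + 1 <= (wk 0 + 1) * expR (A * (1 - n.+1%:R^-1)).
  elim: n => [|n ih]; first by rewrite invr1 subrr mulr0 expR0 mulr1.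
  have w1 : 0 <= wk n + 1 by rewrite addr_ge0.
  apply: (@le_trans _ _ ((wk n + 1) * (1 + A * n.+2%:R^-1 ^+ 2))).
    have g0 : 0 <= n.+2%:R^-1 :> R by rewrite invr_ge0.
    have := wk_rec n; have := mulr_ge0 g0 (Ek_ge0 n).
    move: (wk n) (wk n.+1) (Ek n) (n.+2%:R^-1 : R) A => x y z t a; lra.
  apply: (@le_trans _ _ ((wk n + 1) * expR (A * n.+2%:R^-1 ^+ 2))).
    by rewrite ler_wpM2l// expR_ge1Dx.
  apply: (@le_trans _ _ ((wk 0 + 1) * expR (A * (1 - n.+1%:R^-1)) * expR (A * n.+2%:R^-1 ^+ 2))).
    by rewrite ler_wpM2r ?expR_ge0.
  rewrite -mulrA -expRD ler_wpM2l ?addr_ge0// ler_expR -mulrDr ler_wpM2l//.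
  have := inv_sq n; move: (n.+1%:R^-1 : R) (n.+2%:R^-1 : R) => x y; lra.
by apply: (le_trans h); rewrite ler_wpM2l ?addr_ge0// ler_expR -[leRHS]mulr1 ler_wpM2l// lerBlDr lerDl invr_ge0.
Qed.

(** If [Ek] were at least [eps] from [m0] on, [Pk] would be non-increasing, although its logarithmic
    term, standing for the divergent sum of the steps, is unbounded. The term [A W / (n + 1)] is a
    reserve whose decrements pay for the errors [gam^2 A (wk + 1)]. *)
Lemma small_drift (eps : R) (m0 : nat) : 0 < eps -> exists2 m, (m0 <= m)%N & Ek m < eps.
Proof.
move=> eps0; apply: contrapT => H.
have hE m : (m0 <= m)%N -> eps <= Ek m.
  by move=> m0m; rewrite leNgt; apply/negP => h; apply: H; exists m.
pose Pk n := wk n + A * W * n.+1%:R^-1 + 2 * eps * ln n.+2%:R.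
have W0 : 0 <= W by rewrite (le_trans _ (wk_le 0)) ?addr_ge0.
have dec n : (m0 <= n)%N -> Pk n.+1 <= Pk n.
  move=> m0n; rewrite /Pk.
  have hl : ln n.+3%:R - ln n.+2%:R <= n.+2%:R^-1 :> R.
    rewrite -ln_div ?posrE//.
    have -> : n.+3%:R / n.+2%:R = 1 + n.+2%:R^-1 :> R.
      by rewrite -[n.+3%:R]natr1 mulrDl mul1r divff// pnatr_eq0.
    by apply: le_ln1Dx; rewrite (lt_trans (ltrN10 _))// invr_gt0.
  have h1 := wk_rec n; have h2 := wk_le n; have h3 := inv_sq n; have h4 := hE n m0n.
  have g0 : 0 <= n.+2%:R^-1 :> R by rewrite invr_ge0.
  have h5 : n.+2%:R^-1 ^+ 2 * (A * (wk n + 1)) <= (n.+1%:R^-1 - n.+2%:R^-1) * (A * W).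
    apply: ler_pM; [exact: sqr_ge0| |exact: h3|exact: ler_wpM2l].
    by apply: mulr_ge0 => //; exact: addr_ge0.
  have h6 : n.+2%:R^-1 * eps <= n.+2%:R^-1 * Ek n by rewrite ler_wpM2l.
  have h7 : eps * (ln n.+3%:R - ln n.+2%:R) <= eps * n.+2%:R^-1 by rewrite ler_wpM2l// ltW.
  move: h1 h5 h6 h7; move: (wk n) (wk n.+1) (Ek n) (ln n.+2%:R) (ln n.+3%:R) A W.
  move: (n.+1%:R^-1 : R) (n.+2%:R^-1 : R) => x y w w' E l l' a b; lra.
have bd n : (m0 <= n)%N -> Pk n <= Pk m0.
  move=> mn; rewrite -(subnK mn); elim: (n - m0)%N => [|k ih]; first by [].
  by rewrite addSn (le_trans (dec _ _))// leq_addl.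
pose x := Pk m0 / (2 * eps).
pose n := maxn m0 (Num.truncn (expR x)).
have := bd n (leq_maxl _ _).
have e2 : 0 < 2 * eps by lra.
have : x < ln n.+2%:R.
  rewrite -[x]expRK ltr_ln ?posrE ?expR_gt0//.
  apply: (lt_le_trans (truncnS_gt _)); rewrite ler_nat ltnS (leq_trans (leq_maxr m0 _))//.
rewrite /x ltr_pdivrMr// => h1; rewrite {1}/Pk => h2.
have h3 : 0 <= A * W * n.+1%:R^-1 by rewrite mulr_ge0 ?invr_ge0// mulr_ge0.
have h4 := wk_ge0 n; move: h1 h2 h3 h4.
move: (Pk m0) (ln n.+2%:R) (A * W * n.+1%:R^-1) (wk n) => a b c w; lra.
Qed.

(** Where [|e m| > del], the product [e g] is at least some [c > 0], so a Markov inequality turns a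
    small drift into a small probability. *)
Lemma often_small (eps del : R) (m0 : nat) : 0 < eps -> 0 < del ->
  exists2 m, (m0 <= m)%N & P[B `&` [set w | del < `|e m w|]] <= eps.
Proof.
move=> eps0 del0; have [c c0 hc] := g_away del0.
have [m m0m hm] := small_drift m0 (mulr_gt0 c0 eps0).
exists m => //.
have mA : measurable (B `&` [set w | del < `|e m w|]).
  by apply: measurableI => //; exact: measurable_norm_gt.
rewrite -(ler_pM2l c0) -Exp_indic// -ExpZl; last exact: L1_indic.
apply: le_trans (ltW hm); apply: Exp_le => //; first by apply: L1Zl; exact: L1_indic.
move=> w; rewrite indicI /=; rewrite !indicE.
case: (boolP (w \in B)) => [_|_]; last by rewrite !mul0r mulr0.
rewrite !mul1r; case: (boolP (w \in _)) => [|_]; last by rewrite mulr0 g_sign.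
by rewrite inE/= mulr1 => /ltW; exact: hc.
Qed.

End stage1.

(* As long as [|e| <= del] the step contracts [e^2] by [1 - 5/4 gam], so the
   second moment localized to [stay j] decays like [1 / (m + j)]. *)
Section stage2.
Variables (m : nat) (del del' : R).
Hypothesis m_ge5 : (5 <= m)%N.
Hypothesis del'_ge0 : 0 <= del'.
Hypothesis del'_le : del' <= del.
Hypothesis Kg_del : Kg * del <= 4^-1.

(** Two levels: the error is within the small [del'] at time [m] and within the larger [del]
    afterwards. The gap between them is what makes an exit improbable. *)
Fixpoint stay (j : nat) : set T := match j with
  | 0 => [set w | `|e m w| <= del']
  | i.+1 => stay i `&` [set w | `|e (m + i.+1)%N w| <= del]
  end.

Let Gle k (x : R) : G k [set w | `|e k w| <= x].
Proof.
have -> : [set w | `|e k w| <= x] = (fun w => `|e k w|) @^-1` `]-oo, x]%classic.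
  by apply/seteqP; split => w /=; rewrite in_itv.
exact: (Gmeas_comp (h := fun x => `|x|)).
Qed.

Let Gstay j : G (m + j) (stay j).
Proof.
elim: j => [|j ih] /=; first by rewrite addn0; exact: Gle.
by apply: Gmeas_setI; [exact: sG|rewrite addnS; exact: GS|exact: Gle].
Qed.

Lemma measurable_stay j : measurable (stay j).
Proof. exact: GT (Gstay j). Qed.

Let stay_small j w : stay j w -> `|e (m + j)%N w| <= del.
Proof. by case: j => [|j] /=; [rewrite addn0 => /le_trans; exact|case]. Qed.

Let indE (A : set T) w : A w -> (\1_A w : R) = 1.
Proof. by move=> Aw; rewrite indicE mem_set. Qed.
Let indN (A : set T) w : ~ A w -> (\1_A w : R) = 0.
Proof. by move=> Aw; rewrite indicE memNset. Qed.

Let iz j : L1 Pr (fun w => \1_(stay j) w * e (m + j)%N w ^+ 2).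
Proof.
apply: (L1_bounded (M := del ^+ 2)).
  apply: measurable_funM; last exact: measurable_funX.
  apply: measurable_indic; exact: measurable_stay.
move=> w; have [h|h] := pselect (stay j w).
  rewrite indE// mul1r normrX lerXn2r// ?nnegrE//; last exact: stay_small.
  exact: le_trans del'_le.
by rewrite indN// mul0r normr0 sqr_ge0.
Qed.

Let z j := E[fun w => \1_(stay j) w * e (m + j)%N w ^+ 2].
Let gam j : R := (m + j).+2%:R^-1.

Let z_ge0 j : 0 <= z j.
Proof. by apply: Exp_ge0 => w; rewrite mulr_ge0 ?sqr_ge0. Qed.

Let gam_ge0 j : 0 <= gam j. Proof. by rewrite invr_ge0. Qed.

(** [m >= 5] gives [gam j <= 1 / 7], below the threshold [4 / 25] of [drift_small]. *)
Let gam_le j : gam j <= 4 / 25.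
Proof.
rewrite /gam -[4 / 25]invrK lef_pV2 ?posrE ?invr_gt0//.
apply: (@le_trans _ _ 7); first by rewrite invf_div; lra.
by rewrite ler_nat !ltnS (leq_trans m_ge5)// leq_addr.
Qed.

(** As [|y - x| <= |x| / 4], one has [x y >= 3/4 x^2] and [y^2 <= 25/16 x^2]. The square is thus at
    most [(1 - 3/2 gm + 25/16 gm^2) x^2], and [gm <= 4/25] makes the last term at most [gm / 4]. *)
Let drift_small (x y gm : R) : 0 <= gm -> gm <= 4 / 25 -> `|x| <= del ->
  `|y - x| <= Kg * x ^+ 2 -> (x - gm * y) ^+ 2 <= (1 - 5 / 4 * gm) * x ^+ 2.
Proof.
move=> gm0 gm1 xd yx.
have h : `|y - x| <= `|x| / 4.
  apply: (le_trans yx); rewrite -[x ^+ 2]real_normK ?num_real//.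
  have kx : Kg * `|x| <= 4^-1 := le_trans (ler_wpM2l Kg_ge0 xd) Kg_del.
  by rewrite expr2 mulrA mulrC ler_wpM2l.
have h2 : (y - x) ^+ 2 <= x ^+ 2 / 16.
  rewrite -[(y - x) ^+ 2]real_normK ?num_real// -[x ^+ 2]real_normK ?num_real//.
  have -> : `|x| ^+ 2 / 16 = (`|x| / 4) ^+ 2 by field.
  by rewrite lerXn2r// nnegrE divr_ge0.
have h3 : - (x * (y - x)) <= x ^+ 2 / 4.
  apply: (le_trans (ler_norm _)); rewrite normrN normrM -[x ^+ 2]real_normK ?num_real//.
  by have := ler_wpM2l (normr_ge0 x) h; lra.
have -> : (x - gm * y) ^+ 2 = (1 - gm) ^+ 2 * x ^+ 2 + 2 * gm * (1 - gm) * (- (x * (y - x)))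
   + gm ^+ 2 * (y - x) ^+ 2 by ring.
have c1 : 0 <= 2 * gm * (1 - gm) by nra.
have c2 := sqr_ge0 gm.
have := ler_wpM2l c1 h3; have := ler_wpM2l c2 h2; have := sqr_ge0 x => x2.
have : gm * (25 / 4 * gm - 1) * x ^+ 2 <= 0.
  by apply: mulr_le0_ge0 => //; apply: mulr_ge0_le0 => //; lra.
set X2 := x ^+ 2 in x2 *; set Y2 := (y - x) ^+ 2; set XY := x * (y - x).
nra.
Qed.

(** On the part of [stay j] that is lost at the next step, [e^2] exceeds [del^2]. Keeping that part
    on the left gives one inequality serving both the exit probability and the second moment. *)
Let z_rec j : z j.+1 + del ^+ 2 * (P[stay j] - P[stay j.+1]) <=
  (1 - 5 / 4 * gam j) * z j + gam j ^+ 2 * V.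
Proof.
have mS i := measurable_stay i.
have [i1 h] := drift_noise (Gstay j) (iz j).
have i0 := drift_L1 (Gstay j) (iz j).
apply: (@le_trans _ _ (E[fun w => \1_(stay j) w * e (m + j).+1 w ^+ 2])).
  have iS i : L1 Pr (\1_(stay i) : T -> R) by apply: L1_indic.
  rewrite -!Exp_indic// -ExpB// -ExpZl; last exact: L1B.
  rewrite -ExpD//; last by apply: L1Zl; exact: L1B.
  apply: Exp_le => //; first by apply: L1D => //; apply: L1Zl; exact: L1B.
  move=> w; rewrite addnS.
  have [h0|h0] := pselect (stay j w); last first.
    by rewrite (indN h0) !indN ?subrr ?mulr0 ?mul0r ?addr0// => -[].
  have [h1|h1] := pselect (stay j.+1 w).
    by rewrite (indE h0) (indE h1) subrr mulr0 addr0.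
  rewrite (indE h0) (indN h1) subr0 mulr1 mul0r add0r mul1r.
  have : del < `|e (m + j).+1 w|.
    by rewrite ltNge; apply/negP => h2; apply: h1; split => //=; rewrite addnS.
  move=> /ltW hd; rewrite -[e _ w ^+ 2]real_normK ?num_real// lerXn2r// ?nnegrE//.
  exact: le_trans del'_le.
apply: (le_trans h); rewrite lerD2r -ExpZl//.
apply: Exp_le => //; first exact: L1Zl.
move=> w; have [h0|h0] := pselect (stay j w); last by rewrite indN// !mul0r mulr0.
rewrite indE// !mul1r; apply: drift_small; [exact: gam_ge0|exact: gam_le|exact: stay_small|exact: g_quad].
Qed.

Let z0_le : z 0 <= del' ^+ 2.
Proof.
have := Exp_le (iz 0) (L1_cst (del' ^+ 2)); rewrite Exp_cst; apply => w /=.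
have [h|h] := pselect (stay 0 w); last by rewrite indN// mul0r sqr_ge0.
rewrite indE// mul1r addn0 -[e m w ^+ 2]real_normK ?num_real// lerXn2r// nnegrE//.
Qed.

(** A maximal inequality of Kolmogorov type, by summation of [z_rec]; the noise terms telescope
    below [V / (m + 1)]. *)
Lemma stay_prob j : del ^+ 2 * (P[stay 0] - P[stay j]) <= del' ^+ 2 + V * m.+1%:R^-1.
Proof.
have : z j + del ^+ 2 * (P[stay 0] - P[stay j]) <=
    z 0 + V * (m.+1%:R^-1 - (m + j).+1%:R^-1).
  elim: j => [|j ih]; first by rewrite addn0 !subrr !mulr0.
  have := z_rec j; have := mulr_ge0 (gam_ge0 j) (z_ge0 j).
  have : gam j ^+ 2 * V <= ((m + j).+1%:R^-1 - gam j) * V by rewrite ler_wpM2r// inv_sq.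
  rewrite addnS -/(gam j); move: ih.
  move: (z j) (z j.+1) (P[stay j]) (P[stay j.+1]) (P[stay 0]) (gam j) (m.+1%:R^-1 : R) ((m + j).+1%:R^-1 : R) (del ^+ 2) (z 0) => a1 a2 a3 a4 a5 a6 a7 a8 a9 a10; nra.
have := z_ge0 j; have := z0_le.
have : 0 <= V * (m + j).+1%:R^-1 by rewrite mulr_ge0 ?invr_ge0.
move: (z j) (P[stay j]) (P[stay 0]) (m.+1%:R^-1 : R) ((m + j).+1%:R^-1 : R) (del ^+ 2) (del' ^+ 2) (z 0) => a1 a3 a5 a7 a8 a9 a10 a11; lra.
Qed.

Let Kz := del' ^+ 2 * m.+1%:R + 4 * V.

(** Passing from [1 / (m + j + 1)] to [1 / (m + j + 2)] uses up rate 1 of the contraction [5/4]. The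
    remaining [1/4] absorbs the noise, whence the [4 V] in [Kz]. *)
Let z_le j : z j <= Kz * (m + j).+1%:R^-1.
Proof.
have Kz4 : 4 * V <= Kz by rewrite /Kz lerDr mulr_ge0 ?sqr_ge0.
elim: j => [|j ih].
  rewrite addn0 ler_pdivlMr ?ltr0n//.
  apply: (@le_trans _ _ (del' ^+ 2 * m.+1%:R)); first by rewrite ler_wpM2r.
  by rewrite /Kz lerDl mulr_ge0.
have h := z_rec j.
have hd : 0 <= del ^+ 2 * (P[stay j] - P[stay j.+1]).
  rewrite mulr_ge0 ?sqr_ge0// subr_ge0; apply: prob_le; try exact: measurable_stay.
  by move=> w [].
have ee : (m + j).+1%:R^-1 - gam j = (m + j).+1%:R^-1 * gam j.
  have mj0 : 0 <= m%:R + j%:R :> R by rewrite addr_ge0.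
  rewrite /gam -[(m + j).+2]addn1 natrD; field.
  by apply/andP; split; rewrite gt_eqF//; lra.
have g1 : gam j <= (m + j).+1%:R^-1 by rewrite lef_pV2 ?posrE// ler_nat.
have c0 : 0 <= 1 - 5 / 4 * gam j by have := gam_le j; lra.
have := ler_wpM2l c0 ih; rewrite addnS -/(gam j).
have := gam_ge0 j; move: h hd ee g1 Kz4 V_ge0.
move: (z j) (z j.+1) (del ^+ 2 * _) (gam j) ((m + j).+1%:R^-1 : R) Kz V => a b c x y K0 V0.
move=> h c0' ee xy KV V00 x0 ih'.
have k1 : 0 <= (y - x) * x * V0 by rewrite !mulr_ge0// subr_ge0.
have k2 : 0 <= (y * x) * (K0 - 4 * V0) by rewrite !mulr_ge0 ?subr_ge0// (le_trans x0).
have k3 : K0 * (y - x) = K0 * (y * x) by rewrite ee.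
nra.
Qed.

(** On [stay j] this dominates the growth of [|rem|] from [m] to [m + j], and unlike [rem] it has an
    expectation that stage 2 controls. *)
Definition stay_sum j w := Kg * \sum_(i < j) \1_(stay i) w * e (m + i)%N w ^+ 2.

Lemma stay_sum_L1 j : L1 Pr (stay_sum j).
Proof. by apply: L1Zl; apply: L1_sum => i; exact: iz. Qed.

Lemma Exp_stay_sum j :
  E[stay_sum j] <= Kg * Kz * \sum_(k < m + j) k.+1%:R^-1.
Proof.
rewrite /stay_sum ExpZl; last by apply: L1_sum => i; exact: iz.
rewrite Exp_sum; last by move=> i; exact: iz.
have Kz0 : 0 <= Kz by rewrite /Kz addr_ge0// mulr_ge0 ?sqr_ge0.
rewrite -mulrA ler_wpM2l// mulr_sumr.
apply: (@le_trans _ _ (\sum_(i < j) Kz * (m + i).+1%:R^-1)).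
  by apply: ler_sum => i _; exact: z_le.
rewrite [leRHS]big_split_ord/= lerDr; apply: sumr_ge0 => i _.
by rewrite mulr_ge0 ?invr_ge0.
Qed.

End stage2.

Definition rem n w := \sum_(k < n) (ge k w - e k w).

Lemma rem_stay m del del' j w : stay m del del' j w ->
  `|rem (m + j) w| <= `|rem m w| + stay_sum m del del' j w.
Proof.
elim: j => [|j ih] /=; first by rewrite addn0 /stay_sum big_ord0 mulr0 addr0.
move=> [hj _]; rewrite addnS /rem big_ord_recr/= -/(rem _ w).
rewrite (le_trans (ler_normD _ _))// /stay_sum big_ord_recr/= mulrDr addrA lerD//.
  exact: ih.
by rewrite indicE mem_set// mul1r; exact: g_quad.
Qed.

(** Multiplication by [n + 2] removes the step size, and the excess [e n] in
    [(n + 2) e n = (n + 1) e n + e n] cancels the linear part of [g]. *)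
Lemma e_sum n w : n.+1%:R * e n w = e 0%N w - rem n w - psum n w.
Proof.
elim: n => [|n ih]; first by rewrite mul1r /rem /psum !big_ord0 !subr0.
rewrite e_rec psumS /rem big_ord_recr/= -/(rem n w) -/(ge n w).
rewrite mulrBr mulrA divff ?pnatr_eq0// mul1r.
have -> : n.+2%:R * e n w = n.+1%:R * e n w + e n w by rewrite -[n.+2%:R]natr1 mulrDl mul1r.
by rewrite ih; ring.
Qed.

Let mrem n : measurable_fun setT (rem n).
Proof. by apply: measurable_sum => k; exact: measurable_funB. Qed.

Let mpsum n : measurable_fun setT (psum n).
Proof. exact: (Gmeas_measurable (@GT n) (Gmeas_psum n)). Qed.

(** The order of choices matters: [del] makes [g] nearly linear, [M] bounds [e 0] off a small event,
    [m] is a late time at which [e] is probably within [del'], and only then does [n] grow. On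
    [stay], [|rem n|] is at most that of the fixed variable [rem m] plus a sum with expectation of
    harmonic size. *)
Lemma rem_negligible : cvg0P Pr (fun n w => (Num.sqrt n%:R)^-1 * rem n w).
Proof.
move=> eta eps eta0 eps0.
pose del : R := (4 * (Kg + 1))^-1.
have Kg1 : 0 < 4 * (Kg + 1) by rewrite mulr_gt0// ltr_wpDl.
have del0 : 0 < del by rewrite invr_gt0.
have Kgd : Kg * del <= 4^-1.
  by rewrite /del ler_pdivrMr//; lra.
(* [t <= 1] gives [del' <= del], and [t^2 <= t <= eps / 8] gives [del'^2 <= del^2 eps / 8]. *)
pose t : R := Num.min 1 (eps / 8).
have eps8 : 0 < eps / 8 by lra.
have t0 : 0 < t by rewrite /t lt_min ltr01 eps8.
have t1 : t <= 1 by rewrite /t ge_min lexx.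
have te : t <= eps / 8 by rewrite /t ge_min lexx orbT.
pose del' := del * t.
have del'0 : 0 < del' by rewrite mulr_gt0.
have del'd : del' <= del by rewrite /del' ler_piMr// ltW.
have [M hM] := rv_tight Pr (e_measurable 0) eps8.
have d2 : 0 < del ^+ 2 by rewrite exprn_gt0.
(* From [m0] on, the noise term of [stay_prob] is at most [del^2 eps / 8]. *)
pose m0 := maxn 5 (Num.truncn (V / (del ^+ 2 * (eps / 8)))).
have [m m0m hm] := often_small M m0 eps8 del'0.
have m5 : (5 <= m)%N by rewrite (leq_trans _ m0m)// leq_maxl.
have Vm : V * m.+1%:R^-1 <= del ^+ 2 * (eps / 8).
  have dd : 0 < del ^+ 2 * (eps / 8) by apply: mulr_gt0.
  rewrite ler_pdivrMr ?ltr0n// mulrC -ler_pdivrMr// ltW//.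
  by rewrite (lt_le_trans (truncnS_gt _))// ler_nat ltnS (leq_trans _ m0m)// leq_maxr.
pose J := stay m del del'.
have mJ j : measurable (J j) by exact: measurable_stay.
have J0 : 1 - P[J 0] <= eps / 4.
  have mA : measurable [set w | M < `|e 0%N w|] by exact: measurable_norm_gt.
  have mB : measurable ([set w | `|e 0%N w| <= M] `&` [set w | del' < `|e m w|]).
    apply: measurableI; last exact: measurable_norm_gt.
    rewrite [X in measurable X](_ : _ = ~` [set w | M < `|e 0%N w|]).
      exact: measurableC.
    by apply/seteqP; split => w /=; rewrite leNgt => /negP.
  rewrite -prob_setC//.
  apply: (@le_trans _ _ (P[[set w | M < `|e 0%N w|] `|`
       ([set w | `|e 0%N w| <= M] `&` [set w | del' < `|e m w|])])).
    apply: prob_le.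
    - exact: measurableC.
    - exact: measurableU.
    - move=> w /= h; case: (leP `|e 0%N w| M) => h0; [right|by left].
      by split => //; rewrite ltNge; apply/negP.
  by have := prob_union Pr mA mB; lra.
have JC j : 1 - P[J j] <= eps / 2.
  have h := stay_prob m5 (ltW del'0) del'd Kgd j.
  have h2 : del ^+ 2 * (P[J 0] - P[J j]) <= del ^+ 2 * (eps / 4).
    apply: (le_trans h).
    have : del' ^+ 2 <= del ^+ 2 * (eps / 8).
      rewrite /del' exprMn ler_wpM2l ?(ltW d2)//; apply: le_trans te.
      by rewrite expr2 ler_piMr// ltW.
    by move: Vm; move: (V * _) (del' ^+ 2) (del ^+ 2) => a b c; lra.
  rewrite ler_pM2l// in h2; lra.
pose Kz := del' ^+ 2 * m.+1%:R + 4 * V.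
have Kz0 : 0 <= Kz by rewrite /Kz addr_ge0// mulr_ge0// sqr_ge0.
(* Chosen so that [2 c Kg Kz <= (eta / 2) (eps / 4)], the budget of the Markov inequality for
   [A3]. *)
pose c := (eps * eta) / (16 * (Kg * Kz + 1)).
have KK0 : 0 <= Kg * Kz by rewrite mulr_ge0.
have c0 : 0 < c by rewrite /c divr_gt0 ?mulr_gt0//; lra.
have [N0 hN0] := harmonic_small c0.
have eta2 : 0 < eta / 2 by lra.
have [N1 hN1] := cvg0P_rv Pr (mrem m) (@inv_sqrt_small R) eta2 eps8.
pose N2 := (Num.truncn ((N0%:R / c) ^+ 2)).+1.
exists (maxn m (maxn N1 N2)) => n; rewrite !geq_max => /andP[mn /andP[n1 n2]].
pose j := (n - m)%N.
have nE : n = (m + j)%N by rewrite /j subnKC.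
have n0 : (0 < n)%N by rewrite (leq_trans _ mn)// (leq_trans _ m5).
have sn0 : 0 < Num.sqrt n%:R :> R by rewrite sqrtr_gt0 ltr0n.
have hS : N0%:R <= c * Num.sqrt n%:R.
  have cN : 0 <= N0%:R / c by rewrite divr_ge0 ?ler0n// ltW.
  rewrite mulrC -ler_pdivrMr// -[leLHS]ger0_norm// -sqrtr_sqr ler_wsqrtr//.
  by rewrite ltW// (lt_le_trans (truncnS_gt _))// ler_nat.
have mQ : measurable_fun setT (stay_sum m del del' j).
  have := @stay_sum_L1 m del del' (ltW del'0) del'd j.
  exact: L1_measurable.
have Q0 w : 0 <= stay_sum m del del' j w.
  rewrite /stay_sum mulr_ge0//; apply: sumr_ge0 => i _.
  by rewrite mulr_ge0 ?sqr_ge0.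
pose A1 := ~` J j.
pose A2 := [set w | eta / 2 < `|(Num.sqrt n%:R)^-1 * rem m w|].
pose A3 := [set w | eta / 2 * Num.sqrt n%:R < stay_sum m del del' j w].
have mA2 : measurable A2 by apply: measurable_norm_gt; exact: measurable_funM.
have mA3 : measurable A3.
  rewrite [X in measurable X](_ : _ = [set w | eta / 2 * Num.sqrt n%:R < `|stay_sum m del del' j w|]).
    exact: measurable_norm_gt.
  by apply/seteqP; split => w /=; rewrite ger0_norm.
have mA1 : measurable A1 by exact: measurableC.
apply: (@le_trans _ _ (P[A1 `|` (A2 `|` A3)])).
  apply: prob_le.
  - by apply: measurable_norm_gt; exact: measurable_funM.
  - by apply: measurableU => //; exact: measurableU.
  - move=> w /= h; have [hJ|hJ] := pselect (J j w); [right|by left].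
    case: (ltP (eta / 2) (`|(Num.sqrt n%:R)^-1 * rem m w|)) => h2; [by left|right].
    rewrite /A3 /= ltNge; apply/negP => h3.
    have h4 := rem_stay hJ; rewrite -nE in h4.
    move: h h2; rewrite !normrM ger0_norm ?invr_ge0 ?(ltW sn0)//.
    rewrite ![_^-1 * _]mulrC ltr_pdivlMr// ler_pdivrMr//.
    move: h3 h4; move: (stay_sum m del del' j w) (Num.sqrt n%:R) => a b; lra.
have hA1 : P[A1] <= eps / 2 by rewrite prob_setC.
have hA2 : P[A2] <= eps / 8 by exact: hN1.
have hA3 : P[A3] <= eps / 4.
  have es : 0 < eta / 2 * Num.sqrt n%:R by rewrite mulr_gt0//; lra.
  have := markov_ineq (@stay_sum_L1 m del del' (ltW del'0) del'd j) Q0 es.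
  rewrite -/A3 => hmk.
  have hE := Exp_stay_sum m5 (ltW del'0) del'd Kgd j.
  rewrite -nE -/Kz in hE.
  have hH := hN0 n.
  have hH2 : \sum_(k < n) k.+1%:R^-1 <= 2 * c * Num.sqrt n%:R by move: hH hS; move: (Num.sqrt n%:R) => q; lra.
  rewrite -(ler_pM2l es); apply: (le_trans hmk); apply: (le_trans hE).
  apply: (@le_trans _ _ (Kg * Kz * (2 * c * Num.sqrt n%:R))); first by rewrite ler_wpM2l.
  have -> : Kg * Kz * (2 * c * Num.sqrt n%:R) = (2 * (Kg * Kz) * c) * Num.sqrt n%:R by ring.
  have -> : eta / 2 * Num.sqrt n%:R * (eps / 4) = (eta / 2 * (eps / 4)) * Num.sqrt n%:R by ring.
  rewrite ler_wpM2r ?(ltW sn0)// /c mulrA ler_pdivrMr; last by lra.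
  have : 0 <= eps * eta by rewrite mulr_ge0// ltW.
  move: (Kg * Kz) KK0 => x x0 y0.
  have -> : 2 * x * (eps * eta) = (eps * eta) * (2 * x) by ring.
  have -> : eta / 2 * (eps / 4) * (16 * (x + 1)) = (eps * eta) * (2 * (x + 1)) by field.
  by rewrite ler_wpM2l//; lra.
apply: (le_trans (prob_union Pr mA1 (measurableU _ _ mA2 mA3))).
by have := prob_union Pr mA2 mA3; lra.
Qed.

Lemma psum2 n : L1 Pr (fun w => psum n w ^+ 2) /\ E[fun w => psum n w ^+ 2] <= n%:R * V.
Proof.
elim: n => [|n [ih1 ih2]].
  have -> : (fun w => psum 0 w ^+ 2) = cst 0.
    by apply/funext => w; rewrite /psum big_ord0 expr0n.
  by rewrite Exp_cst mul0r; split => //; exact: L1_cst.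
have ix : L1 Pr (fun w => psum n w * xi n.+1 w).
  apply: (L1_le _ (L1D ih1 (xi2_L1 n))); last by move=> w; exact: norm_mul_le_sqr.
  by apply: measurable_funM => //; exact: xi_measurable.
have eq w : psum n.+1 w ^+ 2 = psum n w ^+ 2 + 2 * (psum n w * xi n.+1 w) + xi n.+1 w ^+ 2.
  by rewrite psumS; ring.
have i1 : L1 Pr (fun w => psum n w ^+ 2 + 2 * (psum n w * xi n.+1 w)).
  by apply: L1D => //; exact: L1Zl.
split; first by under eq_fun do rewrite eq; apply: L1D.
under eq_Rintegral do rewrite eq.
rewrite ExpD// ExpD//; last exact: L1Zl.
rewrite ExpZl// Exp_xi//; last exact: Gmeas_psum.
rewrite mulr0 addr0 -natr1 mulrDl mul1r lerD//.
Qed.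

(** By [e_sum], [sqrt (n + 2) e n] is [a_ n] times [e 0 - rem n - psum n]; [b_ n] is the relative
    error of replacing [a_ n] by [1 / sqrt n]. *)
Let a_ n : R := Num.sqrt n.+2%:R / n.+1%:R.
Let b_ n : R := a_ n * Num.sqrt n%:R - 1.

Let a_small (eps : R) : 0 < eps -> exists N, forall n, (N <= n)%N -> `|a_ n| <= eps.
Proof.
move=> eps0; have e2 : 0 < eps / 2 by lra.
have [N hN] := inv_sqrt_small e2.
exists N => n nN; have := hN n.+1 (leqW nN).
have s0 : 0 < Num.sqrt n.+1%:R :> R by rewrite sqrtr_gt0.
rewrite ger0_norm ?invr_ge0 ?(ltW s0)// => h.
have -> : a_ n = (Num.sqrt n.+2%:R / Num.sqrt n.+1%:R) * (Num.sqrt n.+1%:R)^-1.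
  by rewrite /a_ -mulrA -invfM -expr2 sqr_sqrtr.
rewrite ger0_norm; last by rewrite !mulr_ge0 ?invr_ge0 ?sqrtr_ge0.
have h2 : Num.sqrt n.+2%:R / Num.sqrt n.+1%:R <= 2 :> R.
  rewrite ler_pdivrMr// -[2]ger0_norm// -sqrtr_sqr -sqrtrM ?sqr_ge0// ler_wsqrtr//.
  apply: (@le_trans _ _ (2 * n.+1%:R)).
    by rewrite -natrM ler_nat mul2n -addnn addSn ltnS leq_addl.
  by rewrite ler_wpM2r// expr2; lra.
have -> : eps = 2 * (eps / 2) by field.
by apply: ler_pM; rewrite ?divr_ge0 ?invr_ge0 ?(ltW s0).
Qed.

(** From [n (n + 2) = (n + 1)^2 - 1] one gets [a_ n sqrt n = sqrt (1 - (n + 1)^-2)], which lies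
    between [1 - 1 / (n + 1)] and 1. *)
Let b_small n : `|b_ n| <= n.+1%:R^-1 /\ `|a_ n * Num.sqrt n%:R| <= 1.
Proof.
have n1 : 0 < n.+1%:R :> R by [].
have e1 : a_ n * Num.sqrt n%:R = Num.sqrt (1 - n.+1%:R^-1 ^+ 2).
  have -> : 1 - n.+1%:R^-1 ^+ 2 = (n.+2%:R * n%:R) * n.+1%:R^-1 ^+ 2 :> R.
    rewrite -[n.+2%:R]natr1; have -> : n%:R = n.+1%:R - 1 :> R by rewrite -natr1 addrK.
    by field; rewrite gt_eqF.
  rewrite sqrtrM ?mulr_ge0// sqrtrM// sqrtr_sqr ger0_norm ?invr_ge0//.
  by rewrite /a_ mulrAC.
have x1 : n.+1%:R^-1 <= 1 :> R by rewrite invf_le1// ler1n.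
have x0 : 0 <= n.+1%:R^-1 :> R by rewrite invr_ge0.
have s1 : Num.sqrt (1 - n.+1%:R^-1 ^+ 2) <= 1 :> R.
  rewrite -[leRHS]sqrtr1 ler_wsqrtr// lerBlDr lerDl sqr_ge0//.
rewrite /b_ e1; split; last by rewrite ger0_norm ?sqrtr_ge0.
rewrite ler0_norm ?subr_le0// opprB.
have h : (1 - n.+1%:R^-1) <= Num.sqrt (1 - n.+1%:R^-1 ^+ 2) :> R.
  rewrite -[leLHS]ger0_norm ?subr_ge0// -sqrtr_sqr ler_wsqrtr//.
  by move: (n.+1%:R^-1 : R) x0 x1 => x *; nra.
by move: (n.+1%:R^-1 : R) h => x h; lra.
Qed.

Let Zn n w := Num.sqrt n.+2%:R * e n w.
Let Vn n w := - (psum n w / Num.sqrt n%:R).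

Let mZn n : measurable_fun setT (Zn n).
Proof. exact: measurable_funM. Qed.

Let mVn n : measurable_fun setT (Vn n).
Proof. by apply: measurableT_comp => //; exact: measurable_funM. Qed.

Let Zn_Vn n w : Zn n w - Vn n w = a_ n * e 0%N w +
  ((- (a_ n * Num.sqrt n%:R)) * ((Num.sqrt n%:R)^-1 * rem n w) +
   (- b_ n) * (psum n w / Num.sqrt n%:R)).
Proof.
have eZ : Zn n w = a_ n * (e 0%N w - rem n w - psum n w).
  by rewrite -e_sum /Zn /a_; field; rewrite ?natr1 ?nat1r pnatr_eq0.
rewrite eZ /Vn /b_.
(* At [n = 0] the inverse of [sqrt 0] is [0]; both sums are empty, so the identity persists. *)
case: n {eZ} => [|n]; first by rewrite /rem /psum !big_ord0 !mul0r !mulr0; ring.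
have s0 : Num.sqrt n.+1%:R != 0 :> R by rewrite gt_eqF// sqrtr_gt0.
by field.
Qed.

Lemma Zn_Vn_negligible : cvg0P Pr (fun n w => Zn n w - Vn n w).
Proof.
have -> : (fun n w => Zn n w - Vn n w) = (fun n w => a_ n * e 0%N w +
  ((- (a_ n * Num.sqrt n%:R)) * ((Num.sqrt n%:R)^-1 * rem n w) +
   (- b_ n) * (psum n w / Num.sqrt n%:R))).
  by apply/funext => n; apply/funext => w; exact: Zn_Vn.
have m1 n : measurable_fun setT (fun w => (Num.sqrt n%:R)^-1 * rem n w : R).
  exact: measurable_funM.
have m2 n : measurable_fun setT (fun w => psum n w / Num.sqrt n%:R : R).
  exact: measurable_funM.
have m3 n : measurable_fun setT (fun w => (- b_ n) * (psum n w / Num.sqrt n%:R)).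
  exact: measurable_funM.
have m4 n : measurable_fun setT (fun w => (- (a_ n * Num.sqrt n%:R)) * ((Num.sqrt n%:R)^-1 * rem n w)).
  exact: measurable_funM.
apply: cvg0PD.
- by move=> n; exact: measurable_funM.
- by move=> n; exact: measurable_funD.
- by apply: cvg0P_rv => //; exact: a_small.
apply: cvg0PD => //.
  apply: (@cvg0PM _ _ _ _ _ 1) => //; last exact: rem_negligible.
  by move=> n; rewrite normrN; have [] := b_small n.
have sq n w : ((- b_ n) * (psum n w / Num.sqrt n%:R)) ^+ 2 = (b_ n ^+ 2 / n%:R) * psum n w ^+ 2.
  by rewrite !exprMn sqrrN exprVn sqr_sqrtr// mulrA mulrAC.
apply: cvg0P_L2 => // [n|eps eps0].
  by under eq_fun do rewrite sq; apply: L1Zl; have [] := psum2 n.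
exists (Num.truncn (V / eps)) => n nN.
under eq_Rintegral do rewrite sq.
have [i1 i2] := psum2 n.
rewrite ExpZl//.
have x1 : n.+1%:R^-1 <= 1 :> R by rewrite invf_le1// ler1n.
have x0 : 0 <= n.+1%:R^-1 :> R by rewrite invr_ge0.
have b2 : b_ n ^+ 2 <= n.+1%:R^-1.
  have [h _] := b_small n; rewrite -real_normK ?num_real//.
  have h2 := normr_ge0 (b_ n).
  rewrite expr2; apply: le_trans (_ : `|b_ n| * 1 <= _); last by rewrite mulr1.
  by rewrite ler_wpM2l// (le_trans h).
apply: (@le_trans _ _ (b_ n ^+ 2 / n%:R * (n%:R * V))).
  by rewrite ler_wpM2l// divr_ge0// sqr_ge0.
have [->|n0] := posnP n; first by rewrite mul0r mulr0 ltW.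
rewrite mulrA divfK ?pnatr_eq0 ?lt0n_neq0//.
apply: (@le_trans _ _ (n.+1%:R^-1 * V)); first by rewrite ler_wpM2r.
rewrite mulrC ler_pdivrMr ?ltr0n// mulrC -ler_pdivrMr// ltW//.
by rewrite (lt_le_trans (truncnS_gt _))// ler_nat ltnS.
Qed.

(** [Vn] is minus the normalized noise sum, so [clt_cos] is applied at [- l]; the limit only sees
    [l^2]. *)
Theorem robbins_monro_cos (l c : R) :
  E[fun w => cos (l * (Num.sqrt n.+2%:R * e n w) + c)] @[n --> \oo] -->
  expR (- (l ^+ 2 * s2 / 2)) * cos c.
Proof.
have h1 := slutsky_cos l c mZn mVn Zn_Vn_negligible.
have h2 := @clt_cos (- l) c; rewrite sqrrN in h2.
rewrite -[X in _ --> X]add0r.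
rewrite (_ : (fun n => _) = (fun n =>
   (E[fun w => cos (l * Zn n w + c)] - E[fun w => cos (l * Vn n w + c)]) +
   E[fun w => cos (- l * (psum n w / Num.sqrt n%:R) + c)])); first exact: cvgD.
apply/funext => n; rewrite /Vn.
under [X in _ - X + _]eq_Rintegral do rewrite mulrN -mulNr.
by rewrite subrK.
Qed.

Theorem robbins_monro_tight (eps : R) : 0 < eps -> exists M : R,
  \forall n \near \oo, P[[set w | M < `|Num.sqrt n.+2%:R * e n w|]] <= eps.
Proof.
move=> eps0.
have eps2 : 0 < eps / 2 by lra.
have [N hN] := Zn_Vn_negligible ltr01 eps2.
pose K2 := 2 * (V + 1) / eps.
have K20 : 0 < K2 by rewrite /K2 divr_gt0// mulr_gt0// ltr_wpDl.
pose M1 := Num.sqrt K2.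
have M10 : 0 < M1 by rewrite sqrtr_gt0.
exists (M1 + 1); exists N => // n /= nN.
have mA : measurable [set w | 1 < `|Zn n w - Vn n w|] by apply: measurable_norm_gt; exact: measurable_funB.
have mB : measurable [set w | M1 < `|Vn n w|] by exact: measurable_norm_gt.
apply: (@le_trans _ _ (P[[set w | M1 < `|Vn n w|] `|` [set w | 1 < `|Zn n w - Vn n w|]])).
  apply: prob_le; [by apply: measurable_norm_gt; exact: mZn|exact: measurableU|].
  move=> w /= h; case: (ltP M1 `|Vn n w|) => h1; [by left|right].
  rewrite ltNge; apply/negP => h2.
  have := ler_normD (Zn n w - Vn n w) (Vn n w); rewrite subrK => h3.
  by move: h; rewrite -/(Zn n w); lra.
apply: (le_trans (prob_union Pr mB mA)).
have [i1 i2] := psum2 n.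
have sq w : Vn n w ^+ 2 = n%:R^-1 * psum n w ^+ 2.
  by rewrite /Vn sqrrN exprMn exprVn sqr_sqrtr// mulrC.
have iV : L1 Pr (fun w => Vn n w ^+ 2) by under eq_fun do rewrite sq; exact: L1Zl.
have := chebyshev_ineq (mVn n) iV M10.
under eq_Rintegral do rewrite sq.
rewrite ExpZl// sqr_sqrtr ?(ltW K20)// => hc.
have hc2 : n%:R^-1 * E[fun w => psum n w ^+ 2] <= V.
  have [->|n0] := posnP n; first by rewrite invr0 mul0r.
  by rewrite mulrC ler_pdivrMr ?ltr0n// mulrC.
have : P[[set w | M1 < `|Vn n w|]] <= eps / 2.
  rewrite -(ler_pM2l K20) (le_trans hc)// (le_trans hc2)//.
  have -> : K2 * (eps / 2) = V + 1 by rewrite /K2; field; rewrite gt_eqF.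
  lra.
have := hN n nN; lra.
Qed.

End markov_modulated_clt.

(** * Transfer of expectations along an identity of laws *)

Section equality_in_law.
Context d (T : measurableType d) (R : realType) (Pr : probability T R).
Context d' (T' : measurableType d') (P' : probability T' R).
Variables (B : set T) (Z : T -> R) (zeta : T' -> R) (c : R).
Hypothesis mB : measurable B.
Hypothesis mZ : measurable_fun setT Z.
Hypothesis mzeta : measurable_fun setT zeta.
Hypothesis c0 : 0 <= c.
Hypothesis law : forall C : set R, measurable C ->
  Pr (B `&` Z @^-1` C) = (c%:E * P' (zeta @^-1` C))%E.

(** The event [B] is encoded in a second coordinate [1_B]: it becomes the preimage of [R x {1}], and
    both sides are integrals over that set against image measures that agree there up to the factor
    [c]. *)
Let law_ge0 (phi : R -> R) : measurable_fun setT phi -> (forall x, 0 <= phi x) ->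
  (\int[Pr]_(w in B) (phi (Z w))%:E = c%:E * \int[P']_w (phi (zeta w))%:E)%E.
Proof.
move=> mphi phi0.
pose Z1 w := (Z w, \1_B w : R); pose zeta1 w := (zeta w, 1 : R).
have mZ1 : measurable_fun setT Z1 by apply: measurable_fun_pair => //; exact: measurable_indic.
have mzeta1 : measurable_fun setT zeta1 by exact: measurable_fun_pair.
pose D : set (R * R) := setT `*` [set 1].
have mD : measurable D by exact: measurableX.
pose f (z : R * R) := (phi z.1)%:E.
have mf : measurable_fun setT f.
  by apply/measurable_EFinP; apply: measurableT_comp => //; exact: measurable_fst.
have f0 z : (0 <= f z)%E by rewrite lee_fin.
have B1 : Z1 @^-1` D = B.
  apply/seteqP; split => w; rewrite /D /Z1 /= indicE.
    case: (boolP (w \in B)) => [|_ [_ /= /eqP]]; first by rewrite inE.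
    by rewrite eq_sym oner_eq0.
  by move=> Bw; rewrite mem_set.
have z1 : zeta1 @^-1` D = setT by apply/seteqP; split => w.
have e1 := ge0_integral_pushforward mZ1 Pr mD (measurable_funTS mf) (fun z _ => f0 z).
have e2 := ge0_integral_pushforward mzeta1 P' mD (measurable_funTS mf) (fun z _ => f0 z).
rewrite B1 in e1; rewrite z1 in e2.
rewrite /comp /f /= in e1 e2; rewrite -e1 -e2.
rewrite (_ : c = (NngNum c0)%:num)//.
have e3 := ge0_integral_mscale (pushforward P' zeta1 : {measure set _ -> \bar R}) mD (NngNum c0) (measurable_funTS mf).
rewrite -e3//.
apply: eq_measure_integral => A mA AD.
rewrite /mscale /= /pushforward.
pose A1 := (fun x : R => (x, 1 : R)) @^-1` A.
have mA1 : measurable A1.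
  by rewrite -[A1]setTI; apply: (measurable_fun_pair _ _) => //.
rewrite (_ : Z1 @^-1` A = B `&` Z @^-1` A1); last first.
  apply/seteqP; split => w; rewrite /A1 /Z1 /=.
    move=> h; have Bw : B w by rewrite -B1; exact: AD.
    by split => //; move: h; rewrite indicE mem_set.
  by move=> [Bw]; rewrite indicE mem_set.
by rewrite law.
Qed.

Lemma law_Exp (phi : R -> R) : measurable_fun setT phi ->
  L1 P' (fun w => phi (zeta w)) ->
  L1 Pr (fun w => \1_B w * phi (Z w)) /\
  Rintegral Pr setT (fun w => \1_B w * phi (Z w)) = c * Rintegral P' setT (fun w => phi (zeta w)).
Proof.
have ge0_case (psi : R -> R) : measurable_fun setT psi -> (forall x, 0 <= psi x) ->
    L1 P' (fun w => psi (zeta w)) ->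
    L1 Pr (fun w => \1_B w * psi (Z w)) /\
    Rintegral Pr setT (fun w => \1_B w * psi (Z w)) = c * Rintegral P' setT (fun w => psi (zeta w)).
  move=> mpsi psi0 ipsi; have h := law_ge0 mpsi psi0.
  rewrite (Exp_eq_EFin ipsi) -EFinM in h.
  have eB : (\int[Pr]_w (\1_B w * psi (Z w))%:E = \int[Pr]_(w in B) (psi (Z w))%:E)%E.
    rewrite [RHS]integral_mkcond; apply: eq_integral => w _.
    by rewrite patchE indicE; case: ifPn => _; rewrite ?mul1r ?mul0r.
  have mB1 : measurable_fun setT (fun w => \1_B w * psi (Z w)).
    by apply: measurable_funM; [exact: measurable_indic|exact: measurableT_comp].
  split.
    apply/integrableP; split; first exact/measurable_EFinP.
    under eq_integral do rewrite /= ger0_norm ?mulr_ge0//.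
    by rewrite eB h ltry.
  by rewrite /Rintegral eB h.
move=> mphi iphi.
pose p x := (`|phi x| + phi x) / 2; pose q x := (`|phi x| - phi x) / 2.
have mp : measurable_fun setT p.
  apply: measurable_funM => //; apply: measurable_funD => //.
  exact: (measurableT_comp (@normr_measurable R setT)).
have mq : measurable_fun setT q.
  apply: measurable_funM => //; apply: measurable_funB => //.
  exact: (measurableT_comp (@normr_measurable R setT)).
have p0 x : 0 <= p x.
  by rewrite /p divr_ge0// -[X in X + _]normrN -lerBlDr sub0r; have := ler_norm (- phi x); rewrite normrN.
have q0 x : 0 <= q x by rewrite /q divr_ge0// subr_ge0 ler_norm.
have pq x : phi x = p x - q x by rewrite /p /q; field.
have ip : L1 P' (fun w => p (zeta w)).
  have := L1Zl 2^-1 (L1D (L1_abs iphi) iphi).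
  by apply: eq_integrable => // w _ /=; rewrite /p mulrC.
have iq : L1 P' (fun w => q (zeta w)).
  have := L1Zl 2^-1 (L1B (L1_abs iphi) iphi).
  by apply: eq_integrable => // w _ /=; rewrite /q mulrC.
have [jp ep] := ge0_case _ mp p0 ip; have [jq eq] := ge0_case _ mq q0 iq.
have e : (fun w => \1_B w * phi (Z w)) = (fun w => \1_B w * p (Z w) - \1_B w * q (Z w)).
  by apply/funext => w; rewrite pq mulrBr.
split; first by rewrite e; exact: L1B.
rewrite e ExpB// ep eq -mulrBr -ExpB//.
by congr (_ * _); apply: eq_Rintegral => w _; rewrite -pq.
Qed.

End equality_in_law.

(** Dominated convergence along [h = 1 / (n + 1)], with [zeta^2] as dominating function;
    monotonicity of the integrand in [|h|] then covers all small [h]. *)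
Lemma lindeberg_single d (T : measurableType d) (R : realType) (P : probability T R)
    (zeta : T -> R) : measurable_fun setT zeta -> L1 P (fun w => zeta w ^+ 2) ->
  (forall h : R, L1 P (fun w => Num.min (`|h| * `|zeta w| ^+ 3) (zeta w ^+ 2))) /\
  forall eps : R, 0 < eps -> exists2 del : R, 0 < del & forall h : R, `|h| <= del ->
    Rintegral P setT (fun w => Num.min (`|h| * `|zeta w| ^+ 3) (zeta w ^+ 2)) <= eps.
Proof.
move=> mz iz.
have bd (h : R) w : `|Num.min (`|h| * `|zeta w| ^+ 3) (zeta w ^+ 2)| <= zeta w ^+ 2.
  rewrite ger0_norm ?ge_min ?lexx ?orbT// le_min sqr_ge0.
  by rewrite mulr_ge0// exprn_ge0.
have iL (h : R) := L1_min_cube h mz iz.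
split => // eps eps0.
have cv : (\int[P]_w (Num.min (`|harmonic n| * `|zeta w| ^+ 3) (zeta w ^+ 2))%:E)%E @[n --> \oo] -->
    (\int[P]_w (cst 0 w)%:E)%E.
  apply: (@dominated_cvg _ _ _ P setT measurableT _ _ (fun w => (zeta w ^+ 2)%:E)) => //=.
  - by move=> n; case/integrableP : (iL (harmonic n)).
  - move=> w _; apply: cvg_EFin; first exact: nearW.
    have h0 : `|harmonic n| * `|zeta w| ^+ 3 @[n --> \oo] --> (0 : R).
      rewrite -(mul0r (`|zeta w| ^+ 3)); apply: cvgM; last exact: cvg_cst.
      by rewrite -(normr0 R); apply: cvg_norm; exact: cvg_harmonic.
    apply: (squeeze_cvgr _ (cvg_cst 0) h0); near=> n.
    rewrite ge_min lexx/= andbT le_min sqr_ge0 andbT.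
    by rewrite mulr_ge0// exprn_ge0.
  - by move=> n w _; rewrite lee_fin.
rewrite /= integral0 in cv.
have /fine_cvgP[_ /cvgrPdist_le /(_ _ eps0)] := cv.
case=> n _ /(_ n (leqnn n)) /=; rewrite sub0r normrN => hn.
exists n.+1%:R^-1 => [|h hh]; first by rewrite invr_gt0.
apply: le_trans (le_trans (ler_norm _) hn).
apply: Exp_le; [exact: iL|exact: iL|move=> w].
have hh' : `|h| <= `|harmonic n| by rewrite /harmonic/= [leRHS]ger0_norm ?invr_ge0.
have h3 : `|h| * `|zeta w| ^+ 3 <= `|harmonic n| * `|zeta w| ^+ 3.
  by apply: ler_wpM2r => //; exact: exprn_ge0.
rewrite le_min; apply/andP; split; rewrite ge_min; apply/orP; [by left|by right].
Unshelve. all: by end_near.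
Qed.

(** * The central limit theorem from the conditional laws of noise and chain *)

Section robbins_monro_clt.
Context d (T : measurableType d) (R : realType) (Pr : probability T R).
Context d' (T' : measurableType d').
Variables (I : finType) (X : nat -> T -> I) (xi : nat -> T -> R).
Variable (G : nat -> set (set T)).
Hypothesis sG : forall n, sigma_algebra setT (G n).
Hypothesis GT : forall n A, G n A -> measurable A.
Hypothesis GS : forall n, G n `<=` G n.+1.
Hypothesis GX : forall n i, G n (X n @^-1` [set i]).
Hypothesis Gxi : forall n, Gmeas (G n) (xi n).
Variables (P' : I -> probability T' R) (zeta : I -> T' -> R) (Q : I -> I -> R) (p : I -> R).
Hypothesis mzeta : forall i, measurable_fun setT (zeta i).
Hypothesis zeta2 : forall i, L1 (P' i) (fun w => zeta i w ^+ 2).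
Hypothesis zeta_mean : forall i, Rintegral (P' i) setT (zeta i) = 0.
Hypothesis xi_law : forall n A i C, G n A -> measurable C ->
  Pr (A `&` X n @^-1` [set i] `&` xi n.+1 @^-1` C) =
  (Pr (A `&` X n @^-1` [set i]) * P' i (zeta i @^-1` C))%E.
Hypothesis X_law : forall n A i j, G n A ->
  fine (Pr (A `&` X n @^-1` [set i] `&` X n.+1 @^-1` [set j])) =
  fine (Pr (A `&` X n @^-1` [set i])) * Q i j.
Hypothesis p_ge0 : forall i, 0 <= p i.
Hypothesis p_sum : \sum_i p i = 1.
Hypothesis p_inv : forall j, \sum_i p i * Q i j = p j.
Hypothesis Q_irr : forall h : I -> R, (forall i, \sum_j Q i j * h j = h i) ->
  forall i j, h i = h j.
Local Notation "'E[' f ]" := (Rintegral Pr setT f).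

Let v i := Rintegral (P' i) setT (fun w => zeta i w ^+ 2).

Let mA n A i : G n A -> measurable (A `&` X n @^-1` [set i]).
Proof. by move=> gA; apply: measurableI; [exact: GT gA|exact: GT (GX n i)]. Qed.

Let mxi n : measurable_fun setT (xi n).
Proof. exact: (Gmeas_measurable (@GT n) (Gxi n)). Qed.

Let split_chain n A w : (\1_A w : R) = \sum_i \1_(A `&` X n @^-1` [set i]) w.
Proof.
rewrite (bigD1 (X n w))//= big1 ?addr0.
  rewrite indicI /= !indicE [X in _ * X](_ : _ = 1) ?mulr1//.
  by rewrite mem_set.
by move=> i iX; rewrite indicE memNset// => -[_ /= e]; rewrite e eqxx in iX.
Qed.

Let split_fun n A (m : I -> R) w :
  \1_A w * m (X n w) = \sum_i m i * (\1_(A `&` X n @^-1` [set i]) w : R).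
Proof.
rewrite (split_chain n) mulr_suml; apply: eq_bigr => i _.
rewrite !indicE; case: (boolP (w \in _)) => [|_]; last by rewrite mul0r mulr0.
by rewrite inE => -[_ /= ->]; rewrite mulrC.
Qed.

Let Exp_chain n A (m : I -> R) : G n A ->
  E[fun w => \1_A w * m (X n w)] = \sum_i m i * fine (Pr (A `&` X n @^-1` [set i])).
Proof.
move=> gA; under eq_Rintegral do rewrite (split_fun n).
rewrite Exp_sum; last by move=> i; apply: L1Zl; apply: L1_indic; exact: mA.
apply: eq_bigr => i _; rewrite ExpZl ?Exp_indic//; last by apply: L1_indic; exact: mA.
exact: mA.
Qed.

(** On each piece [X n = i] the noise has the law of [zeta i] under [P' i]; summing over the
    finitely many pieces gives the conditional expectation of [phi (xi n.+1)]. *)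
Lemma noise_Exp (phi : R -> R) n : measurable_fun setT phi ->
  (forall i, L1 (P' i) (fun w => phi (zeta i w))) ->
  L1 Pr (fun w => phi (xi n.+1 w)) /\
  forall A, G n A -> E[fun w => \1_A w * phi (xi n.+1 w)] =
    E[fun w => \1_A w * Rintegral (P' (X n w)) setT (fun w' => phi (zeta (X n w) w'))].
Proof.
move=> mphi iphi.
have H A i : G n A -> L1 Pr (fun w => \1_(A `&` X n @^-1` [set i]) w * phi (xi n.+1 w)) /\
    E[fun w => \1_(A `&` X n @^-1` [set i]) w * phi (xi n.+1 w)] =
    fine (Pr (A `&` X n @^-1` [set i])) * Rintegral (P' i) setT (fun w => phi (zeta i w)).
  move=> gA; apply: (law_Exp (mA i gA)) => //.
  - exact: fine_ge0.
  - by move=> C mC; rewrite xi_law// fineK// fin_num_measure//; exact: mA.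
have e A w : \1_A w * phi (xi n.+1 w) = \sum_i \1_(A `&` X n @^-1` [set i]) w * phi (xi n.+1 w).
  by rewrite (split_chain n A w) mulr_suml.
split.
  have := L1_sum (Pr := Pr) (enum I) xpredT (F := fun i w => \1_(setT `&` X n @^-1` [set i]) w * phi (xi n.+1 w)).
  move=> /(_ (fun i => (H setT i (GmeasT (sG n))).1)).
  apply: eq_integrable => // w _ /=; rewrite big_enum/= -mulr_suml -(split_chain n setT w).
  by rewrite indicT mul1r.
move=> A gA; under eq_Rintegral do rewrite e.
rewrite (Exp_sum _ _ (fun i => (H A i gA).1)).
rewrite (Exp_chain (fun i => Rintegral (P' i) setT (fun w' => phi (zeta i w'))) gA).
by apply: eq_bigr => i _; rewrite (H A i gA).2 mulrC.
Qed.

Let X_step (u : I -> R) n A : G n A ->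
  E[fun w => \1_A w * u (X n.+1 w)] = E[fun w => \1_A w * \sum_j Q (X n w) j * u j].
Proof.
move=> gA; rewrite (Exp_chain (fun i => \sum_j Q i j * u j) gA).
have mB i j : measurable (A `&` X n @^-1` [set i] `&` X n.+1 @^-1` [set j]).
  by apply: measurableI; [exact: mA|exact: GT (GX n.+1 j)].
have gA1 : G n.+1 A by exact: GS.
have e w : \1_A w * u (X n.+1 w) = \sum_j \sum_i
    u j * (\1_(A `&` X n @^-1` [set i] `&` X n.+1 @^-1` [set j]) w : R).
  rewrite (split_fun n.+1); apply: eq_bigr => j _; rewrite -mulr_sumr; congr (_ * _).
  rewrite (split_chain n (A `&` X n.+1 @^-1` [set j]) w); apply: eq_bigr => i _.
  by rewrite setIAC.
under eq_Rintegral do rewrite e.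
have iB i j : L1 Pr (fun w => u j * (\1_(A `&` X n @^-1` [set i] `&` X n.+1 @^-1` [set j]) w : R)).
  by apply: L1Zl; apply: L1_indic; exact: mB.
rewrite Exp_sum; last by move=> j; apply: L1_sum.
under eq_bigr do rewrite Exp_sum//.
rewrite exchange_big/=; apply: eq_bigr => i _.
rewrite mulr_suml; apply: eq_bigr => j _.
rewrite ExpZl; last by apply: L1_indic; exact: mB.
by rewrite Exp_indic// X_law//; ring.
Qed.

Let v_ge0 i : 0 <= v i. Proof. by apply: Exp_ge0 => w; exact: sqr_ge0. Qed.

Let msqr : measurable_fun setT (fun x : R => x ^+ 2).
Proof. exact: measurable_funX. Qed.

Let xi2_L1 n : L1 Pr (fun w => xi n.+1 w ^+ 2).
Proof. by have [] := noise_Exp n msqr zeta2. Qed.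

Let zeta_L1 i : L1 (P' i) (zeta i).
Proof. exact: L1_sqr. Qed.

Let xi_mean n A : G n A -> E[fun w => \1_A w * xi n.+1 w] = 0.
Proof.
move=> gA; have [_ h] := @noise_Exp id n (@measurable_id _ _ setT) zeta_L1.
rewrite (h A gA); under eq_Rintegral do rewrite zeta_mean mulr0.
by rewrite [LHS](Exp_cst Pr 0).
Qed.

Let xi_var n A : G n A ->
  E[fun w => \1_A w * xi n.+1 w ^+ 2] = E[fun w => \1_A w * v (X n w)].
Proof. by move=> gA; have [_ ->] := noise_Exp n msqr zeta2. Qed.

Let xi2_le n : E[fun w => xi n.+1 w ^+ 2] <= \sum_i v i.
Proof.
have := xi_var (GmeasT (sG n)).
under eq_Rintegral do rewrite indicT mul1r.
move=> ->; rewrite (Exp_chain v (GmeasT (sG n))).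
apply: ler_sum => i _; rewrite ler_piMr// prob_le1//; exact: mA (GmeasT (sG n)).
Qed.

(** Given the past, the noise follows one of finitely many laws, so a single [del] serves all
    [n]. *)
Let lindeberg (eps : R) : 0 < eps -> exists2 del : R, 0 < del &
  forall (h : R) n, `|h| <= del ->
  E[fun w => Num.min (`|h| * `|xi n.+1 w| ^+ 3) (xi n.+1 w ^+ 2)] <= eps.
Proof.
move=> eps0.
pose m (h : R) i := Rintegral (P' i) setT (fun w => Num.min (`|h| * `|zeta i w| ^+ 3) (zeta i w ^+ 2)).
have c0 : 0 < eps / (#|I|%:R + 1) by rewrite divr_gt0// ltr_wpDl.
have [del del0 hdel] : exists2 del : R, 0 < del & forall h i, i \in enum I -> `|h| <= del -> m h i <= eps / (#|I|%:R + 1).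
  elim: (enum I) => [|a s [d1 d10 h1]]; first by exists 1.
  have [d2 d20 h2] := (lindeberg_single (mzeta a) (zeta2 a)).2 _ c0.
  exists (Num.min d1 d2); first by rewrite lt_min d10 d20.
  move=> h i; rewrite inE le_min => /orP[/eqP ->|si] /andP[hd1 hd2]; first exact: h2.
  exact: h1.
exists del => // h n hd.
have mphi : measurable_fun setT (fun x : R => Num.min (`|h| * `|x| ^+ 3) (x ^+ 2)).
  by apply: measurable_minr => //; apply: measurable_funM => //; apply: measurable_funX.
have [_ H] := @noise_Exp (fun x => Num.min (`|h| * `|x| ^+ 3) (x ^+ 2)) n mphi
  (fun i => (lindeberg_single (mzeta i) (zeta2 i)).1 h).
have := H _ (GmeasT (sG n)); rewrite (Exp_chain (m h) (GmeasT (sG n))).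
under eq_Rintegral do rewrite indicT mul1r.
move=> ->; apply: (@le_trans _ _ (\sum_(i : I) eps / (#|I|%:R + 1))).
  apply: ler_sum => i _.
  have h0 : 0 <= m h i.
    by apply: Exp_ge0 => w; rewrite le_min sqr_ge0 mulr_ge0// exprn_ge0.
  apply: (@le_trans _ _ (m h i)); last by apply: hdel => //; rewrite mem_enum.
  by rewrite ler_piMr// prob_le1//; exact: mA (GmeasT (sG n)).
rewrite sumr_const -[_ *+ _]mulr_natr -mulrA ler_piMr ?(ltW eps0)//.
by rewrite mulrC ler_pdivrMr ?mul1r ?ltr_wpDl// lerDl.
Qed.

Variables (e : nat -> T -> R) (g : I -> R -> R).
Hypothesis Ge : forall n, Gmeas (G n) (e n).
Hypothesis mg : forall i, measurable_fun setT (g i).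
Hypothesis e_rec : forall n w,
  e n.+1 w = e n w - n.+2%:R^-1 * (g (X n w) (e n w) + xi n.+1 w).
Variables (Cg Kg : R).
Hypothesis Cg_ge0 : 0 <= Cg.
Hypothesis Kg_ge0 : 0 <= Kg.
Hypothesis g_lin : forall i x, `|g i x| <= Cg * (1 + `|x|).
Hypothesis g_sign : forall i x, 0 <= x * g i x.
Hypothesis g_away : forall del : R, 0 < del ->
  exists2 c : R, 0 < c & forall i (x : R), del <= `|x| -> c <= x * g i x.
Hypothesis g_quad : forall i x, `|g i x - x| <= Kg * x ^+ 2.

Theorem robbins_monro_clt (f : R -> R) : continuous f ->
  (exists M : R, forall x, `|f x| <= M) ->
  E[fun w => f (Num.sqrt n.+2%:R * e n w)] @[n --> \oo] -->
  Rintegral (normal_prob 0 1) setT (fun z : R => f (Num.sqrt (\sum_i p i * v i) * z)).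
Proof.
move=> cf bf.
set s2 := \sum_i p i * v i.
have s20 : 0 <= s2 by apply: sumr_ge0 => i _; rewrite mulr_ge0.
have [u poisson] := poisson_equation v p_sum p_inv Q_irr.
have [K K0 uK] := fin_bounded u.
have V0 : 0 <= \sum_i v i by apply: sumr_ge0.
have hcos := robbins_monro_cos sG GT GS GX Gxi xi2_L1 xi_mean xi_var X_step s20 V0 xi2_le poisson K0 uK lindeberg Ge mg e_rec Cg_ge0 Kg_ge0 g_lin g_sign g_away g_quad.
have htight := robbins_monro_tight sG GT GS GX Gxi xi2_L1 xi_mean V0 xi2_le Ge mg e_rec Cg_ge0 Kg_ge0 g_lin g_sign g_away g_quad.
have me n : measurable_fun setT (fun w => Num.sqrt n.+2%:R * e n w).
  by apply: measurable_funM => //; exact: (Gmeas_measurable (@GT n) (Ge n)).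
have := @cvg_of_cos _ T R Pr _ _ (normal_prob 0 1) (fun n w => Num.sqrt n.+2%:R * e n w)
  (fun z => Num.sqrt s2 * z) me _ _ _ f cf bf.
apply.
- by apply: continuous_measurable_fun; exact: mulrl_continuous.
- move=> l c.
  have -> : Rintegral (normal_prob 0 1) setT (fun z : R => cos (l * (Num.sqrt s2 * z) + c)) =
      expR (- (l ^+ 2 * s2 / 2)) * cos c.
    have := integral_normal_cos c (l * Num.sqrt s2).
    rewrite /Rintegral exprMn sqr_sqrtr// mulNr.
    rewrite (_ : (\int[_]_z _)%E = (\int[normal_prob 0 1]_z (cos (l * (Num.sqrt s2 * z) + c))%:E)%E).
      by move=> ->.
    by apply: eq_integral => z _; rewrite mulrA.
  exact: hcos.
- exact: htight.
Qed.

End robbins_monro_clt.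

(** Discreteness of a finite set of reals. This form makes the entry times attained; [seq_gap2]
    keeps the [tau_n] from accumulating. *)
Lemma seq_gap (R : realFieldType) (l : seq R) (x : R) :
  exists2 del : R, 0 < del & forall a, a \in l -> a != x -> del <= `|a - x|.
Proof.
elim: l => [|a l [del del0 hl]]; first by exists 1.
have [->|ax] := eqVneq a x.
  by exists del => // b; rewrite inE => /orP[/eqP ->|/hl//]; rewrite eqxx.
exists (Num.min del `|a - x|); first by rewrite lt_min del0 normr_gt0 subr_eq0.
move=> b; rewrite inE ge_min => /orP[/eqP ->|bl] bx; first by rewrite lexx orbT.
by rewrite hl.
Qed.

Lemma seq_gap2 (R : realFieldType) (l : seq R) :
  exists2 del : R, 0 < del & forall a b, a \in l -> b \in l -> a != b -> del <= `|a - b|.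
Proof.
suff [del del0 h] : exists2 del : R, 0 < del &
    forall b, b \in l -> forall a, a \in l -> a != b -> del <= `|a - b|.
  by exists del => // a b al bl; exact: h.
elim: {1}l => [|b s [del del0 hs]]; first by exists 1.
have [del' del'0 h'] := seq_gap l b.
exists (Num.min del del'); first by rewrite lt_min del0.
move=> c; rewrite inE => /orP[/eqP ->|cs] a al ac; rewrite ge_min.
  by rewrite (h' a al ac) orbT.
by rewrite (hs c cs a al ac).
Qed.

(** * Path space and the times tau_n *)

Section paths.
Context {R : realType} {s : state_space}.
Local Notation Omega := (@Omega R s).
Local Notation path_space := (@path_space R s).
Implicit Types (w : Omega) (A : set Omega).

Lemma path_continuous w : continuous (val w).
Proof. by case: w => f /= /asboolP[_ []]. Qed.

Lemma path_neg w (t : R) : t <= 0 -> val w t = val w 0.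
Proof.
rewrite le_eqVlt => /orP[/eqP ->//|]; case: w => f /= /asboolP[_ [h _]]; exact: h.
Qed.

Lemma path_Sset w (t : R) : Sset s (val w t).
Proof. by case: w => f /= /asboolP[]. Qed.

Lemma path_eq w w' : (forall t, 0 <= t -> val w t = val w' t) -> w = w'.
Proof.
move=> h; apply: val_inj; apply/funext => t.
by have [t0|/ltW t0] := leP 0 t; [exact: h|rewrite (path_neg w)// (path_neg w')// h].
Qed.

Lemma path_near w (r e : R) : 0 < e ->
  exists2 h : R, 0 < h & forall t, `|t - r| < h -> `|val w t - val w r| < e.
Proof.
move=> e0; have /cvgrPdist_lt /(_ e e0) := @path_continuous w r.
case=> h /= h0 hh; exists h => // t tr; rewrite distrC; apply: hh.
by rewrite /= distrC.
Qed.

Fact shift_subproof (r : R) w : `[< is_path s (fun t => val w (r + Num.max t 0)) >].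
Proof.
apply/asboolP; split; first by move=> t; exact: path_Sset.
split=> [t t0|].
  by rewrite max_r ?ltW// max_l.
move=> t; apply: (continuous_comp (f := fun t : R => r + Num.max t 0)); last exact: path_continuous.
apply: cvgD; first exact: cvg_cst.
by apply: (@continuous_max R R id (cst 0)); [exact: cvg_id|exact: cvg_cst].
Qed.
Definition path_shift (r : R) w : Omega := exist (fun f : R -> R => `[< is_path s f >]) _ (shift_subproof r w).

Fact stop_subproof (r : R) w : `[< is_path s (fun t => val w (Num.min t r)) >].
Proof.
apply/asboolP; split; first by move=> t; exact: path_Sset.
split=> [t t0|].
  have [r0|r0] := leP 0 r.
    by rewrite path_neg// ge_min ltW.
  rewrite (@path_neg w (Num.min t r)) ?ge_min ?(ltW t0)//.
  by rewrite (path_neg w (ltW r0)).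
move=> t; apply: (continuous_comp (f := fun t : R => Num.min t r)); last exact: path_continuous.
by apply: (@continuous_min R R id (cst r)); [exact: cvg_id|exact: cvg_cst].
Qed.
Definition path_stop (r : R) w : Omega := exist (fun f : R -> R => `[< is_path s f >]) _ (stop_subproof r w).

Lemma Xc_shift (r t : R) w : 0 <= t -> Xc t (path_shift r w) = val w (r + t).
Proof. by move=> t0; rewrite /Xc /= max_l. Qed.

(** [fine] sends infinite times to [0], which matches the fallback values of [Xat] and [shift_at];
    both are therefore evaluation and shift at a real time. *)
Lemma XatE (T : Omega -> \bar R) w : Xat T w = val w (fine (T w)).
Proof. by rewrite /Xat; case: (T w). Qed.

Lemma shift_atE (T : Omega -> \bar R) w : shift_at T w = path_shift (fine (T w)) w.
Proof.
have w0 : w = path_shift 0 w.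
  by apply: path_eq => t t0; rewrite /= add0r max_l.
rewrite /shift_at; case: (T w) => [r||] //=.
apply: val_inj; rewrite val_insubd.
by case: ifPn => // /negP[]; exact: shift_subproof.
Qed.

Lemma Fall_preimage (G : set (set Omega)) (phi : Omega -> Omega) :
  sigma_algebra setT G ->
  (forall (u : R) (B : set R), 0 <= u -> measurable B -> G (phi @^-1` (Xc u @^-1` B))) ->
  forall A, Fall A -> G (phi @^-1` A).
Proof.
move=> [G0 GC GU] h; apply: smallest_sub.
  split=> [|A gA|F gF]; first by rewrite /= preimage_set0.
    by rewrite /= setTD preimage_setC -setTD; exact: GC.
  by rewrite /= preimage_bigcup; exact: GU.
by move=> A [u [u0 [B [mB ->]]]]; exact: h.
Qed.

Lemma Ft_sigma_algebra (t : R) : sigma_algebra setT (@Ft R s t).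
Proof. exact: smallest_sigma_algebra. Qed.

Lemma Ft_le (t t' : R) : t <= t' -> @Ft R s t `<=` Ft t'.
Proof.
move=> tt'; apply: sub_smallest2r => //.
by move=> A [u [/andP[u0 ut] ?]]; exists u; split => //; rewrite /= u0 (le_trans ut).
Qed.

Lemma Ft_Ftplus (t : R) : @Ft R s t `<=` Ftplus t.
Proof. by move=> A h e e0; apply: (Ft_le _ h); rewrite lerDl ltW. Qed.

Lemma Ftplus_sigma_algebra (t : R) : sigma_algebra setT (@Ftplus R s t).
Proof.
split=> [e e0|A h e e0|F h e e0]; have [G0 GC GU] := Ft_sigma_algebra (t + e) => //.
- by apply: GC; exact: h.
- by apply: GU => n; exact: h.
Qed.

(* Galmarino's test *)
Lemma Ft_stop (t : R) A : 0 <= t -> Fall A -> (forall w, A w <-> A (path_stop t w)) -> Ft t A.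
Proof.
move=> t0 fA AE; rewrite (_ : A = path_stop t @^-1` A); last first.
  by apply/seteqP; split => w /=; rewrite -AE.
apply: Fall_preimage fA; first exact: Ft_sigma_algebra.
move=> u B u0 mB; apply: sub_sigma_algebra.
exists (Num.min u t); split; first by rewrite /= le_min u0 t0 ge_min lexx orbT.
by exists B.
Qed.

Lemma measurable_Xc (u : R) : measurable_fun setT (Xc u : path_space -> R).
Proof.
have h v : 0 <= v -> measurable_fun setT (Xc v : path_space -> R).
  move=> v0 _ B mB; rewrite setTI; apply: sub_sigma_algebra.
  by exists v; split => //; exists B.
have [|u0] := leP 0 u; first exact: h.
rewrite (_ : Xc u = Xc 0); first exact: h.
by apply/funext => w; rewrite /Xc path_neg// ltW.
Qed.

(** The time is rounded down to the grid of mesh [1 / (n + 1)], where evaluation is a countable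
    union of coordinate events; continuity of the path gives the limit. *)
Lemma measurable_eval (T : path_space -> R) : (forall w, 0 <= T w) ->
  measurable_fun setT T -> measurable_fun setT (fun w : path_space => val w (T w)).
Proof.
move=> T0 mT.
pose k n w := Num.trunc (n.+1%:R * T w).
pose Tn n w : R := (k n w)%:R / n.+1%:R.
have kP n w : (k n w)%:R <= n.+1%:R * T w < (k n w).+1%:R.
  by apply: Num.Theory.truncn_itv; rewrite mulr_ge0.
apply: (@measurable_fun_cvg _ _ _ _ (fun n (w : path_space) => val w (Tn n w))) => [n|w _].
  move=> _ B mB; rewrite setTI.
  rewrite (_ : _ @^-1` B = \bigcup_j ((fun w => n.+1%:R * T w) @^-1` [set x | j%:R <= x < j.+1%:R] `&`
       Xc (j%:R / n.+1%:R) @^-1` B)); last first.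
    apply/seteqP; split=> w /=; first by exists (k n w) => //; split => //=; exact: kP.
    move=> [j _ /= [hj]]; rewrite /Tn (_ : k n w = j)//.
    by apply: Num.Theory.truncn_def.
  apply: bigcupT_measurable => j; apply: measurableI.
    rewrite -[X in measurable X]setTI; apply: (measurable_funM (measurable_cst _) mT) => //.
    by rewrite (_ : [set _ | _] = `[j%:R, j.+1%:R[%classic)//; apply/seteqP; split=> x /=; rewrite in_itv.
  by rewrite -[X in measurable X]setTI; exact: measurable_Xc.
apply: (@continuous_cvg _ _ _ _ _ _ (val w)); first exact: path_continuous.
apply/cvgrPdist_le => e e0.
near=> n.
have /andP[k1 k2] := kP n w; rewrite /Tn.
have n0 : 0 < (n.+1%:R : R) by rewrite ltr0n.
have h1 : (k n w)%:R / n.+1%:R <= T w by rewrite ler_pdivrMr// mulrC.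
rewrite ger0_norm ?subr_ge0//.
have h2 : T w < (k n w)%:R / n.+1%:R + n.+1%:R^-1.
  by rewrite -[X in _ + X]mul1r -mulrDl natr1 ltr_pdivlMr// mulrC.
rewrite lerBlDl (le_trans (ltW h2))// lerD2l.
near: n; have [n _ hn] := near_infty_natSinv_lt (PosNum e0).
by exists n => // m nm; apply: ltW; exact: hn.
Unshelve. all: by end_near.
Qed.

Lemma measurable_shift (T : path_space -> R) : (forall w, 0 <= T w) ->
  measurable_fun setT T ->
  measurable_fun setT (fun w : path_space => path_shift (T w) w : path_space).
Proof.
move=> T0 mT _ A mA; rewrite setTI; move: A mA; apply: Fall_preimage => //.
  exact: smallest_sigma_algebra.
move=> u B u0 mB.
have := measurable_eval (T := fun w => T w + u) _ (measurable_funD mT (measurable_cst u)).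
move=> /(_ (fun w => addr_ge0 (T0 w) u0)) /(_ measurableT B mB); rewrite setTI.
by congr (measurable _); apply/seteqP; split => w /=; rewrite Xc_shift.
Qed.

(** By compactness and continuity, [a] is attained on [[S, T]] exactly when the path comes within
    each [1 / (n + 1)] of it at some time [C q], a rational clamped into the random interval. This
    leaves countable operations only. *)
Lemma measurable_hit (S T : path_space -> R) (a : R) : (forall w, 0 <= S w) ->
  measurable_fun setT S -> measurable_fun setT T ->
  measurable ([set w | exists t, S w <= t <= T w /\ val w t = a] : set path_space).
Proof.
move=> S0 mS mT.
pose C (q : rat) w := Num.max (S w) (Num.min (ratr q) (T w)).
have mC q : measurable_fun setT (fun w : path_space => val w (C q w)).
  apply: measurable_eval; first by move=> w; rewrite le_max S0.
  by apply: measurable_maxr => //; exact: measurable_minr.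
rewrite (_ : [set w | _] = [set w | S w <= T w] `&` \bigcap_(n : nat) \bigcup_(q : rat)
  [set w | `|val w (C q w) - a| <= n.+1%:R^-1]).
  apply: measurableI.
    by rewrite -[X in measurable X]setTI; exact: measurable_fun_le.
  apply: bigcapT_measurable => n; apply: bigcupT_measurable_rat => q.
  rewrite -[X in measurable X]setTI; apply: measurable_fun_le => //.
  apply: (measurableT_comp (@normr_measurable R setT)).
  exact: measurable_funB.
apply/seteqP; split => w /=.
  move=> [t [/andP[St tT] wt]]; split; first exact: le_trans tT.
  move=> n _; have e0 : 0 < (n.+1%:R^-1 : R) by rewrite invr_gt0.
  have [h h0 hh] := path_near w t e0.
  have bh : ball t h !=set0 by exists t; exact: ballxx.
  have [z [/= ht [q _ qE]]] := @dense_rat R (ball t h) bh (ball_open t h).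
  rewrite -qE /ball/= in ht.
  exists q => //=; rewrite -wt ltW//; apply: hh.
  move: ht; rewrite /C !ltr_norml => /andP[q1 q2].
  have [?|?] := leP (ratr q) (T w); [have [?|?] := leP (S w) (ratr q)|have [?|?] := leP (S w) (T w)];
    by apply/andP; split; lra.
move=> [ST hC].
have [c cI cmin] : exists2 c, c \in `[S w, T w] & forall t, t \in `[S w, T w] -> `|val w c - a| <= `|val w t - a|.
  apply: EVT_min => //; apply: continuous_subspaceT => t.
  apply: cvg_norm; apply: cvgB; [exact: path_continuous|exact: cvg_cst].
exists c; split; first by rewrite in_itv in cI.
apply/eqP; rewrite -subr_eq0 -normr_eq0; apply/eqP/le_anti/andP; split => //.
apply/ler_addgt0Pr => e e0; rewrite add0r.
have [n _ hn] := near_infty_natSinv_lt (PosNum e0).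
have [q _ /= hq] := hC n I.
have qI : C q w \in `[S w, T w].
  by rewrite in_itv/= le_max lexx/= ge_max ST ge_min lexx orbT.
exact: le_trans (cmin _ qI) (le_trans hq (ltW (hn n (leqnn n)))).
Qed.

Lemma measurable_efun (f : path_space -> \bar R) :
  (forall t : R, measurable [set w | (f w <= t%:E)%E]) -> measurable_fun setT f.
Proof.
move=> h; apply: (measurability _ (ErealGenOInfty.measurableE R)) => // _ [_ [x ->] <-].
rewrite setTI (_ : _ @^-1` _ = ~` [set w | (f w <= x%:E)%E]); first exact: measurableC.
by apply/seteqP; split => w /=; rewrite in_itv/= andbT ltNge => /negP.
Qed.

(** The common form of [tau1], with [T = 0] and [l = D], and of [tau_next], where [l] is [D] without
    the current point. *)
Definition entry (T : \bar R) (l : seq R) w : \bar R :=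
  ereal_inf [set t%:E | t in [set t | (T <= t%:E)%E /\ val w t \in l]].

Lemma entry_le T l w (t : R) : (T <= t%:E)%E -> val w t \in l -> (entry T l w <= t%:E)%E.
Proof. by move=> Tt wt; apply: ereal_inf_lbound; exists t. Qed.

Lemma entry_ge T l w : (T <= entry T l w)%E.
Proof. by apply/ereal_infP => _ [t [Tt _] <-]. Qed.

(** The infimum is attained: otherwise [val w r] is at positive distance from [l], and by continuity
    the path avoids [l] for a while after [r]. *)
Lemma entryP T l w (r : R) : entry T l w = r%:E -> (T <= r%:E)%E /\ val w r \in l.
Proof.
move=> e; have Tr : (T <= r%:E)%E by rewrite -e entry_ge.
split => //; apply: contraT => nr.
have [del del0 hl] := seq_gap l (val w r).
have [h h0 hh] := path_near w r del0.
have : (r%:E < (r + h)%:E)%E by rewrite lte_fin ltrDl.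
rewrite -{1}e => /ereal_inf_lt[_ [t [Tt wt] <-]]; rewrite lte_fin => th.
have rt : r <= t by rewrite -lee_fin -e; apply: entry_le.
have := hh t; rewrite ger0_norm ?subr_ge0// ltrBlDl => /(_ th).
rewrite ltNge hl//; apply: contraNneq nr => <- //.
Qed.

Lemma entry_leP T l w (t : R) : (0 <= T)%E -> (entry T l w <= t%:E)%E ->
  exists u : R, [/\ u <= t, (T <= u%:E)%E, val w u \in l & entry T l w = u%:E].
Proof.
move=> T0 et; have e0 := le_trans T0 (entry_ge T l w).
case e : (entry T l w) et e0 => [u||]//; rewrite lee_fin => ut _.
by have [? ?] := entryP e; exists u.
Qed.

Variable D : seq R.
(** The index is shifted: [tau n] stands here for the time [tau_(n+1)] of the theorem. *)
Local Notation tau := (tau_aux D).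

Lemma tau_aux0 w : tau 0 w = entry 0 D w.
Proof. by []. Qed.

Lemma tau_auxS n w :
  tau n.+1 w = entry (tau n w) [seq d <- D | d != Xat (tau n) w] w.
Proof.
rewrite /= /tau_next /entry; congr ereal_inf; apply/seteqP.
split => _ [t [h1 h2] <-]; exists t => //; split => //.
  by rewrite mem_filter h2.1 h2.2.
by move: h2; rewrite mem_filter => /andP[? ?].
Qed.

Lemma tau_ge0 n w : (0 <= tau n w)%E.
Proof.
elim: n => [|n IHn]; first exact: entry_ge.
by rewrite tau_auxS (le_trans IHn)// entry_ge.
Qed.

Lemma tau_le n w : (tau n w <= tau n.+1 w)%E.
Proof. by rewrite tau_auxS entry_ge. Qed.

Lemma tau_in n w (r : R) : tau n w = r%:E -> val w r \in D.
Proof.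
case: n => [|n]; first by rewrite tau_aux0 => /entryP[].
by rewrite tau_auxS => /entryP[_]; rewrite mem_filter => /andP[].
Qed.

Lemma tau_neq n w (r r' : R) : tau n w = r%:E -> tau n.+1 w = r'%:E ->
  val w r' != val w r.
Proof.
rewrite tau_auxS XatE => -> /entryP[_].
by rewrite mem_filter => /andP[].
Qed.

(** A time not exceeding [t] is determined by the path on [[0, t]], which is what the stopping
    argument requires. One inequality for entry times, used with the two paths exchanged, gives
    equality. *)
Lemma tau_local n (t : R) w w' : (forall u, 0 <= u <= t -> val w u = val w' u) ->
  (tau n w <= t%:E)%E -> tau n w' = tau n w.
Proof.
have main m v v' T l : (0 <= T)%E -> (forall u, 0 <= u <= t -> val v u = val v' u) ->
    (entry T l v <= m%:E)%E -> m <= t -> (entry T l v' <= entry T l v)%E.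
  move=> T0 E vm mt; have [u [um Tu vu ->]] := entry_leP T0 vm.
  apply: entry_le => //; rewrite -E// (le_trans um mt) andbT -lee_fin; exact: le_trans Tu.
have eqE T l v v' : (0 <= T)%E -> (forall u, 0 <= u <= t -> val v u = val v' u) ->
    (entry T l v <= t%:E)%E -> entry T l v' = entry T l v.
  move=> T0 E vt; have le1 := main t v v' T l T0 E vt (lexx t).
  apply/le_anti; rewrite le1 (main t)//; last exact: le_trans vt.
  by move=> u ut; rewrite E.
move=> E; elim: n => [|n IHn]; first by rewrite !tau_aux0; exact: eqE.
move=> h; have hn := le_trans (tau_le n w) h.
rewrite tau_auxS IHn// tau_auxS (_ : Xat (tau n) w' = Xat (tau n) w).
  by apply: eqE => //; [exact: tau_ge0|rewrite -tau_auxS].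
rewrite !XatE IHn// E//.
have := tau_ge0 n w; case: (tau n w) hn => [r||]//=.
by rewrite !lee_fin => -> ->.
Qed.

Lemma stop_eq (t : R) w u : 0 <= u <= t -> val w u = val (path_stop t w) u.
Proof. by move=> /andP[_ ut] /=; rewrite min_l. Qed.

(** Since entry times are attained, [tau n.+1 <= t] is a finite union over [a] in [D]: [a] differs
    from the current point and is hit between [tau n] and [t]. *)
Lemma measurable_tau n : measurable_fun setT (tau n : path_space -> \bar R).
Proof.
elim: n => [|n IHn]; apply: measurable_efun => t.
  rewrite (_ : [set w | _] = \bigcup_(a in [set` D])
      [set w | exists u, cst 0 w <= u <= cst t w /\ val w u = a]); last first.
    apply/seteqP; split => w /=.
      move=> /(entry_leP (lexx _))[u [ut u0 wu _]].
      by exists (val w u) => //=; exists u; rewrite ut andbT -lee_fin.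
    move=> [a /= aD [u [/andP[u0 ut] wu]]].
    apply: (@le_trans _ _ u%:E); last by rewrite lee_fin.
    by rewrite -[tau1 D w]/(tau 0 w) tau_aux0; apply: entry_le; rewrite ?lee_fin ?[val w u]wu.
  by apply: fin_bigcup_measurable; [exact: finite_seq|move=> a _; exact: measurable_hit].
have mT : measurable_fun setT (fun w : path_space => fine (tau n w)).
  exact: measurableT_comp (fine_measurable measurableT) IHn.
have T0 w : 0 <= fine (tau n w) by apply: fine_ge0; exact: tau_ge0.
have mX : measurable_fun setT (fun w : path_space => Xat (tau n) w).
  rewrite (_ : (fun w => _) = (fun w : path_space => val w (fine (tau n w)))).
    exact: measurable_eval.
  by apply/funext => w; rewrite XatE.
rewrite (_ : [set w | _] = \bigcup_(a in [set` D])
    ([set w | tau n w < +oo]%E `&` ([set w | Xat (tau n) w != a] `&`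
     [set w | exists u, fine (tau n w) <= u <= cst t w /\ val w u = a]))); last first.
  apply/seteqP; split => w; rewrite /mkset tau_auxS.
    move=> /(entry_leP (tau_ge0 n w))[u [ut nu]]; rewrite mem_filter => /andP[wX wD] _.
    have nfin : (tau n w < +oo)%E by rewrite (le_lt_trans nu)// ltry.
    exists (val w u) => //=; split => //; split; first by rewrite eq_sym.
    exists u; split => //; rewrite ut andbT -lee_fin fineK//.
    by rewrite ge0_fin_numE// tau_ge0.
  move=> [a /= aD [nfin [Xa [u [/andP[nu ut] wu]]]]].
  have h : (tau n w <= u%:E)%E.
    by rewrite -lee_fin fineK ?ge0_fin_numE ?tau_ge0// in nu.
  have {}wu : val w u = a := wu.
  apply: le_trans (entry_le h _) _; last by rewrite lee_fin.
  by rewrite wu mem_filter aD eq_sym Xa.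
apply: fin_bigcup_measurable; [exact: finite_seq|move=> a _]; apply: measurableI.
  by rewrite -[X in measurable X]setTI; apply: emeasurable_fun_infty_o.
apply: measurableI; last exact: measurable_hit.
rewrite (_ : [set w | _] = Xat (tau n) @^-1` (~` [set a])); last first.
  by apply/seteqP; split => w /=; move/eqP.
by rewrite -[X in measurable X]setTI; apply: mX => //; exact: measurableC.
Qed.

Lemma measurable_ftau n : measurable_fun setT (fun w : path_space => fine (tau n w)).
Proof. exact: measurableT_comp (fine_measurable measurableT) (measurable_tau n). Qed.

Lemma ftau_ge0 n w : 0 <= fine (tau n w).
Proof. by apply: fine_ge0; exact: tau_ge0. Qed.

Lemma measurable_Xtau n : measurable_fun setT (Xat (tau n) : path_space -> R).
Proof.
rewrite (_ : Xat _ = (fun w : path_space => val w (fine (tau n w)))).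
  exact: measurable_eval (ftau_ge0 n) (measurable_ftau n).
by apply/funext => w; rewrite XatE.
Qed.

Lemma measurable_shift_tau n :
  measurable_fun setT (shift_at (tau n) : path_space -> path_space).
Proof.
rewrite (_ : shift_at _ = (fun w : path_space => path_shift (fine (tau n w)) w)).
  exact: measurable_shift (ftau_ge0 n) (measurable_ftau n).
by apply/funext => w; rewrite shift_atE.
Qed.

(** Stopping the path at [t] changes neither [tau n] nor the position there once [tau n <= t]. The
    event thus lies in the raw [Ft t], hence in [Ftplus t]. *)
Lemma Ft_Xtau n (t : R) (B : set R) : 0 <= t -> measurable B ->
  @Ft R s t (Xat (tau n) @^-1` B `&` [set w | (tau n w <= t%:E)%E]).
Proof.
move=> t0 mB; apply: Ft_stop => //.
  apply: (@measurableI _ path_space).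
    by rewrite -[X in measurable X]setTI; exact: measurable_Xtau.
  rewrite -[X in measurable X]setTI.
  exact: (@emeasurable_fun_infty_c _ path_space _ _ _ measurableT (measurable_tau n)).
have E w w' : (forall u, 0 <= u <= t -> val w u = val w' u) ->
    (tau n w <= t%:E)%E -> Xat (tau n) w' = Xat (tau n) w.
  move=> e h; rewrite !XatE (tau_local e h) e//; move: (tau_ge0 n w) h.
  by case: (tau n w) => [r||]//=; rewrite !lee_fin => -> ->.
move=> w; split => -[/= wB wt].
  rewrite /= (tau_local (@stop_eq t w) wt); split => //.
  by rewrite (E _ _ (@stop_eq t w) wt).
have e u : 0 <= u <= t -> val (path_stop t w) u = val w u by move=> ut; rewrite -(stop_eq w ut).
by rewrite /= (tau_local e wt) (E _ _ e wt).
Qed.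

Lemma stopping_time_tau n : @stopping_time R s (tau n).
Proof.
split=> [w|t t0]; first exact: tau_ge0.
apply: Ft_Ftplus; have := Ft_Xtau n t0 measurableT.
by rewrite preimage_setT setTI.
Qed.

Lemma F_at_Xtau n (B : set R) : measurable B -> @F_at R s (tau n) (Xat (tau n) @^-1` B).
Proof.
move=> mB; split=> [|t t0]; last by apply: Ft_Ftplus; exact: Ft_Xtau.
rewrite -[X in Fall X]setTI.
exact: (measurable_Xtau n measurableT mB).
Qed.

Lemma F_at_le (S T : Omega -> \bar R) : stopping_time T -> (forall w, S w <= T w)%E ->
  F_at S `<=` F_at T.
Proof.
move=> [_ hT] ST A [fA hA]; split => // t t0.
rewrite (_ : _ `&` _ = (A `&` [set w | S w <= t%:E]%E) `&` [set w | T w <= t%:E]%E).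
  by apply: (@Gmeas_setI _ path_space _ (Ftplus_sigma_algebra t)); [exact: hA|exact: hT].
apply/seteqP; split => w /=; last by move=> [[]].
by move=> [Aw wt]; split => //; split => //; exact: le_trans (ST w) wt.
Qed.

Lemma F_at_sigma_algebra (T : Omega -> \bar R) : stopping_time T ->
  sigma_algebra setT (F_at T).
Proof.
move=> [_ hT]; split.
- split; first exact: (@measurable0 _ path_space).
  by move=> t t0; rewrite set0I; have [] := Ftplus_sigma_algebra t.
- move=> A [fA hA]; split; first by rewrite setTD; exact: (@measurableC _ path_space).
  move=> t t0; rewrite (_ : _ `&` _ = [set w | T w <= t%:E]%E `&`
      ~` (A `&` [set w | T w <= t%:E]%E)).
    apply: (@Gmeas_setI _ path_space _ (Ftplus_sigma_algebra t)); first exact: hT.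
    by apply: (@Gmeas_setC _ path_space _ (Ftplus_sigma_algebra t)); exact: hA.
  apply/seteqP; split => w /=; first by move=> [[_ nA] wt]; split => // -[].
  by move=> [wt nA]; split => //; split => // Aw; apply: nA.
- move=> F hF; split.
    by apply: (@bigcupT_measurable _ path_space) => n; exact: (hF n).1.
  move=> t t0; rewrite setI_bigcupl.
  have [_ _] := Ftplus_sigma_algebra t; apply => n; exact: (hF n).2.
Qed.
End paths.

(** * Almost sure statements and the paths of the embedded chain *)

Lemma ae_prob1 d (T : measurableType d) (R : realType) (P : probability T R) (A : set T) :
  measurable A -> P A = 1%E -> {ae P, forall w, A w}.
Proof.
move=> mA PA; exists (~` A); split; first exact: measurableC.
  by rewrite probability_setC// PA subee.
by [].
Qed.

Lemma aeS d (T : measurableType d) (R : realType) (P : probability T R) (A B : T -> Prop) :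
  (forall w, A w -> B w) -> {ae P, forall w, A w} -> {ae P, forall w, B w}.
Proof. exact: (@filterS _ _ (ae_filter_ringOfSetsType P)). Qed.

Lemma ae_and d (T : measurableType d) (R : realType) (P : probability T R) (A B : T -> Prop) :
  {ae P, forall w, A w} -> {ae P, forall w, B w} -> {ae P, forall w, A w /\ B w}.
Proof. exact: (@filterI _ _ (ae_filter_ringOfSetsType P)). Qed.

Lemma prob_eq_ae d (T : measurableType d) (R : realType) (P : probability T R) (A B : set T) :
  measurable A -> measurable B -> {ae P, forall w, A w <-> B w} -> P A = P B.
Proof.
move=> mA mB [N [mN N0 sN]].
have le U V : measurable U -> measurable V -> U `\` V `<=` N -> (P U <= P V)%E.
  move=> mU mV UVN.
  have -> : P V = P (V `|` N).
    by rewrite [RHS]measureU0.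
  apply: le_measure; rewrite ?inE//; first exact: measurableU.
  move=> w Uw; have [Vw|Vw] := pselect (V w); [by left|by right; exact: UVN].
by apply/le_anti; rewrite !le//= => w [Aw Bw]; apply: sN => /= -[AB BA]; auto.
Qed.

Section embedded_chain_paths.
Context {R : realType} {s : state_space} (D : seq R).
Local Notation Omega := (@Omega R s).
Local Notation path_space := (@path_space R s).
Local Notation tau := (tau_aux D).
Implicit Type w : Omega.

Definition hits (y : R) : set Omega := [set w | exists t, 0 <= t /\ Xc t w = y].

Lemma measurable_hits y : measurable (hits y : set path_space).
Proof.
rewrite (_ : hits y = \bigcup_(n : nat)
   [set w | exists t, cst 0 w <= t <= cst n%:R w /\ val w t = y]).
  by apply: bigcupT_measurable => n; exact: measurable_hit.
apply/seteqP; split => w.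
  move=> [t [t0 wt]]; exists (Num.trunc t).+1 => //=; exists t; split => //.
  by rewrite t0/= ltW//; have /andP[] := Num.Theory.truncn_itv t0.
by move=> [n _ [t [/andP[t0 _] wt]]]; exists t.
Qed.

Lemma entry_shift (r : R) (l : seq R) w : 0 <= r ->
  entry r%:E l w = (r%:E + entry 0 l (path_shift r w))%E.
Proof.
move=> r0; apply/le_anti/andP; split.
  case e : (entry 0 l (path_shift r w)) (entry_ge 0 l (path_shift r w)) => [u||]//; last first.
    by move=> _; rewrite addey// leey.
  rewrite lee_fin => u0; have [_ wu] := entryP e.
  rewrite -EFinD; apply: entry_le; first by rewrite lee_fin lerDl.
  by have := Xc_shift r w u0; rewrite /Xc => <-.
case e : (entry r%:E l w) (entry_ge r%:E l w) => [v||]//; last by move=> _; rewrite leey.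
rewrite lee_fin => rv; have [_ wv] := entryP e.
apply: (@le_trans _ _ (r%:E + (v - r)%:E)%E); last by rewrite -EFinD addrC subrK.
apply: leeD2l; apply: entry_le; first by rewrite lee_fin subr_ge0.
have vr : 0 <= v - r by rewrite subr_ge0.
by have := Xc_shift r w vr; rewrite /Xc => ->; rewrite addrC subrK.
Qed.

Lemma tau0_in w : val w 0 \in D -> tau 0 w = 0%E.
Proof.
move=> w0; apply/le_anti; rewrite tau_ge0 andbT tau_aux0.
exact: entry_le.
Qed.

(** The path shifted by [tau n] starts in [D], so its own [tau 0] vanishes and its [tau 1] is the
    waiting time until the next point. *)
Lemma tau_shift n (r : R) w : tau n w = r%:E ->
  tau n.+1 w = (r%:E + tau 1 (path_shift r w))%E.
Proof.
move=> e; have r0 : 0 <= r by have := tau_ge0 D n w; rewrite e.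
have wE : val (path_shift r w) 0 = val w r by have := Xc_shift r w (lexx 0); rewrite /Xc addr0.
have t0 : tau 0 (path_shift r w) = 0%E by rewrite tau0_in// wE (tau_in e).
have f0 : fine (0 : \bar R) = 0 by [].
have fr : fine r%:E = r by [].
by rewrite !tau_auxS !XatE t0 e f0 fr wE entry_shift.
Qed.

Lemma Xtau_shift n w : (tau n.+1 w < +oo)%E ->
  Xat (tau n.+1) w = Xat (tau 1) (shift_at (tau n) w).
Proof.
move=> fin1; have fin0 := le_lt_trans (tau_le D n w) fin1.
case e : (tau n w) fin0 (tau_ge0 D n w) => [r||]// _; rewrite lee_fin => r0.
rewrite shift_atE e !XatE; move: fin1; rewrite (tau_shift e).
case e1 : (tau 1 _) (tau_ge0 D 1 (path_shift r w)) => [u||]//; rewrite lee_fin => u0 _ /=.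
by rewrite max_l.
Qed.

Lemma Xtau_in n w : (tau n w < +oo)%E -> Xat (tau n) w \in D.
Proof.
rewrite XatE; case e : (tau n w) (tau_ge0 D n w) => [r||]// _ _.
exact: tau_in e.
Qed.

Lemma tau_lt_oo n w : (tau n w < +oo)%E -> forall d, d \in D ->
  d != Xat (tau n) w -> hits d (shift_at (tau n) w) -> (tau n.+1 w < +oo)%E.
Proof.
move=> fin0 d dD dX [t [t0 wt]].
case e : (tau n w) fin0 (tau_ge0 D n w) => [r||]// _; rewrite lee_fin => r0.
rewrite tau_auxS; apply: (@le_lt_trans _ _ (r + t)%:E); last exact: ltry.
apply: entry_le; first by rewrite e lee_fin lerDl.
by move: wt; rewrite shift_atE e Xc_shift// => ->; rewrite mem_filter dX.
Qed.

(* the times tau_n cannot accumulate, since consecutive values of a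
   continuous path at these times are a fixed distance apart *)
Lemma hits_Xtau d w : d \in D -> hits d w -> (forall n, (tau n w < +oo)%E) ->
  exists n, Xat (tau n) w = d.
Proof.
move=> dD [t [t0 wt]] fin; apply: contrapT => /forallNP hne.
have tau_t n : (tau n w <= t%:E)%E.
  elim: n => [|n IHn]; first by rewrite tau_aux0; apply: entry_le; rewrite ?lee_fin// [val w t]wt.
  rewrite tau_auxS; apply: entry_le => //; rewrite [val w t]wt mem_filter dD andbT.
  by apply/eqP => h; apply: (hne n).
pose r n := fine (tau n w).
have rE n : tau n w = (r n)%:E by rewrite fineK// ge0_fin_numE// tau_ge0.
have rcv : r @ \oo --> sup (range r).
  apply: nondecreasing_cvgn.
    by apply/nondecreasing_seqP => n; rewrite -lee_fin -!rE tau_le.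
  by exists t => _ [n _ <-]; rewrite -lee_fin -rE.
have wcv : val w (r n) @[n --> \oo] --> val w (sup (range r)).
  by apply: (@continuous_cvg _ _ _ _ _ _ (val w)) => //; exact: path_continuous.
have [del del0 hdel] := seq_gap2 D.
have del20 : 0 < del / 2 by rewrite divr_gt0.
have /cvgrPdist_lt /(_ _ del20) [n _ hn] := wcv.
have h1 := hn n (leqnn n); have h2 := hn n.+1 (leqnSn n).
have := hdel _ _ (tau_in (rE n.+1)) (tau_in (rE n)) (tau_neq (rE n) (rE n.+1)).
move: h1 h2 => /=; rewrite !ltr_norml ler_normr => /andP[a1 a2] /andP[b1 b2] /orP[]; lra.
Qed.

End embedded_chain_paths.

(** * The embedded chain *)

Section embedded_chain_law.
Context {R : realType} {s : state_space}.
Local Notation path_space := (@path_space R s).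
Variables (P : R -> R -> probability path_space R) (th : R) (D : seq R).
Hypothesis HP : recurrent_strong_markov_family P.
Hypothesis Duniq : uniq D.
Hypothesis Dsize : (2 <= size D)%N.
Hypothesis DS : forall d, d \in D -> Sset s d.
Local Notation tau := (tau_aux D).

Lemma ae_start x : Sset s x -> {ae P th x, forall w, val w 0 = x}.
Proof.
move=> xS; case: HP => h _; apply: ae_prob1 (h th x xS).
by rewrite -[X in measurable X]setTI; exact: (measurable_Xc 0 measurableT (measurable_set1 x)).
Qed.

Lemma ae_hits x y : Sset s x -> Sset s y -> {ae P th x, forall w, hits y w}.
Proof.
move=> xS yS; case: HP => _ [_ [_ h]]; apply: ae_prob1 (h th x y xS yS).
exact: measurable_hits.
Qed.

Lemma measurable_tau_lt_oo n : measurable ([set w | (tau n w < +oo)%E] : set path_space).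
Proof.
rewrite -[X in measurable X]setTI; apply: emeasurable_fun_infty_o => //.
exact: measurable_tau.
Qed.

(** By recurrence every state leads to [y] with probability 1, so the integrand in the strong Markov
    property is constantly 1. *)
Lemma strong_markov_hits x y n : Sset s x -> Sset s y ->
  P th x [set w | (tau n w < +oo)%E] = 1%E ->
  {ae P th x, forall w, hits y (shift_at (tau n) w)}.
Proof.
move=> xS yS fin; have [_ [_ [SM h]]] := HP.
have mh : measurable (shift_at (tau n) @^-1` hits y : set path_space).
  by rewrite -[X in measurable X]setTI; exact: (measurable_shift_tau D n measurableT (measurable_hits y)).
have := SM th x xS _ (stopping_time_tau D n) _ (measurable_hits y) setT
  (@GmeasT _ path_space _ (F_at_sigma_algebra (stopping_time_tau D n))).
rewrite setTI (eq_integral (cst 1%E)); last first.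
  by move=> w _ /=; rewrite h// XatE; exact: path_Sset.
rewrite integral_cst ?mul1e ?fin; last exact: measurable_tau_lt_oo.
move=> e; have := ae_prob1 (measurableI _ _ (measurable_tau_lt_oo n) mh) (etrans e fin).
by apply: aeS => w [].
Qed.

(** Of two distinct points of [D], at least one is not the current point, and both are visited after
    [tau n] almost surely. *)
Lemma ae_tau_fin x n : Sset s x -> {ae P th x, forall w, (tau n w < +oo)%E}.
Proof.
move=> xS.
have d0D : D`_0 \in D by apply: mem_nth; exact: leq_trans Dsize.
have d1D : D`_1 \in D by exact: mem_nth.
have d01 : D`_0 != D`_1 by rewrite nth_uniq//; exact: leq_trans Dsize.
elim: n => [|n IHn].
  apply: aeS (ae_hits xS (DS d0D)) => w [t [t0 wt]].
  rewrite tau_aux0; apply: (@le_lt_trans _ _ t%:E); last exact: ltry.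
  by apply: entry_le; rewrite ?lee_fin// [val w t]wt.
have P1 : P th x [set w | (tau n w < +oo)%E] = 1%E.
  rewrite -(probability_setT (P th x)).
  apply: prob_eq_ae => //; first exact: measurable_tau_lt_oo.
  by apply: aeS IHn => w.
have h0 := strong_markov_hits xS (DS d0D) P1.
have h1 := strong_markov_hits xS (DS d1D) P1.
apply: aeS (ae_and IHn (ae_and h0 h1)) => w [fin [H0 H1]].
have [e|ne] := eqVneq D`_0 (Xat (tau n) w).
  by apply: (tau_lt_oo fin d1D) => //; rewrite -e eq_sym.
exact: (tau_lt_oo fin d0D).
Qed.

(** On [X_tau = d] the integrand of the strong Markov property is the constant [P th d C]; almost
    sure finiteness of [tau n] removes the restriction to finite times. *)
Lemma strong_markov_tau x n d (A C : set path_space) : Sset s x -> F_at (tau n) A ->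
  measurable C ->
  P th x (A `&` Xat (tau n) @^-1` [set d] `&` shift_at (tau n) @^-1` C) =
  (P th x (A `&` Xat (tau n) @^-1` [set d]) * P th d C)%E.
Proof.
move=> xS fA mC; have [_ [_ [SM _]]] := HP.
have sF := F_at_sigma_algebra (@stopping_time_tau R s D n).
set B := A `&` _.
have fB : F_at (tau n) B by apply: (@Gmeas_setI _ path_space _ sF) => //; exact: F_at_Xtau.
have mB : measurable (B : set path_space) by case: fB.
have mS : measurable (shift_at (tau n) @^-1` C : set path_space).
  by rewrite -[X in measurable X]setTI; exact: (measurable_shift_tau D n measurableT mC).
have mT := measurable_tau_lt_oo n.
have := SM th x xS _ (stopping_time_tau D n) _ mC B fB.
rewrite (eq_integral (cst (P th d C))); last first.
  by move=> w; rewrite inE => -[[_ /= <-]].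
rewrite integral_cst; last exact: measurableI.
have PB : P th x (B `&` [set w | (tau n w < +oo)%E]) = P th x B.
  apply: prob_eq_ae => //; first exact: measurableI.
  by apply: aeS (ae_tau_fin n xS) => w h; split => [[]//|Bw]; split.
rewrite [X in _ = (_ * X)%E]PB muleC => <-; apply: prob_eq_ae; first exact: measurableI.
  by apply: measurableI => //; exact: measurableI.
apply: aeS (ae_tau_fin n xS) => w h; split; first by move=> [Bw Sw]; split.
by move=> [[]].
Qed.

Lemma Xtau_law x n d d' (A : set path_space) : Sset s x -> F_at (tau n) A ->
  P th x (A `&` Xat (tau n) @^-1` [set d] `&` Xat (tau n.+1) @^-1` [set d']) =
  (P th x (A `&` Xat (tau n) @^-1` [set d]) * P th d (Xat (tau 1) @^-1` [set d']))%E.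
Proof.
move=> xS fA.
have mX m (e : R) : measurable (Xat (tau m) @^-1` [set e] : set path_space).
  by rewrite -[X in measurable X]setTI; exact: (measurable_Xtau D m measurableT (measurable_set1 e)).
have mB : measurable (A `&` Xat (tau n) @^-1` [set d] : set path_space).
  by apply: measurableI => //; case: fA.
rewrite -strong_markov_tau//; apply: prob_eq_ae; first exact: measurableI.
  apply: measurableI => //; rewrite -[X in measurable X]setTI.
  exact: (measurable_shift_tau D n measurableT (mX 1%N d')).
apply: aeS (ae_tau_fin n.+1 xS) => w h.
have E : Xat (tau n.+1) w = Xat (tau 1) (shift_at (tau n) w) := Xtau_shift h.
by split=> -[? Xd']; split => //; rewrite /preimage /mkset -?E// E.
Qed.

Local Notation I := (seq_sub D).
Let Q (i j : I) := fine (P th (ssval i) (Xat (tau 1) @^-1` [set ssval j])).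

Lemma measurable_Xtau1 n (y : R) : measurable (Xat (tau n) @^-1` [set y] : set path_space).
Proof.
by rewrite -[X in measurable X]setTI; exact: (measurable_Xtau D n measurableT (measurable_set1 y)).
Qed.

Lemma Xtau_row_sum (i : I) : \sum_j Q i j = 1.
Proof.
have iS := DS (ssvalP i).
have iA (j : I) : L1 (P th (ssval i)) (\1_(Xat (tau 1) @^-1` [set ssval j])).
  by apply: L1_indic; exact: measurable_Xtau1.
transitivity (Rintegral (P th (ssval i)) setT
    (fun w => \sum_(j : I) \1_(Xat (tau 1) @^-1` [set ssval j]) w)).
  rewrite Exp_sum//; apply: eq_bigr => j _; rewrite Exp_indic//.
  exact: measurable_Xtau1.
rewrite -[RHS](Exp_cst (P th (ssval i)) 1) /Rintegral; congr fine.
apply: ae_eq_integral => //=.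
- have L : L1 (P th (ssval i)) (fun w => \sum_(j : I) \1_(Xat (tau 1) @^-1` [set ssval j]) w).
    exact: L1_sum.
  exact: measurable_int L.
- apply: aeS (ae_tau_fin 1 iS) => w h _; congr EFin.
  rewrite (bigD1 (SeqSub (Xtau_in h)))//= big1 ?addr0; first by rewrite indicE mem_set.
  move=> j /eqP ji; rewrite indicE memNset// => -/= e; apply: ji.
  by apply: val_inj => /=; rewrite e.
Qed.

(* Liouville property of the embedded chain: by the maximum principle the
   chain cannot leave the set where a harmonic function is maximal, but by
   recurrence the path started there visits every point of D *)
Lemma Xtau_harmonic (h : I -> R) : (forall i, \sum_j Q i j * h j = h i) ->
  forall i j, h i = h j.
Proof.
move=> hQ.
suff main k : (forall i, h i <= h k) -> forall j, h j = h k.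
  move=> i j; have [k _ hk] := @arg_maxP _ R I i xpredT h isT.
  have hk' l : h l <= h k by exact: hk.
  by rewrite (main k hk' i) (main k hk' j).
move=> hk.
have Q0 i j : h i = h k -> h j != h k -> Q i j = 0.
  move=> hi hj.
  have Q_ge0 l : 0 <= Q i l by exact: fine_ge0.
  have : \sum_l Q i l * (h k - h l) = 0.
    under eq_bigr do rewrite mulrBr.
    by rewrite sumrB -mulr_suml Xtau_row_sum mul1r hQ hi subrr.
  move=> /eqP; rewrite psumr_eq0; last by move=> l _; rewrite mulr_ge0// subr_ge0.
  move=> /allP /(_ j (mem_index_enum _)) /=; rewrite mulf_eq0 subr_eq0 => /orP[/eqP//|].
  by rewrite eq_sym (negPf hj).
have kS := DS (ssvalP k).
have stay n : {ae P th (ssval k), forall w, forall j : I, Xat (tau n) w = ssval j -> h j = h k}.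
  elim: n => [|n IHn].
    apply: aeS (ae_start kS) => w w0 j.
    rewrite XatE tau0_in; last by rewrite w0 ssvalP.
    rewrite [fine _]/(0 : R) w0 => kj; congr h.
    by apply: val_inj.
  have h1 (i j : I) : h j != h k -> {ae P th (ssval k), forall w,
      ~ (Xat (tau n) w = ssval i /\ Xat (tau n.+1) w = ssval j)}.
    move=> hj; have [hi|hi] := eqVneq (h i) (h k); last first.
      by apply: aeS IHn => w hw [/hw /eqP]; rewrite (negPf hi).
    exists (Xat (tau n) @^-1` [set ssval i] `&` Xat (tau n.+1) @^-1` [set ssval j]); split.
    - by apply: measurableI; exact: measurable_Xtau1.
    - have := Xtau_law (ssval i) (ssval j) kS
        (@GmeasT _ path_space _ (F_at_sigma_algebra (stopping_time_tau D n))).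
      rewrite setTI => ->.
      have /eqP := Q0 _ _ hi hj; rewrite /Q fine_eq0 ?fin_num_measure//; last exact: measurable_Xtau1.
      by move=> /eqP ->; rewrite mule0.
    - by move=> w /= /contrapT [].
  have h2 : {ae P th (ssval k), forall w, forall j i : I, h j != h k ->
      ~ (Xat (tau n) w = ssval i /\ Xat (tau n.+1) w = ssval j)}.
    apply: (@filter_forall _ _ _ _ (ae_filter_ringOfSetsType (P th (ssval k)))) => j.
    apply: (@filter_forall _ _ _ _ (ae_filter_ringOfSetsType (P th (ssval k)))) => i.
    have [hj|hj] := eqVneq (h j) (h k); first by apply: aeS (ae_start kS).
    by apply: aeS (h1 i j hj) => w ? _.
  apply: aeS (ae_and h2 (ae_tau_fin n kS)) => w [hw fin] j Xj.
  apply/eqP/contraT => hj; exfalso.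
  by apply: (hw j (SeqSub (Xtau_in fin)) hj).
move=> j; apply/eqP/contraT => hj; exfalso.
have all_fin : {ae P th (ssval k), forall w, forall n, (tau n w < +oo)%E}.
  by apply/ae_foralln => n; exact: ae_tau_fin.
have all_stay : {ae P th (ssval k), forall w, forall n, forall j : I, Xat (tau n) w = ssval j -> h j = h k}.
  by apply/ae_foralln.
have : {ae P th (ssval k), forall w, False}.
  apply: aeS (ae_and all_fin (ae_and all_stay (ae_hits kS (DS (ssvalP j))))).
  move=> w [fin [st hit]].
  have [n Xn] := hits_Xtau (ssvalP j) hit fin.
  by move: hj; rewrite (st n j Xn) eqxx.
move=> [N [mN N0 sN]]; have NT : N = setT by apply/seteqP; split => // w _; apply: sN; exact.
by move: N0; rewrite NT probability_setT => /eqP; rewrite onee_eq0.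
Qed.

End embedded_chain_law.

(** * The normalized response functions *)

Lemma derivable_lipschitz (R : realType) (f : R -> R) (a : R) : derivable f a 1 ->
  exists2 C : R, 0 < C & exists2 del : R, 0 < del &
    forall x, `|x| <= del -> `|f (a + x) - f a| <= C * `|x|.
Proof.
move=> /cvg_ex[l /cvgrPdist_lt /(_ 1 ltr01)] /=.
move=> [del /= del0 h]; exists (`|l| + 1); first by rewrite ltr_wpDl.
exists (del / 2); first by rewrite divr_gt0.
move=> x xd; have [->|x0] := eqVneq x 0; first by rewrite addr0 subrr normr0 mulr0.
have := h x; rewrite /= sub0r normrN => /(_ _ x0).
have xd' : `|x| < del by apply: le_lt_trans xd _; lra.
move=> /(_ xd'); rewrite /GRing.scale /= mulr1 addrC [x + a]addrC => hl.
have : `|x^-1 * (f (a + x) - f a)| <= `|l| + 1.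
  rewrite -[x^-1 * _](subrK l) (le_trans (ler_normD _ _))// addrC lerD2l ltW//.
  by rewrite distrC [l - _]addrC.
by rewrite normrM normfV mulrC ler_pdivrMr ?normr_gt0.
Qed.

(** Near 0 the quadratic error comes from the Lipschitz bound of the derivative at [th]; away from 0
    linear growth is already quadratic, because [1 <= |x| / del]. Division by the derivative makes
    both monotone cases increasing. *)
Lemma normalized_response (R : realType) (F : R -> R) (th L L' : R) :
  strictly_monotone F -> C2 F -> derive1 F th != 0 -> 0 <= L -> 0 <= L' ->
  (forall t, `|F t - F th| <= L * `|t - th| + L') ->
  let G x := (F (th + x) - F th) / derive1 F th in
  {homo G : x y / x < y} /\ exists2 K : R, 0 <= K & forall x, `|G x - x| <= K * x ^+ 2.
Proof.
move=> Fmono [dF [ddF _]] a0 L0 L'0 Flin G.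
set a := derive1 F th in a0 G *.
have [C C0 [del del0 hC]] := derivable_lipschitz (ddF th).
have taylor x : `|x| <= del -> `|F (th + x) - F th - a * x| <= C * x ^+ 2.
  move=> xd; pose H y := F y - a * y.
  have -> : F (th + x) - F th - a * x = H (th + x) - H th by rewrite /H; ring.
  have := @MVT_bound R H (fun y => derive1 F y - a) th (th + x) (C * `|x|).
  rewrite (addrC th x) addrK addrC => MVT; rewrite -real_normK ?num_real// expr2 mulrA.
  apply: MVT => y yx.
    have -> : derive1 F y - a = derive1 F y - a * 1 by rewrite mulr1.
    by apply: is_deriveB; rewrite derive1E; exact/derivableP.
  have := hC (y - th); rewrite (le_trans yx xd) (addrC th) subrK => /(_ isT) h.
  by apply: le_trans h _; rewrite ler_pM2l.
(* For small [x] the linear term beats the quadratic error, so the increment has the sign of [a];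
   this ties the sign of [a] to the direction of monotonicity. *)
have sgn x : 0 < x -> x <= del -> C * x < `|a| -> 0 < (F (th + x) - F th) * a.
  move=> x0 xd xa; have := taylor x; rewrite gtr0_norm// => /(_ xd).
  set D := F (th + x) - F th => h.
  have : D * a - a ^+ 2 * x = (D - a * x) * a by ring.
  move=> /eqP; rewrite subr_eq => /eqP ->.
  have h2 : `|(D - a * x) * a| < a ^+ 2 * x.
    rewrite normrM -[a ^+ 2]real_normK ?num_real//.
    apply: (@le_lt_trans _ _ (C * x ^+ 2 * `|a|)); first by rewrite ler_wpM2r.
    rewrite (_ : C * x ^+ 2 * `|a| = C * x * (`|a| * x)); last by ring.
    rewrite (_ : `|a| ^+ 2 * x = `|a| * (`|a| * x)); last by ring.
    by rewrite ltr_pM2r// mulr_gt0// normr_gt0.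
  by move: h2; rewrite ltr_norml => /andP[h2 _]; rewrite -ltrBlDr sub0r.
have a_gt0 : 0 < `|a| by rewrite normr_gt0.
pose x0 := Num.min del (`|a| / (2 * C)).
have x00 : 0 < x0 by rewrite lt_min del0 divr_gt0// mulr_gt0.
have sg : 0 < (F (th + x0) - F th) * a.
  apply: sgn => //; first by rewrite ge_min lexx.
  apply: (@le_lt_trans _ _ (C * (`|a| / (2 * C)))).
    by rewrite ler_pM2l// ge_min lexx orbT.
  rewrite (_ : C * _ = `|a| / 2); last by field; rewrite gt_eqF.
  lra.
have Gm : {homo G : x y / x < y}.
  move=> x y xy; rewrite /G.
  have xy' : th + x < th + y by rewrite ltrD2l.
  have thx : th < th + x0 by rewrite ltrDl.
  case: Fmono => mono.
    have Fp := mono _ _ thx; have Fxy := mono _ _ xy'.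
    have ap : 0 < a by rewrite -(pmulr_rgt0 _ (_ : 0 < F (th + x0) - F th))// subr_gt0.
    by rewrite ltr_pM2r ?invr_gt0// ltrD2r.
  have Fp := mono _ _ thx; have Fxy := mono _ _ xy'.
  have an : a < 0 by rewrite -(nmulr_rgt0 _ (_ : F (th + x0) - F th < 0))// subr_lt0.
  by rewrite ltr_nM2r ?invr_lt0// ltrD2r.
split => //.
(* [K1] serves [|x| <= del] and [K2] serves the rest, each term of the linear bound being multiplied
   by a power of [|x| / del >= 1]. *)
pose K1 := C / `|a|; pose K2 := (L / `|a| + 1) / del + L' / `|a| / del ^+ 2.
have K10 : 0 <= K1 by rewrite divr_ge0// ltW.
have K20 : 0 <= K2.
  by rewrite addr_ge0// divr_ge0 ?exprn_ge0 ?(ltW del0)// ?addr_ge0// divr_ge0.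
exists (K1 + K2); first exact: addr_ge0.
move=> x; rewrite mulrDl.
have [xd|xd] := leP `|x| del.
  apply: (@le_trans _ _ (K1 * x ^+ 2)); last by rewrite lerDl mulr_ge0// sqr_ge0.
  rewrite (_ : G x - x = (F (th + x) - F th - a * x) / a); last by rewrite /G; field.
  rewrite normrM normfV /K1 mulrAC ler_wpM2r ?invr_ge0//; exact: taylor.
apply: (@le_trans _ _ (K2 * x ^+ 2)); last by rewrite lerDr mulr_ge0// sqr_ge0.
have hG : `|G x| <= L / `|a| * `|x| + L' / `|a|.
  rewrite normrM normfV (_ : _ + _ = (L * `|x| + L') / `|a|); last by ring.
  by rewrite ler_wpM2r ?invr_ge0//; have := Flin (th + x); rewrite (addrC th) addrK.
apply: le_trans (ler_normB _ _) _; apply: (le_trans (lerD hG (lexx _))).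
rewrite -[x ^+ 2]real_normK ?num_real// /K2 mulrDl.
have u : 1 <= `|x| / del by rewrite ler_pdivlMr// mul1r ltW.
rewrite (_ : (L / `|a| + 1) / del * `|x| ^+ 2 = (L / `|a| + 1) * `|x| * (`|x| / del)); last by ring.
rewrite (_ : L' / `|a| / del ^+ 2 * `|x| ^+ 2 = L' / `|a| * (`|x| / del) ^+ 2); last first.
  by rewrite expr_div_n; ring.
rewrite addrAC (_ : L / `|a| * `|x| + `|x| = (L / `|a| + 1) * `|x|); last by ring.
apply: lerD.
  by rewrite ler_peMr// mulr_ge0// addr_ge0// divr_ge0.
by rewrite ler_peMr ?divr_ge0// exprn_ege1.
Qed.

Lemma fin_lower (R : realFieldType) (I : finType) (i0 : I) (F : I -> R) :
  (forall i, 0 < F i) -> exists2 c : R, 0 < c & forall i, c <= F i.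
Proof.
move=> F0; have [k _ hk] := @arg_minP _ R I i0 xpredT F isT.
by exists (F k) => // i; exact: hk.
Qed.

Lemma sum_seq_sub (R : realType) (D : seq R) (F : R -> R) : uniq D ->
  \sum_(i : seq_sub D) F (ssval i) = \sum_(d <- D) F d.
Proof.
move=> Du; rewrite -(big_map (@ssval _ D) xpredT F); apply: perm_big.
apply: uniq_perm => //; first by rewrite map_inj_uniq ?index_enum_uniq//; exact: val_inj.
move=> d; apply/mapP/idP => [[i _ ->]|dD]; first exact: ssvalP.
by exists (SeqSub dD); rewrite ?mem_index_enum.
Qed.

(** * The estimator *)

Section pointwise_limit.
Context (R : realType) (s : state_space).
Local Notation Omega := (@Omega R s).
Local Notation path_space := (@path_space R s).
Variables (P : R -> R -> probability path_space R) (D : seq R) (thstar : R).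
Variables (Y : Omega -> R) (p : R -> R) (Theta : nat -> Omega -> R).
Hypothesis HP : recurrent_strong_markov_family P.
Hypothesis Duniq : uniq D.
Hypothesis Dsize : (2 <= size D)%N.
Hypothesis DS : forall d, d \in D -> Sset s d.
Hypothesis HYmeas : forall B : set R, measurable B -> F_at (tau D 2) (Y @^-1` B).
Hypothesis HYL2 : forall d, d \in D -> (\int[P thstar d]_w ((Y w) ^+ 2)%:E < +oo)%E.
Hypothesis HYint : forall th d, d \in D -> (P th d).-integrable setT (fun w => (Y w)%:E).
Hypothesis N1 : forall d, d \in D ->
  strictly_monotone (fun th => etaY P Y th d) /\
  C2 (fun th => etaY P Y th d) /\
  (forall th, derive1 (fun th => etaY P Y th d) th != 0).
Hypothesis N2 : exists L L' : R, 0 < L /\ 0 < L' /\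
  forall th d, d \in D ->
    `|etaY P Y th d - etaY P Y thstar d| <= L * `|th - thstar| + L'.
Hypothesis Hp_ge0 : forall d, d \in D -> 0 <= p d.
Hypothesis Hp_sum : \sum_(d <- D) p d = 1.
Hypothesis Hp_inv : forall d', d' \in D ->
  \sum_(d <- D) p d * Qmat P D thstar d d' = p d'.
Hypothesis HTheta_adapted : forall n, (1 <= n)%N ->
  forall B : set R, measurable B -> F_at (tau D n) (Theta n @^-1` B).
Hypothesis HTheta_rec : forall n, (1 <= n)%N -> forall w,
  Theta n.+1 w = Theta n w -
    n%:R^-1 * ((Yn D Y n.+1 w - etaY P Y (Theta n w) (Xat (tau D n) w))
               / alpha P Y thstar (Xat (tau D n) w)).

Local Notation I := (seq_sub D).
Local Notation tau := (tau_aux D).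
Let eta (i : I) th := etaY P Y th (ssval i).
Let a (i : I) := derive1 (eta i) thstar.
Let i0 : I := seq_sub_default (ltnW Dsize).
(** The position at [tau_(n+2)], as an index of [D]. On the null event where that time is infinite
    the value may lie outside [D], and the default [i0] is returned. *)
Let X n (w : Omega) : I := insubd i0 (Xat (tau n.+1) w).
Let G n := @F_at R s (tau n.+1).
Let g i x := (eta i (thstar + x) - eta i thstar) / a i.
(* Time is shifted by two, since [Y_2] need not be square integrable when the
   process starts outside [D]; the noise is read off the recursion, which makes
   it adapted and, where [tau_n] is finite, equal to [zeta] of the shifted path. *)
Let e n w := Theta n.+2 w - thstar.
Let xi n w := if n is k.+1 then - k.+2%:R * (e k.+1 w - e k w) - g (X k w) (e k w) else 0.
Let zeta i w := (Y w - eta i thstar) / alpha P Y thstar (ssval i).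

Let aN0 i : a i != 0. Proof. exact: (N1 (ssvalP i)).2.2. Qed.

Let alphaE i : alpha P Y thstar (ssval i) = - a i. Proof. by []. Qed.

Let mY : measurable_fun setT (Y : path_space -> R).
Proof. by move=> _ B mB; rewrite setTI; exact: (HYmeas mB).1. Qed.

Let X_fin n w : (tau n.+1 w < +oo)%E -> ssval (X n w) = Xat (tau n.+1) w.
Proof. by move=> fin; rewrite -[ssval _]/(val _) insubdK//; exact: (Xtau_in fin). Qed.

Let sG n : sigma_algebra setT (G n).
Proof. exact: F_at_sigma_algebra (stopping_time_tau D n.+1). Qed.

Let GT n (A : set path_space) : G n A -> measurable A. Proof. by case. Qed.

Let GS n : G n `<=` G n.+1.
Proof. by apply: F_at_le; [exact: stopping_time_tau|exact: tau_le]. Qed.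

Let GX n i : G n (X n @^-1` [set i]).
Proof.
(* The default index also receives the paths whose value lies outside [D]. *)
pose B : set R := [set ssval i] `|` (if i == i0 then ~` [set` D] else set0).
have mB : measurable B.
  apply: measurableU => //; case: ifP => _ //; apply: measurableC.
  rewrite (_ : [set` D] = \bigcup_(d in [set` D]) [set d]).
    by apply: fin_bigcup_measurable; [exact: finite_seq|].
  by apply/seteqP; split => [d dD|d [d' d'D ->]//]; exists d.
rewrite (_ : X n @^-1` _ = Xat (tau n.+1) @^-1` B); first exact: F_at_Xtau.
apply/seteqP; split=> w; rewrite /B /X /=.
  move=> <-; case: (boolP (Xat (tau n.+1) w \in D)) => XD.
    by left; rewrite -[ssval _]/(val _) insubdK.
  by right; rewrite /insubd insubN//= eqxx; exact/negP.
case=> [Xi|].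
  by apply: val_inj; rewrite /= -[ssval (insubd _ _)]/(val _) insubdK Xi//; exact: ssvalP.
by case: ifP => [/eqP ->|//] /negP XD; rewrite /insubd insubN.
Qed.

Let g_props : exists2 K : R, 0 <= K &
  forall i, {homo g i : x y / x < y} /\ forall x, `|g i x - x| <= K * x ^+ 2.
Proof.
have [L [L' [L0 [L'0 hL]]]] := N2.
have h (i : I) : {homo g i : x y / x < y} /\ exists2 K : R, 0 <= K & forall x, `|g i x - x| <= K * x ^+ 2.
  have [m [c2 _]] := N1 (ssvalP i).
  apply: (normalized_response m c2 (aN0 i) (ltW L0) (ltW L'0)).
  by move=> t; exact: hL (ssvalP i).
have h' i : exists K, forall x, `|g i x - x| <= K * x ^+ 2.
  by have [_ [K _ hK]] := h i; exists K.
have [K hK] := choice h'.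
pose K' := \sum_i `|K i|.
have KK' i : `|K i| <= K'.
  by rewrite /K' (bigD1 i)//= lerDl; apply: sumr_ge0 => j _; exact: normr_ge0.
exists K'; first by apply: sumr_ge0 => j _; exact: normr_ge0.
move=> i; split; first exact: (h i).1.
move=> x; apply: le_trans (hK i x) _.
by rewrite ler_wpM2r ?sqr_ge0// (le_trans (ler_norm _)).
Qed.

Let g0 i : g i 0 = 0. Proof. by rewrite /g addr0 subrr mul0r. Qed.

Let g_sign i x : 0 <= x * g i x.
Proof.
have [K _ /(_ i)[mono _]] := g_props.
have [x0|x0|->] := ltgtP x 0; last by rewrite mul0r.
- by rewrite mulr_le0// ltW// -(g0 i); exact: mono.
- by rewrite mulr_ge0// ltW// -(g0 i); exact: mono.
Qed.

(** Each [g i] increases through [0], so for [|x| >= del] it is in absolute value at least the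
    smaller of [g i del] and [- g i (- del)]; finiteness of [D] gives a common bound. *)
Let g_away (del : R) : 0 < del ->
  exists2 c : R, 0 < c & forall i (x : R), del <= `|x| -> c <= x * g i x.
Proof.
move=> del0; have [K _ hg] := g_props.
pose F i := Num.min (g i del) (- g i (- del)).
have F0 i : 0 < F i.
  have [mono _] := hg i.
  have := mono _ _ del0; have del0' : - del < 0 by rewrite oppr_lt0.
  by have := mono _ _ del0'; rewrite g0 lt_min oppr_gt0 => -> ->.
have [c c0 hc] := fin_lower i0 F0.
exists (del * c); first exact: mulr_gt0.
move=> i x; have [mono _] := hg i.
have homo u v : u <= v -> g i u <= g i v.
  by rewrite le_eqVlt => /orP[/eqP ->//|/mono/ltW].
have := hc i; rewrite /F le_min => /andP[c1 c2].
rewrite ler_normr => /orP[xd|xd].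
  by apply: ler_pM => //; [exact: ltW|exact: ltW|exact: le_trans c1 (homo _ _ xd)].
rewrite -[x * _]mulrNN; apply: ler_pM; [exact: ltW|exact: ltW|exact: xd|].
by apply: le_trans c2 _; rewrite lerN2; apply: homo; rewrite lerNr.
Qed.

Let g_lin : exists2 C : R, 0 <= C & forall i x, `|g i x| <= C * (1 + `|x|).
Proof.
have [L [L' [L0 [L'0 hL]]]] := N2.
have [K K0 hK] := fin_bounded (fun i => (a i)^-1).
exists ((L + L') * K); first by rewrite mulr_ge0// addr_ge0// ltW.
move=> i x; rewrite normrM mulrAC; apply: ler_pM => //.
apply: le_trans (hL _ _ (ssvalP i)) _; rewrite addrAC subrr add0r.
rewrite mulrDr mulr1 mulrDl; have := normr_ge0 x; nra.
Qed.

Let mg i : measurable_fun setT (g i).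
Proof.
apply: continuous_measurable_fun => x; have [_ [[dF _] _]] := N1 (ssvalP i).
apply: cvgM; last exact: cvg_cst.
apply: cvgB; last exact: cvg_cst.
apply: (continuous_comp (f := fun x => thstar + x)).
  by apply: cvgD; [exact: cvg_cst|exact: cvg_id].
by apply/differentiable_continuous/derivable1_diffP; exact: dF.
Qed.

Let Ge n : Gmeas (G n) (e n).
Proof.
apply: (@GmeasB _ path_space _ _ (sG n) (Theta n.+2) (cst thstar)); last exact: Gmeas_cst.
by move=> B mB; exact: HTheta_adapted.
Qed.

Let Gxi n : Gmeas (G n) (xi n).
Proof.
case: n => [|n]; first exact (@Gmeas_cst _ path_space R _ (sG 0) 0).
have Ge' : Gmeas (G n.+1) (e n) by move=> B mB; apply: GS; exact: Ge.
apply: (@GmeasB _ path_space) => //.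
  by apply: (@GmeasZ _ path_space) => //; exact: (@GmeasB _ path_space).
apply: (@Gmeas_fin _ path_space _ _ (sG n.+1) I (X n) (fun i w => g i (e n w))) => i.
  by apply: GS; exact: GX.
exact: (@Gmeas_comp _ path_space).
Qed.

Let e_rec n w : e n.+1 w = e n w - n.+2%:R^-1 * (g (X n w) (e n w) + xi n.+1 w).
Proof.
have n0 : n.+2%:R != 0 :> R by rewrite pnatr_eq0.
rewrite (_ : g _ _ + _ = - (n.+2%:R * (e n.+1 w - e n w))); last by rewrite /xi; ring.
by rewrite mulrN mulKf// opprK addrC subrK.
Qed.

(** The place where the given recursion is used. Since [alpha = - a], the two occurrences of [eta]
    at the current estimate cancel, and what remains is centred at [eta] of [thstar]. *)
Let xiE n w : (tau n.+1 w < +oo)%E -> xi n.+1 w = zeta (X n w) (shift_at (tau n.+1) w).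
Proof.
move=> fin; rewrite /zeta; set y := Y (shift_at _ w).
have yE : Yn D Y n.+3 w = y by [].
rewrite /xi /e (HTheta_rec (n := n.+2))// yE.
have XE : Xat (Defs.tau D n.+2) w = ssval (X n w) by rewrite X_fin.
rewrite XE.
have n0 : n.+2%:R != 0 :> R by rewrite pnatr_eq0.
have a0 := aN0 (X n w).
rewrite /g !alphaE (addrC thstar) subrK -[etaY _ _ _ (ssval _)]/(eta _ _).
move: n0; set N : R := n.+2%:R; move: N => N n0.
by field; rewrite ?oppr_eq0 a0 n0.
Qed.

Let mzeta (i : I) : measurable_fun setT (zeta i : path_space -> R).
Proof. by apply: measurable_funM => //; apply: measurable_funB. Qed.

Let Y2_L1 (i : I) : L1 (P thstar (ssval i)) (fun w => Y w ^+ 2).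
Proof.
apply/integrableP; split; first by apply/measurable_EFinP; exact: measurable_funX.
under eq_integral do rewrite /= ger0_norm ?sqr_ge0//.
exact: HYL2 (ssvalP i).
Qed.

Let Y_L1 (i : I) : L1 (P thstar (ssval i)) Y. Proof. exact: HYint (ssvalP i). Qed.

Let Yc2_L1 (i : I) : L1 (P thstar (ssval i)) (fun w => (Y w - eta i thstar) ^+ 2).
Proof.
have h := L1D (Y2_L1 i) (L1_cst (Pr := P thstar (ssval i)) (eta i thstar ^+ 2)).
apply: (L1_le _ (L1Zl 2 h)).
  by apply: measurable_funX; exact: measurable_funB.
move=> w; rewrite ger0_norm ?sqr_ge0//= /cst.
by have := sqr_ge0 (Y w + eta i thstar); nra.
Qed.

Let zeta2E (i : I) w : zeta i w ^+ 2 = (alpha P Y thstar (ssval i) ^+ 2)^-1 * (Y w - eta i thstar) ^+ 2.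
Proof. by rewrite /zeta expr_div_n mulrC. Qed.

Let zeta2 (i : I) : L1 (P thstar (ssval i)) (fun w => zeta i w ^+ 2).
Proof.
rewrite (_ : (fun w => _) = (fun w => (alpha P Y thstar (ssval i) ^+ 2)^-1 * (Y w - eta i thstar) ^+ 2)).
  by apply: L1Zl; exact: Yc2_L1.
by apply/funext => w; rewrite zeta2E.
Qed.

Let zeta_mean (i : I) : Rintegral (P thstar (ssval i)) setT (zeta i) = 0.
Proof.
rewrite /zeta; under eq_Rintegral do rewrite mulrC.
have Lc := L1_cst (Pr := P thstar (ssval i)) (eta i thstar).
rewrite ExpZl; last exact: (L1B (Y_L1 i) Lc).
rewrite (ExpB (Y_L1 i) Lc) Exp_cst.
have -> : Rintegral (P thstar (ssval i)) setT Y = eta i thstar by [].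
by rewrite subrr mulr0.
Qed.

Section started_at_x.
Variables (x : R) (xS : Sset s x).

Let ae_X n : {ae P thstar x, forall w, (tau n.+1 w < +oo)%E}.
Proof. exact: ae_tau_fin. Qed.

Let mXi n i : measurable (X n @^-1` [set i] : set path_space).
Proof. exact: GT (GX n i). Qed.

Let mXat n d : measurable (Xat (tau n) @^-1` [set d] : set path_space).
Proof. exact: measurable_Xtau1. Qed.

Let X_Xat n (A : set path_space) (i : I) : measurable A ->
  P thstar x (A `&` X n @^-1` [set i]) = P thstar x (A `&` Xat (tau n.+1) @^-1` [set ssval i]).
Proof.
move=> mA; apply: prob_eq_ae; [exact: measurableI|exact: measurableI|].
apply: aeS (ae_X n) => w fin; split => -[Aw /= Xw]; split => //=.
  by rewrite -X_fin// Xw.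
by apply: val_inj; rewrite /= X_fin.
Qed.

Let xi_law n A (i : I) C : G n A -> measurable C ->
  P thstar x (A `&` X n @^-1` [set i] `&` xi n.+1 @^-1` C) =
  (P thstar x (A `&` X n @^-1` [set i]) * P thstar (ssval i) (zeta i @^-1` C))%E.
Proof.
move=> GA mC; rewrite X_Xat; last exact: GT GA.
have mzC : measurable (zeta i @^-1` C : set path_space).
  by rewrite -[X in measurable X]setTI; exact: mzeta.
rewrite -(strong_markov_tau thstar HP Duniq Dsize DS (ssval i) xS GA mzC).
have mA := GT GA.
apply: prob_eq_ae.
- apply: measurableI; first exact: measurableI.
  by rewrite -[X in measurable X]setTI; exact: (Gmeas_measurable (@GT n.+1) (Gxi n.+1)).
- apply: measurableI; first exact: measurableI.
  by rewrite -[X in measurable X]setTI; exact: (measurable_shift_tau D n.+1 measurableT mzC).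
apply: aeS (ae_X n) => w fin.
have E : X n w = i -> xi n.+1 w = zeta i (shift_at (tau n.+1) w).
  by move=> <-; exact: xiE.
split=> -[[Aw Xw] zC].
  have Xi : X n w = i := Xw.
  have zC' : C (xi n.+1 w) := zC; rewrite (E Xi) in zC'.
  by split; [split => //; rewrite /preimage /mkset -X_fin// Xi|exact: zC'].
have Xi : X n w = i by apply: val_inj; rewrite -[val (X n w)]/(ssval (X n w)) X_fin.
split; first by split.
by have zC' : C (zeta i (shift_at (tau n.+1) w)) := zC; rewrite -(E Xi) in zC'.
Qed.

Let X_law n A (i j : I) : G n A ->
  fine (P thstar x (A `&` X n @^-1` [set i] `&` X n.+1 @^-1` [set j])) =
  fine (P thstar x (A `&` X n @^-1` [set i])) * Qmat P D thstar (ssval i) (ssval j).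
Proof.
move=> GA; have mA := GT GA.
rewrite X_Xat; last exact: measurableI.
rewrite setIAC X_Xat; last exact: measurableI.
rewrite setIAC (Xtau_law thstar HP Duniq Dsize DS (ssval i) (ssval j) xS GA) X_Xat//.
rewrite fineM// fin_num_measure//; last exact: measurableI.
Qed.

(** The variance is the same for every starting point [x], which is what permits mixing over the
    initial law. *)
Lemma pointwise_clt (f : R -> R) : continuous f ->
  (exists M : R, forall x, `|f x| <= M) ->
  Rintegral (P thstar x) setT (fun w => f (Num.sqrt n%:R * (Theta n w - thstar)))
    @[n --> \oo] -->
  Rintegral (normal_prob 0 1) setT (fun z : R => f (Num.sqrt (sigma2 P Y D p thstar) * z)).
Proof.
(* [e n] is the error of [Theta n.+2]. *)
move=> cf bf; rewrite -(cvg_shiftn 2).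
have [C C0 hC] := g_lin; have [K K0 hK] := g_props.
have psum : \sum_(i : I) p (ssval i) = 1 by rewrite sum_seq_sub.
have pinv (j : I) : \sum_(i : I) p (ssval i) * Qmat P D thstar (ssval i) (ssval j) = p (ssval j).
  by rewrite (sum_seq_sub (fun d => p d * Qmat P D thstar d (ssval j)))// Hp_inv// ssvalP.
have Qirr := @Xtau_harmonic _ _ _ thstar _ HP Duniq Dsize DS.
have := @robbins_monro_clt _ _ R (P thstar x) _ _ I X xi G sG GT GS GX Gxi
  (fun i => P thstar (ssval i)) zeta (fun i j => Qmat P D thstar (ssval i) (ssval j))
  (fun i => p (ssval i)) mzeta zeta2 zeta_mean xi_law X_law
  (fun i => Hp_ge0 (ssvalP i)) psum pinv Qirr e g Ge mg e_rec C K C0 K0 hC g_sign g_away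
  (fun i => (hK i).2) f cf bf.
rewrite (_ : \sum_i _ = sigma2 P Y D p thstar); last first.
  rewrite /sigma2 -sum_seq_sub//; apply: eq_bigr => i _; congr (_ * _).
  rewrite (_ : (fun w => _) = (fun w => (alpha P Y thstar (ssval i) ^+ 2)^-1 * (Y w - eta i thstar) ^+ 2)).
    by rewrite ExpZl// mulrC.
  by apply/funext => w; rewrite zeta2E.
move=> h; rewrite (_ : [sequence _]_n =
    (fun n => Rintegral (P thstar x) setT (fun w => f (Num.sqrt n.+2%:R * e n w)))).
  exact: h.
by apply/funext => n; rewrite /= addn2.
Qed.

End started_at_x.
End pointwise_limit.

(** * Integration over the initial law *)

Import HBNNSimple.

(* the integrands need not be measurable, so [ae_eq_integral] does not apply *)
Lemma integral_eq_off_null d (T : measurableType d) (R : realType)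
    (mu : {measure set T -> \bar R}) (A : set T) (f g : T -> \bar R) :
  measurable A -> mu (~` A) = 0 -> (forall x, A x -> f x = g x) ->
  (\int[mu]_x f x = \int[mu]_x g x)%E.
Proof.
move=> mA A0 fg.
have le (u v : T -> \bar R) : (forall x, 0 <= u x)%E -> (forall x, 0 <= v x)%E ->
    (forall x, A x -> u x = v x) -> (\int[mu]_x u x <= \int[mu]_x v x)%E.
  move=> u0 v0 uv; rewrite !ge0_integralTE//; apply: ge_ereal_sup => _ [h /= hu <-].
  apply: ereal_sup_ubound; exists (proj_nnsfun h mA) => /=.
    move=> x; rewrite mindicE; have [/set_mem Ax|_] := boolP (x \in A).
      by rewrite mulr1 -uv.
    by rewrite mulr0.
  rewrite -!integralT_nnsfun; apply: ae_eq_integral => //.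
  - by apply/measurable_EFinP; exact: measurable_funPT.
  - by apply/measurable_EFinP; exact: measurable_funPT.
  exists (~` A); split => //; first exact: measurableC.
  move=> x /= + Ax; apply => _; rewrite mindicE mem_set//= mulr1//.
have eq (u v : T -> \bar R) : (forall x, 0 <= u x)%E -> (forall x, 0 <= v x)%E ->
    (forall x, A x -> u x = v x) -> (\int[mu]_x u x = \int[mu]_x v x)%E.
  by move=> u0 v0 uv; apply/le_anti; rewrite !le// => x Ax; rewrite uv.
rewrite integralE [RHS]integralE; congr (_ - _)%E; apply: eq => // x Ax.
  by rewrite !funepos.unlock fg.
by rewrite !funeneg.unlock fg.
Qed.

Lemma measurable_Sset (R : realType) (s : state_space) : measurable (@Sset R s).
Proof.
case: s => /=; first exact: measurableT.
  rewrite (_ : [set x | 0 <= x] = `[0, +oo[%classic)//.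
  by apply/seteqP; split => x /=; rewrite in_itv/= andbT.
rewrite (_ : [set x | 0 < x] = `]0, +oo[%classic)//.
by apply/seteqP; split => x /=; rewrite in_itv/= andbT.
Qed.

Section mixture.
Context (R : realType) (s : state_space) (P : R -> probability (@path_space R s) R).
Hypothesis mP : forall A : set (@path_space R s), measurable A ->
  measurable_fun (Sset s) ((fun x => P x A) : R -> \bar R).
Variable mu : probability R R.
Hypothesis muS : mu (Sset s) = 1%E.

Let S : set R := Sset s.
Let mS : measurable S. Proof. exact: measurable_Sset. Qed.

(** The kernel is measurable only on [S]. Points outside, which form a [mu]-null set, are redirected
    to the state 1, common to all three state spaces. *)
Let x1 (x : R) : R := if x \in S then x else 1.

Let x1S x : S (x1 x).
Proof. by rewrite /x1; case: ifPn => [/set_mem//|_]; exact: one_in_Sset. Qed.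

Let mk (A : set (@path_space R s)) : measurable A ->
  measurable_fun setT (fun x => P (x1 x) A).
Proof.
move=> mA; rewrite (_ : (fun x => _) = (fun x => if x \in S then P x A else P 1 A)).
  have SE : (fun x => x \in S) @^-1` [set true] = S.
    by apply/seteqP; split => x; [exact: set_mem|exact: mem_set].
  apply: measurable_fun_if => //.
  - apply: (measurable_fun_bool true) => //.
    by rewrite setTI SE.
  - by rewrite setTI SE; exact: mP.
by apply/funext => x; rewrite /x1; case: ifP.
Qed.

Lemma mixture_cvg (F : nat -> @path_space R s -> R) (M c : R) :
  (forall n, measurable_fun setT (F n)) -> (forall n w, `|F n w| <= M) ->
  (forall x, Sset s x -> Rintegral (P x) setT (F n) @[n --> \oo] --> c) ->
  (\int[mu]_x (\int[P x]_w (F n w)%:E))%E @[n --> \oo] --> c%:E.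
Proof.
move=> mF bF cF.
have LF n x : L1 (P x) (F n) by exact: L1_bounded.
have muSC : mu (~` S) = 0%E by rewrite probability_setC// muS subee.
pose H n x := Rintegral (P (x1 x)) setT (F n).
have mH n : measurable_fun setT (H n).
  (* Adding [M] makes the integrand nonnegative, as the measurability of kernel integrals
     requires. *)
  have m1 : measurable_fun setT (fun x => \int[P (x1 x)]_w (F n w + M)%:E)%E.
    apply: (@measurable_fun_integral_kernel _ _ _ _ _ (fun x => P (x1 x))) => //.
    - by move=> w; rewrite lee_fin; have := bF n w; rewrite ler_norml -lerBlDr sub0r => /andP[].
    - by apply/measurable_EFinP; exact: measurable_funD.
  rewrite (_ : H n = (fun x => fine (\int[P (x1 x)]_w (F n w + M)%:E) - M)).
    apply: measurable_funB => //.
    exact: measurableT_comp (fine_measurable measurableT) m1.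
  apply/funext => x; rewrite -[fine _]/(Rintegral (P (x1 x)) setT (fun w => F n w + M)).
  by rewrite (ExpD (LF n _) (L1_cst M)) (Exp_cst _ M) addrK.
have bH n x : `|H n x| <= M.
  rewrite -(Exp_cst (P (x1 x)) M); apply: Exp_abs_le => //; exact: L1_cst.
(* Outside [S] the inner integral may depend on [x] in a non-measurable way; it is exchanged for
   [H n] off a null set. *)
rewrite (_ : (fun n => _) = (fun n => \int[mu]_x (H n x)%:E)%E); last first.
  apply/funext => n; apply: (integral_eq_off_null mS muSC) => x Sx.
  by rewrite Exp_eq_EFin// /H /x1 mem_set.
have -> : c%:E = (\int[mu]_x (cst c x)%:E)%E.
  by rewrite (Exp_eq_EFin (L1_cst c)) Exp_cst.
apply: (@dominated_cvg _ _ _ mu setT measurableT _ _ (cst M%:E)) => //.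
- by move=> n; apply/measurable_EFinP.
- by move=> x _; apply: cvg_EFin; [exact: nearW|exact: cF (x1S x)].
- exact: (L1_cst M).
- by move=> n x _; rewrite lee_fin.
Qed.

End mixture.
Theorem theorem4p1 (R : realType) (s : state_space)
  (P : R -> R -> probability (path_space s) R)
  (HP : recurrent_strong_markov_family P)
  (D : seq R) (HDuniq : uniq D) (HDsize : (2 <= size D)%N)
  (HDS : forall d, d \in D -> Sset s d)
  (thstar : R)
  (mu : probability R R) (Hmu : mu (Sset s) = 1%E)
  (Y : @Omega R s -> R)
  (HYmeas : forall B : set R, measurable B -> F_at (tau D 2) (Y @^-1` B))
  (HYlb : exists c : R, forall w, c <= Y w)
  (HYL2 : forall d, d \in D ->
     (\int[P thstar d]_w ((Y w) ^+ 2)%:E < +oo)%E)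
  (HYint : forall th d, d \in D -> (P th d).-integrable setT (fun w => (Y w)%:E))
  (N1 : forall d, d \in D ->
     strictly_monotone (fun th => etaY P Y th d) /\
     C2 (fun th => etaY P Y th d) /\
     (forall th, derive1 (fun th => etaY P Y th d) th != 0))
  (N2 : exists L L' : R, 0 < L /\ 0 < L' /\
     forall th d, d \in D ->
       `|etaY P Y th d - etaY P Y thstar d| <= L * `|th - thstar| + L')
  (p : R -> R)
  (Hp_ge0 : forall d, d \in D -> 0 <= p d)
  (Hp_sum : \sum_(d <- D) p d = 1)
  (Hp_inv : forall d', d' \in D ->
     \sum_(d <- D) p d * Qmat P D thstar d d' = p d')
  (Theta : nat -> @Omega R s -> R)
  (HTheta_adapted : forall n, (1 <= n)%N ->
     forall B : set R, measurable B -> F_at (tau D n) (Theta n @^-1` B))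
  (HTheta1_L2 :
     (\int[mu]_x (\int[P thstar x]_w ((Theta 1%N w) ^+ 2)%:E) < +oo)%E)
  (HTheta_rec : forall n, (1 <= n)%N -> forall w,
     Theta n.+1 w = Theta n w -
       n%:R^-1 * ((Yn D Y n.+1 w - etaY P Y (Theta n w) (Xat (tau D n) w))
                  / alpha P Y thstar (Xat (tau D n) w))) :
  forall f : R -> R, continuous f -> (exists M : R, forall x, `|f x| <= M) ->
    (fun n : nat =>
       \int[mu]_x (\int[P thstar x]_w
          (f (Num.sqrt n%:R * (Theta n w - thstar)))%:E))%E
    @ \oo --> (\int[normal_prob 0 1]_z
                 (f (Num.sqrt (sigma2 P Y D p thstar) * z))%:E)%E.

Proof.
move=> f cf [M fM].
have [_ [mP _]] := HP.
have mTheta n : measurable_fun setT (Theta n.+1 : path_space s -> R).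
  by move=> _ B mB; rewrite setTI; have [] := HTheta_adapted n.+1 isT B mB.
have mf : measurable_fun setT f by exact: continuous_measurable_fun.
pose F n (w : path_space s) := f (Num.sqrt n%:R * (Theta n w - thstar)).
pose c := Rintegral (normal_prob 0 1) setT (fun z : R => f (Num.sqrt (sigma2 P Y D p thstar) * z)).
have -> : (\int[normal_prob 0 1]_z (f (Num.sqrt (sigma2 P Y D p thstar) * z))%:E)%E = c%:E.
  apply: Exp_eq_EFin; apply: (L1_bounded (M := M)) => // .
  apply: measurableT_comp => //; exact: measurable_funM.
(* [Theta 0] is unconstrained: adaptedness, hence measurability, starts at index 1. *)
rewrite -cvg_shiftS.
apply: (@mixture_cvg _ _ (P thstar) (mP thstar) mu Hmu (fun n => F n.+1) M c) => //.
  move=> n; apply: measurableT_comp => //; apply: measurable_funM => //.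
  exact: measurable_funB.
  by move=> n w; exact: fM.
move=> x xS; have bf : exists M, forall x, `|f x| <= M by exists M.
have := pointwise_clt HP HDuniq HDsize HDS HYmeas HYL2 HYint N1 N2 Hp_ge0 Hp_sum Hp_inv
  HTheta_adapted HTheta_rec xS cf bf.
by rewrite -cvg_shiftS.
Qed.
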